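(* Fix a finite signature $\tau$ and $k,k'\in\mathbb{N}$. The separator synthesis problem for $\mathrm{FO\text{-}LFP}(k,k')$ is decidable in $\mathsf{EXPTIME}$: there is an algorithm that, given finite sets $\mathit{Pos},\mathit{Neg}$ of finite $\tau$-structures and a regular tree grammar $G$ over $\Sigma_{\mathrm{FO\text{-}LFP}(k,k')}$, runs in time exponential in the input size and either outputs a sentence $\varphi\in L(G)$ true in every structure of $\mathit{Pos}$ and false in every structure of $\mathit{Neg}$, or correctly answers ''No'' if none exists.
   Context: A signature $\tau$ has relation, function and constant symbols; structures are finite. $\mathrm{FO\text{-}LFP}$ has syntax $\varphi::=\mathsf{let}\ P(\bar x)=_{\mathsf{lfp}}\psi\ \mathsf{in}\ \varphi\mid\exists x.\varphi\mid\forall x.\varphi\mid R(\bar t)\mid P(\bar t)\mid\varphi\vee\varphi\mid\varphi\wedge\varphi\mid\neg\varphi$, $\psi::=\exists x.\psi\mid\forall x.\psi\mid R(\bar t)\mid P(\bar t)\mid\psi\vee\psi\mid\psi\wedge\psi\mid\neg\psi$, $t::=x\mid c\mid f(\bar t)\mid\mathsf{ite}(\psi,t,t')$, where $R,f,c\in\tau$, $P$ ranges over definable relation symbols disjoint from $\tau$, every occurrence of $P$ in its defining $\psi$ is under an even number of negations, and relations are defined before use. Semantics: $A\models \mathsf{let}\ P(\bar x)=_{\mathsf{lfp}}\psi(\bar x,P)\ \mathsf{in}\ \varphi(P)$ iff $A\models\varphi$ with $P$ interpreted as the least fixed point of the monotone operator $F_\psi(Y)=\{\bar a\in\mathrm{dom}(A)^{\mathrm{ar}(P)}: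 A\models\psi(\bar a,Y)\}$; a symbol may be redefined later, the inner definition shadowing the outer; other constructs are interpreted as in first-order logic ($\mathsf{ite}(\psi,t_1,t_2)$ is $t_1$ if $\psi$ holds, else $t_2$). $\mathrm{FO\text{-}LFP}(k,k')$ restricts to first-order variables $V=\{x_1,\dots,x_k\}$ and definable symbols $\{P_1,\dots,P_{k'}\}$ (both reusable). Its formulas are trees over the finite ranked alphabet consisting of $\{R^{\mathrm{ar}(R)},f^{\mathrm{ar}(f)}: R,f\in\tau\}\cup\{\mathsf{ite}^3,\wedge^2,\vee^2,\neg^1\}\cup\{\forall x^1,\exists x^1,x^0:x\in V\}$ together with binary symbols $\mathsf{let}\,P(\bar x)$ (children: the definition body and the rest of the formula) and symbols $P$ of arity $\mathrm{ar}(P)$, for $P\in\{P_1,\dots,P_{k'}\}$, $\bar x\in V^{\mathrm{ar}(P)}$. A regular tree grammar $G=\langle N,\Sigma,S,P\rangle$ has nonterminals $N$, axiom $S$ and rules $B\to t$ ($t$ a tree over $\Sigma\cup N$); $L(G)$ is the set of trees over $\Sigma$ derivable from $S$.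
   Formalization: The sentence is output with shared subtrees (as a DAG), since smallest separators can be doubly exponential as trees; as P in an ite guard can break monotonicity, two readings are covered: P barred from guards, or literal negation count with P obtained by iteration from the empty relation. *)

(* Defs.v *)
From Stdlib Require Import List Relation_Operators.
From mathcomp Require Import all_boot.

Set Implicit Arguments.
Unset Strict Implicit.
Unset Printing Implicit Defensive.

(** * Signatures and finite structures *)

(* Constant symbols are function symbols of arity 0. *)
Record signature := Signature {
  nrel : nat;
  nfun : nat;
  rar : 'I_nrel -> nat;
  far : 'I_nfun -> nat }.

(* Domains are nonempty, as usual in first-order logic. *)
Record structure (tau : signature) := Structure {
  predsize : nat;
  irel : forall R : 'I_(nrel tau), {set (rar R).-tuple 'I_predsize.+1};
  ifun : forall f : 'I_(nfun tau),
    {ffun (far f).-tuple 'I_predsize.+1 -> 'I_predsize.+1} }.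

Notation dom A := ('I_(predsize A).+1).

(** * Trees and regular tree grammars *)

Inductive tree (T : Type) : Type := Node of T & seq (tree T).

Fixpoint map_tree T U (h : T -> U) (t : tree T) : tree U :=
  let: Node a ts := t in Node (h a) (map (map_tree h) ts).

(* [ranked rk t]: every node has as many children as its label prescribes;
   [rk a = None] forbids the label [a] altogether. *)
Fixpoint ranked T (rk : T -> option nat) (t : tree T) : bool :=
  let: Node a ts := t in (rk a == Some (size ts)) && all (ranked rk) ts.

(* The nonterminals are the numbers below [nnt]; a tree over Sigma and the
   nonterminals is a tree with labels in [T + nat]. *)
Record grammar (T : Type) := Grammar {
  nnt : nat;
  axm : nat;
  rules : seq (nat * tree (T + nat)) }.

Definition wf_grammar T (rank : T -> nat) (G : grammar T) : bool :=
  let rk (a : T + nat) := match a with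
    | inl b => Some (rank b)
    | inr B => if B < nnt G then Some 0 else None
    end in
  (axm G < nnt G) && all (fun r => (r.1 < nnt G) && ranked rk r.2) (rules G).

Inductive gstep T (G : grammar T) : tree (T + nat) -> tree (T + nat) -> Prop :=
| GRoot B t : List.In (B, t) (rules G) -> gstep G (Node (inr B) [::]) t
| GChild a ts1 t t' ts2 : gstep G t t' ->
    gstep G (Node a (ts1 ++ t :: ts2)) (Node a (ts1 ++ t' :: ts2)).

Definition lang T (G : grammar T) (t : tree T) : Prop :=
  clos_refl_trans _ (gstep G) (Node (inr (axm G)) [::]) (map_tree inl t).

(** * FO-LFP(k, k') *)

(* The first-order variables are x_i for [i : 'I_k], the definable symbols are
   P_j for [j : 'I_k'], and [par j] is the arity of P_j. *)
Section FOLFP.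
Variables (tau : signature) (k k' : nat) (par : 'I_k' -> nat).

Inductive term : Type :=
| TVar of 'I_k
| TApp (f : 'I_(nfun tau)) of ('I_(far f) -> term)
| TIte of psi & term & term
with psi : Type :=
| PEx of 'I_k & psi
| PAll of 'I_k & psi
| PRel (R : 'I_(nrel tau)) of ('I_(rar R) -> term)
| PDef (P : 'I_k') of ('I_(par P) -> term)
| POr of psi & psi
| PAnd of psi & psi
| PNot of psi.

Inductive phi : Type :=
| FLet (P : 'I_k') of (par P).-tuple 'I_k & psi & phi
| FEx of 'I_k & phi
| FAll of 'I_k & phi
| FRel (R : 'I_(nrel tau)) of ('I_(rar R) -> term)
| FDef (P : 'I_k') of ('I_(par P) -> term)
| FOr of phi & phi
| FAnd of phi & phi
| FNot of phi.

(** ** Semantics *)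

Section Semantics.
Variable A : structure tau.

Definition assignment := {ffun 'I_k -> dom A}.
Definition env := forall P : 'I_k', {set (par P).-tuple (dom A)}.

Definition upd (s : assignment) (x : 'I_k) (d : dom A) : assignment :=
  [ffun y => if y == x then d else s y].

Fixpoint teval (I : env) (s : assignment) (t : term) : dom A :=
  match t with
  | TVar x => s x
  | TApp f ts => ifun A f [tuple teval I s (ts i) | i < far f]
  | TIte c t1 t2 => if psat I s c then teval I s t1 else teval I s t2
  end
with psat (I : env) (s : assignment) (p : psi) : bool :=
  match p with
  | PEx x p => [exists d, psat I (upd s x d) p]
  | PAll x p => [forall d, psat I (upd s x d) p]
  | PRel R ts => [tuple teval I s (ts i) | i < rar R] \in irel A R
  | PDef P ts => [tuple teval I s (ts i) | i < par P] \in I P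
  | POr p q => psat I s p || psat I s q
  | PAnd p q => psat I s p && psat I s q
  | PNot p => ~~ psat I s p
  end.

(* F_psi(Y): the free variables of [p] are among [xs] in every well-formed
   formula, so [p] holds at [a] iff it holds under some assignment sending the
   tuple of variables [xs] to [a]. *)
Definition lfp_op (I : env) (P : 'I_k') (xs : (par P).-tuple 'I_k) (p : psi)
    (Y : {set (par P).-tuple (dom A)}) : {set (par P).-tuple (dom A)} :=
  [set a | [exists s : assignment,
     (map_tuple s xs == a) && psat (dfwith I Y) s p]].

(* [fixset F] is the least fixed point of [F] when [F] is monotone; see
   [lfp_op_fixset] and [lfp_op_least]. *)
Fixpoint fsat (I : env) (s : assignment) (p : phi) : bool :=
  match p with
  | FLet P xs d p => fsat (dfwith I (fixset (lfp_op I xs d))) s p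
  | FEx x p => [exists d, fsat I (upd s x d) p]
  | FAll x p => [forall d, fsat I (upd s x d) p]
  | FRel R ts => [tuple teval I s (ts i) | i < rar R] \in irel A R
  | FDef P ts => [tuple teval I s (ts i) | i < par P] \in I P
  | FOr p q => fsat I s p || fsat I s q
  | FAnd p q => fsat I s p && fsat I s q
  | FNot p => ~~ fsat I s p
  end.

(* Only used on sentences, whose value does not depend on the initial
   environment and assignment. *)
Definition models (p : phi) : bool :=
  fsat (fun P => set0) [ffun => ord0] p.

End Semantics.

(** ** Static conditions *)

Fixpoint tfv (t : term) : {set 'I_k} :=
  match t with
  | TVar x => [set x]
  | TApp f ts => \bigcup_i tfv (ts i)
  | TIte c t1 t2 => pfv c :|: tfv t1 :|: tfv t2
  end
with pfv (p : psi) : {set 'I_k} :=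
  match p with
  | PEx x p | PAll x p => pfv p :\ x
  | PRel R ts => \bigcup_i tfv (ts i)
  | PDef P ts => \bigcup_i tfv (ts i)
  | POr p q | PAnd p q => pfv p :|: pfv q
  | PNot p => pfv p
  end.

Fixpoint ffv (p : phi) : {set 'I_k} :=
  match p with
  | FLet P xs d p => (pfv d :\: [set x in xs]) :|: ffv p
  | FEx x p | FAll x p => ffv p :\ x
  | FRel R ts => \bigcup_i tfv (ts i)
  | FDef P ts => \bigcup_i tfv (ts i)
  | FOr p q | FAnd p q => ffv p :|: ffv q
  | FNot p => ffv p
  end.

(* The definable symbols occurring in a term or in a formula without [let]. *)
Fixpoint tdefs (t : term) : {set 'I_k'} :=
  match t with
  | TVar _ => set0
  | TApp f ts => \bigcup_i tdefs (ts i)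
  | TIte c t1 t2 => pdefs c :|: tdefs t1 :|: tdefs t2
  end
with pdefs (p : psi) : {set 'I_k'} :=
  match p with
  | PEx _ p | PAll _ p => pdefs p
  | PRel R ts => \bigcup_i tdefs (ts i)
  | PDef P ts => P |: \bigcup_i tdefs (ts i)
  | POr p q | PAnd p q => pdefs p :|: pdefs q
  | PNot p => pdefs p
  end.

(* [ppos strict P e p]: every occurrence of P in p is under a number of
   negations of the parity of [e] ([true] for even).  A guard of an [ite] can
   be passed without crossing a negation although [ite] is not monotone in it:
   R(ite(q, t, u)) is equivalent to (q /\ R(t)) \/ (~ q /\ R(u)).  If [strict]
   is [false], negations are counted literally; if [strict] is [true], an
   occurrence in a guard counts as being under negations of both parities, and
   is thus excluded. *)
Fixpoint tpos (strict : bool) (P : 'I_k') (e : bool) (t : term) : bool :=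
  match t with
  | TVar _ => true
  | TApp f ts => [forall i, tpos strict P e (ts i)]
  | TIte c t1 t2 =>
      [&& if strict then P \notin pdefs c else ppos strict P e c,
          tpos strict P e t1 & tpos strict P e t2]
  end
with ppos (strict : bool) (P : 'I_k') (e : bool) (p : psi) : bool :=
  match p with
  | PEx _ p | PAll _ p => ppos strict P e p
  | PRel R ts => [forall i, tpos strict P e (ts i)]
  | PDef Q ts => ((Q == P) ==> e) && [forall i, tpos strict P e (ts i)]
  | POr p q | PAnd p q => ppos strict P e p && ppos strict P e q
  | PNot p => ppos strict P (~~ e) p
  end.

(* [fwf strict D p]: p is well formed where the symbols in D are already
   defined.  The body of a definition has no free variables besides the formal
   parameters. *)
Fixpoint fwf (strict : bool) (D : {set 'I_k'}) (p : phi) : bool :=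
  match p with
  | FLet P xs d p =>
      [&& pfv d \subset [set x in xs], pdefs d \subset P |: D,
          ppos strict P true d & fwf strict (P |: D) p]
  | FEx _ p | FAll _ p => fwf strict D p
  | FRel R ts => [forall i, tdefs (ts i) \subset D]
  | FDef P ts => (P \in D) && [forall i, tdefs (ts i) \subset D]
  | FOr p q | FAnd p q => fwf strict D p && fwf strict D q
  | FNot p => fwf strict D p
  end.

Definition sentence (strict : bool) (p : phi) : bool :=
  fwf strict set0 p && (ffv p == set0).

(** ** Formulas as ranked trees *)

Inductive sym : Type :=
| SRel of 'I_(nrel tau)
| SFun of 'I_(nfun tau)
| SIte | SAnd | SOr | SNot
| SAll of 'I_k
| SEx of 'I_k
| SVar of 'I_k
| SLet (P : 'I_k') of (par P).-tuple 'I_k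
| SDef of 'I_k'.

Definition rank (a : sym) : nat :=
  match a with
  | SRel R => rar R
  | SFun f => far f
  | SIte => 3
  | SAnd | SOr | SLet _ _ => 2
  | SNot | SAll _ | SEx _ => 1
  | SVar _ => 0
  | SDef P => par P
  end.

Fixpoint tree_of_term (t : term) : tree sym :=
  match t with
  | TVar x => Node (SVar x) [::]
  | TApp f ts => Node (SFun f) [seq tree_of_term (ts i) | i <- enum 'I_(far f)]
  | TIte c t1 t2 =>
      Node SIte [:: tree_of_psi c; tree_of_term t1; tree_of_term t2]
  end
with tree_of_psi (p : psi) : tree sym :=
  match p with
  | PEx x p => Node (SEx x) [:: tree_of_psi p]
  | PAll x p => Node (SAll x) [:: tree_of_psi p]
  | PRel R ts => Node (SRel R) [seq tree_of_term (ts i) | i <- enum 'I_(rar R)]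
  | PDef P ts => Node (SDef P) [seq tree_of_term (ts i) | i <- enum 'I_(par P)]
  | POr p q => Node SOr [:: tree_of_psi p; tree_of_psi q]
  | PAnd p q => Node SAnd [:: tree_of_psi p; tree_of_psi q]
  | PNot p => Node SNot [:: tree_of_psi p]
  end.

Fixpoint tree_of_phi (p : phi) : tree sym :=
  match p with
  | FLet P xs d p => Node (SLet xs) [:: tree_of_psi d; tree_of_phi p]
  | FEx x p => Node (SEx x) [:: tree_of_phi p]
  | FAll x p => Node (SAll x) [:: tree_of_phi p]
  | FRel R ts => Node (SRel R) [seq tree_of_term (ts i) | i <- enum 'I_(rar R)]
  | FDef P ts => Node (SDef P) [seq tree_of_term (ts i) | i <- enum 'I_(par P)]
  | FOr p q => Node SOr [:: tree_of_phi p; tree_of_phi q]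
  | FAnd p q => Node SAnd [:: tree_of_phi p; tree_of_phi q]
  | FNot p => Node SNot [:: tree_of_phi p]
  end.

(** ** In the strict reading, defined relations are least fixed points *)

Section LeastFixedPoint.
Variable A : structure tau.

Scheme term_psi_ind := Induction for term Sort Prop
with psi_term_ind := Induction for psi Sort Prop.
Combined Scheme term_psi_mutind from term_psi_ind, psi_term_ind.

Let agree (P : 'I_k') (I J : env A) := forall Q, Q != P -> I Q = J Q.

Lemma defs_agree P (I J : env A) : agree P I J ->
  (forall t s, P \notin tdefs t -> teval I s t = teval J s t) /\
  (forall p s, P \notin pdefs p -> psat I s p = psat J s p).
Proof.
move=> IJ.
have args n (ts : 'I_n -> term) s :
    (forall i s, P \notin tdefs (ts i) -> teval I s (ts i) = teval J s (ts i)) ->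
    P \notin \bigcup_i tdefs (ts i) ->
    [tuple teval I s (ts i) | i < n] = [tuple teval J s (ts i) | i < n].
  move=> IH /bigcupP nP; apply: eq_from_tnth => i; rewrite !tnth_mktuple.
  by apply: IH; apply/negP => Pi; apply: nP; exists i.
apply: term_psi_mutind => /=.
- by [].
- by move=> f ts IH s nP; rewrite (args _ ts).
- move=> c IHc t IHt u IHu s; rewrite !inE !negb_or => /andP[/andP[nc nt] nu].
  by rewrite IHc ?IHt ?IHu.
- by move=> x p IH s nP; apply: eq_existsb => d; rewrite IH.
- by move=> x p IH s nP; apply: eq_forallb => d; rewrite IH.
- by move=> R ts IH s nP; rewrite (args _ ts).
- move=> Q ts IH s; rewrite !inE negb_or eq_sym => /andP[QP nP].
  by rewrite (args _ ts) // IJ.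
- by move=> p IHp q IHq s; rewrite inE negb_or => /andP[np nq];
    rewrite IHp ?IHq.
- by move=> p IHp q IHq s; rewrite inE negb_or => /andP[np nq];
    rewrite IHp ?IHq.
- by move=> p IH s nP; rewrite IH.
Qed.

Lemma tpos_defs P :
  (forall t e, tpos true P e t -> P \notin tdefs t) /\
  (forall p : psi, True).
Proof.
have args n (ts : 'I_n -> term) e :
    (forall i e, tpos true P e (ts i) -> P \notin tdefs (ts i)) ->
    [forall i, tpos true P e (ts i)] -> P \notin \bigcup_i tdefs (ts i).
  by move=> IH /forallP h; apply/bigcupP => -[i _]; apply/negP/(IH i e).
apply: term_psi_mutind => //=.
- by move=> x e _; rewrite inE.
- by move=> f ts IH e; apply: args.
- move=> c _ t IHt u IHu e /and3P[nc /IHt nt /IHu nu].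
  by rewrite !inE !negb_or nc nt.
Qed.

Lemma psat_mono P (I J : env A) : agree P I J -> I P \subset J P ->
  forall p s e, ppos true P e p ->
    if e then psat I s p -> psat J s p else psat J s p -> psat I s p.
Proof.
move=> IJ sIJ.
have args n (ts : 'I_n -> term) s e : [forall i, tpos true P e (ts i)] ->
    [tuple teval I s (ts i) | i < n] = [tuple teval J s (ts i) | i < n].
  move=> /forallP h; apply: eq_from_tnth => i; rewrite !tnth_mktuple.
  exact: (proj1 (defs_agree IJ)) _ _ (proj1 (tpos_defs P) _ _ (h i)).
elim=> [x p IH|x p IH|R ts|Q ts|p IHp q IHq|p IHp q IHq|p IH] s e /=.
- move=> h; case: e h => h /existsP[d hd]; apply/existsP; exists d;
    exact: IH h hd.
- move=> h; case: e h => h /forallP hd; apply/forallP => d;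
    exact: IH h (hd d).
- by move=> /args ->; case: e.
- move=> /andP[QP /args ->]; case: (eqVneq Q P) QP => [E|QP _] /=.
    by move=> ->; move: ts; rewrite E => ts; apply: (subsetP sIJ).
  by rewrite IJ //; case: e.
- move=> /andP[hp hq]; case: e hp hq => hp hq /orP[h|h]; apply/orP;
    [left; exact: IHp hp h|right; exact: IHq hq h
    |left; exact: IHp hp h|right; exact: IHq hq h].
- move=> /andP[hp hq]; case: e hp hq => hp hq /andP[h1 h2]; apply/andP;
    split; by [exact: IHp hp h1|exact: IHq hq h2].
- by move=> /IH-/(_ s); case: e => /= h; apply: contra.
Qed.

Lemma lfp_op_mono (I : env A) P (xs : (par P).-tuple 'I_k) p :
  ppos true P true p -> {homo lfp_op I xs p : X Y / X \subset Y}.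
Proof.
move=> pos X Y sXY; apply/subsetP => a; rewrite !inE => /existsP[s].
move=> /andP[sa sp]; apply/existsP; exists s; rewrite sa /=.
have agr : agree P (dfwith I X) (dfwith I Y).
  by move=> Q QP; rewrite !dfwith_out // eq_sym.
have sub : dfwith I X P \subset dfwith I Y P by rewrite !dfwith_in.
by have := psat_mono agr sub s pos; apply.
Qed.

Lemma lfp_op_fixset (I : env A) P (xs : (par P).-tuple 'I_k) p :
  ppos true P true p ->
  lfp_op I xs p (fixset (lfp_op I xs p)) = fixset (lfp_op I xs p).
Proof. by move=> pos; apply: fixsetK; apply: lfp_op_mono. Qed.

Lemma lfp_op_least (I : env A) P (xs : (par P).-tuple 'I_k) p Y :
  ppos true P true p -> lfp_op I xs p Y = Y ->
  fixset (lfp_op I xs p) \subset Y.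
Proof.
move=> pos fY; rewrite /fixset; elim: #|_| => [|n IHn] /=.
  exact: sub0set.
by have := lfp_op_mono I xs pos IHn; rewrite fY.
Qed.

End LeastFixedPoint.

(** ** Separators *)

(* The finite sets of structures are given as lists. *)
Record instance := Instance {
  pos : seq (structure tau);
  neg : seq (structure tau);
  gram : grammar sym }.

Definition separator (strict : bool) (X : instance) (p : phi) : Prop :=
  [/\ sentence strict p, lang (gram X) (tree_of_phi p),
      all (fun A => models A p) (pos X) &
      all (fun A => ~~ models A p) (neg X)].

(* Size of the smallest separator may be doubly exponential in the size of the
   instance: with f binary, c constant, R unary, a grammar for the sentences
   R(t), t ::= c | f(t,t), and as positive examples, for each of the first m
   primes p, the structure on {0,...,p-1,*} where c = 0, f(q,q) = q+1 mod p,
   f(q,q') = * in all other cases and R = {p-1}, every separator has all its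
   leaves at depth at least the product of the primes.  Hence sentences are
   output with shared subtrees, as directed acyclic graphs: node i of a [dag]
   carries a symbol and the list of its children, and node 0 is the root. *)
Definition dag := seq (sym * seq nat).

Inductive unfolds (g : dag) : nat -> tree sym -> Prop :=
| Unfolds i a js ts : onth g i = Some (a, js) ->
    List.Forall2 (unfolds g) js ts -> unfolds g i (Node a ts).

(** ** Encodings as binary words *)

Inductive data : Type := Data of seq data.

(* Balanced parentheses. *)
Fixpoint word_of (d : data) : seq bool :=
  let: Data ds := d in true :: flatten (map word_of ds) ++ [:: false].

(* Numbers are unary; in particular, an encoded structure is at least as long
   as its domain is large. *)
Definition dnat (n : nat) : data := Data (nseq n (Data [::])).
Definition dnats (s : seq nat) : data := Data (map dnat s).

Definition dsym (a : sym) : data :=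
  match a with
  | SRel R => dnats [:: 0; val R]
  | SFun f => dnats [:: 1; val f]
  | SIte => dnats [:: 2]
  | SAnd => dnats [:: 3]
  | SOr => dnats [:: 4]
  | SNot => dnats [:: 5]
  | SAll x => dnats [:: 6; val x]
  | SEx x => dnats [:: 7; val x]
  | SVar x => dnats [:: 8; val x]
  | SLet P xs => dnats (9 :: val P :: [seq val x | x <- xs])
  | SDef P => dnats [:: 10; val P]
  end.

Definition dlabel (a : sym + nat) : data :=
  match a with inl b => dsym b | inr B => dnats [:: 11; B] end.

Fixpoint dtree (t : tree (sym + nat)) : data :=
  let: Node a ts := t in Data (dlabel a :: map dtree ts).

Definition dgrammar (G : grammar sym) : data :=
  Data [:: dnat (nnt G); dnat (axm G);
           Data [seq Data [:: dnat r.1; dtree r.2] | r <- rules G]].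

(* Relations are listed by their tuples, functions by their graphs. *)
Definition dstructure (A : structure tau) : data :=
  Data [:: dnat (predsize A).+1;
    Data [seq Data [seq dnats [seq val d | d <- tval a] | a <- enum (irel A R)]
         | R <- enum 'I_(nrel tau)];
    Data [seq Data [seq dnats (rcons [seq val d | d <- tval a]
                                     (val (ifun A f a)))
                   | a <- enum {: (far f).-tuple (dom A)}]
         | f <- enum 'I_(nfun tau)]].

Definition dinstance (X : instance) : data :=
  Data [:: Data (map dstructure (pos X)); Data (map dstructure (neg X));
           dgrammar (gram X)].

Definition ddag (g : dag) : data :=
  Data [seq Data [:: dsym v.1; dnats v.2] | v <- g].

Definition input (X : instance) : seq bool := word_of (dinstance X).

(* "No" is the empty list of nodes. *)
Definition output_no : seq bool := word_of (Data [::]).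
Definition output_dag (g : dag) : seq bool := word_of (ddag g).

Definition correct_output (strict : bool) (X : instance) (w : seq bool) : Prop :=
  (exists g p, [/\ w = output_dag g, unfolds g 0 (tree_of_phi p) &
                   separator strict X p])
  \/ (w = output_no /\ ~ exists p, separator strict X p).

End FOLFP.

(** * Deterministic multitape Turing machines over {0, 1, blank} *)

Definition cell := option bool.

Inductive move := MLeft | MStay | MRight.

Record TM := MkTM {
  xtapes : nat;
  state : finType;
  start : state;
  halted : pred state;
  delta : state -> {ffun 'I_xtapes.+1 -> cell} ->
          state * ('I_xtapes.+1 -> cell * move) }.

(* The cells to the left of the head, nearest first, and the cells from the
   head rightwards; all further cells are blank. *)
Definition tape := (seq cell * seq cell)%type.

Definition tread (t : tape) : cell := head None t.2.

Definition twrite (t : tape) (a : cell * move) : tape :=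
  let: (l, r) := t in let r' := behead r in
  match a.2 with
  | MLeft => (behead l, head None l :: a.1 :: r')
  | MStay => (l, a.1 :: r')
  | MRight => (a.1 :: l, r')
  end.

Definition config (M : TM) := (state M * ('I_(xtapes M).+1 -> tape))%type.

Definition tmstep M (c : config M) : config M :=
  if halted c.1 then c else
  let: (q, a) := delta c.1 [ffun i => tread (c.2 i)] in
  (q, fun i => twrite (c.2 i) (a i)).

(* The input is on tape 0, with the head on its first symbol. *)
Definition tminit M (w : seq bool) : config M :=
  (start M, fun i => if i == ord0 then ([::], map Some w) else ([::], [::])).

(* The output is read on tape 0, from the head to the first blank. *)
Fixpoint bits (s : seq cell) : seq bool :=
  if s is Some b :: s' then b :: bits s' else [::].

Definition computes_in (M : TM) (w : seq bool) (T : nat) (v : seq bool) : Prop :=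
  let c := iter T (@tmstep M) (tminit M w) in
  halted c.1 /\ bits (c.2 ord0).2 = v.

(* Main.v *)
(** Whether a tree derived from a grammar node evaluates to a given table of
    values depends on the environments in which it is evaluated.  The body of a
    definition contains no [let], so it is only evaluated with the defined symbol
    interpreted by one of the polynomially many iterates of its operator.  Hence
    the relevant environments of all the structures, and the values of the tree
    in all of them and under all assignments, have polynomial size, and there are
    exponentially many "facts" (node, environments, values).  Well-formedness of
    formulas is a deterministic top-down tree automaton with constantly many
    states, which become part of the facts.  Saturating the set of facts under
    the rules of the grammar takes exponential time, and the justifications of
    the facts form a dag that unfolds to the formulas found.

    For the running time, functions on encoded data are closed under
    composition, pairing, case analysis and bounded iteration of a machine with
    four stacks of bits, which a Turing machine simulates; polynomial time is
    preserved by list comprehensions, and the list of all sublists of a list is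
    computable in exponential time. *)

From HB Require Import structures.
From Stdlib Require Import FunctionalExtensionality.
From Stdlib Require List Relation_Operators.
Require Import Defs.
From mathcomp Require Import all_boot zify.

Set Implicit Arguments.
Unset Strict Implicit.
Unset Printing Implicit Defensive.

(** * Structured programs on four stacks of bits *)

(** A separator is one tree for all structures at once, and the body of a definition is one tree for
    all stages of its iteration. Values found separately could come from different trees, so a fact
    records the values in all relevant worlds of all structures jointly. A fact about a body thus
    presupposes the interpretations of the defined symbol at every stage, which depend on the body
    itself. The circle is broken by guessing all of them in the context of the fact and checking,
    where the definition is made, that every stage results from the preceding one. The number of
    stages is the one that [fixset] prescribes, so the check follows the semantics literally, and
    the two readings of positivity differ only in the automaton. As for complexity, functions of
    exponential time do not compose. All exponential growth is therefore confined to two lists of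
    sublists, one of the atoms of contexts and one of the atoms of values; the rest of the algorithm
    is polynomial in the instance extended with these lists. *)

Inductive reg := Main | AuxA | AuxB | Cnt.

Record store := Store { smain : seq bool; sa : seq bool; sb : seq bool; sc : seq bool }.

Definition get (s : store) (r : reg) : seq bool :=
  match r with Main => smain s | AuxA => sa s | AuxB => sb s | Cnt => sc s end.

Definition set_reg (s : store) (r : reg) (x : seq bool) : store :=
  let: Store m a b c := s in
  match r with
  | Main => Store x a b c | AuxA => Store m x b c
  | AuxB => Store m a x c | Cnt => Store m a b x
  end.

(* Every command returns a boolean, tested by [If] and [While]. *)
Inductive cmd :=
| Push of reg & bool
| Pop of reg
| Top of reg
| If of cmd & cmd & cmd
| While of cmd & cmd.

Notation Seq c d := (If c d d).

(** The last argument is the exact number of steps of the compiled machine. A push costs two, one to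
    move the head left and one to write; [If] and [While] cost nothing, since the last step of a
    command already enters the state of the next one. *)
Inductive exec : cmd -> store -> bool -> store -> nat -> Prop :=
| EPush s r b : exec (Push r b) s false (set_reg s r (b :: get s r)) 2
| EPop s r : exec (Pop r) s false (set_reg s r (behead (get s r))) 1
| ETop s r : exec (Top r) s (head false (get s r)) s 1
| EIf c d e s b s1 t1 b' s2 t2 : exec c s b s1 t1 ->
    exec (if b then d else e) s1 b' s2 t2 -> exec (If c d e) s b' s2 (t1 + t2)
| EWhileF c d s s1 t : exec c s false s1 t -> exec (While c d) s false s1 t
| EWhileT c d s s1 t1 b s2 t2 b' s3 t3 : exec c s true s1 t1 ->
    exec d s1 b s2 t2 -> exec (While c d) s2 b' s3 t3 ->
    exec (While c d) s b' s3 (t1 + t2 + t3).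

(** No command adds more bits than it takes steps. A time bound for a function thus also bounds the
    size of its values. *)
Lemma exec_size c s b s' t : exec c s b s' t ->
  size (smain s') <= size (smain s) + t.
Proof.
elim=> {c s b s' t}.
- by move=> [m a b c] [] x /=; lia.
- by move=> [m a b c] [] /=; rewrite ?size_behead; lia.
- by move=> s r; lia.
- by move=> *; lia.
- by move=> *; lia.
- by move=> *; lia.
Qed.

(** * Compilation to multitape Turing machines *)

Notation tapes := ('I_4 -> tape).
Notation actions := ('I_4 -> cell * move).

Definition reg_of (i : 'I_4) : reg :=
  match val i with 0 => Main | 1 => AuxA | 2 => AuxB | _ => Cnt end.

Definition tape_of (r : reg) : 'I_4 :=
  match r with
  | Main => @Ordinal 4 0 isT | AuxA => @Ordinal 4 1 isT
  | AuxB => @Ordinal 4 2 isT | Cnt => @Ordinal 4 3 isT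
  end.

Definition same_reg (r r' : reg) : bool :=
  match r, r' with
  | Main, Main | AuxA, AuxA | AuxB, AuxB | Cnt, Cnt => true
  | _, _ => false
  end.

Lemma reg_ofK r : reg_of (tape_of r) = r. Proof. by case: r. Qed.

Lemma same_regP r r' : reflect (r = r') (same_reg r r').
Proof. by case: r; case: r'; constructor. Qed.

(** The top of the stack is under the head. Popped cells are blanked, so a push finds a blank on the
    left; explicit blanks at the right end arise from steps on an empty stack. *)
Definition holds_stack (t : tape) (s : seq bool) :=
  exists m n, t.1 = nseq m None /\ t.2 = map Some s ++ nseq n None.

Definition represents (tp : tapes) (s : store) :=
  forall i, holds_stack (tp i) (get s (reg_of i)).

Definition tops (tp : tapes) : {ffun 'I_4 -> cell} := [ffun i => tread (tp i)].

Definition act (tp : tapes) (a : actions) : tapes := fun i => twrite (tp i) (a i).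

Definition keep (c : {ffun 'I_4 -> cell}) : actions := fun i => (c i, MStay).

Definition put (c : {ffun 'I_4 -> cell}) (r : reg) (x : cell * move) : actions :=
  fun i => if same_reg (reg_of i) r then x else (c i, MStay).

Fixpoint St (c : cmd) : finType :=
  match c with
  | Push _ _ => bool
  | Pop _ | Top _ => unit
  | If c d e => (St c + (St d + St e))%type
  | While c d => (St c + St d)%type
  end.

Fixpoint entry_state (c : cmd) : St c :=
  match c with
  | Push _ _ => false
  | Pop _ | Top _ => tt
  | If c _ _ | While c _ => inl (entry_state c)
  end.

Definition next_state S S' (i : S -> S') (k : bool -> S' + bool)
    (x : (S + bool) * actions) : (S' + bool) * actions :=
  (match x.1 with inl s => inl (i s) | inr b => k b end, x.2).

Fixpoint stp (c : cmd) :
    St c -> {ffun 'I_4 -> cell} -> (St c + bool) * actions :=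
  match c with
  | Push r b => fun q h =>
      if q then (inr false, put h r (Some b, MStay))
      else (inl true, put h r (h (tape_of r), MLeft))
  | Pop r => fun q h => (inr false, put h r (None, MRight))
  | Top r => fun q h => (inr (h (tape_of r) == Some true), keep h)
  | If c d e => fun q h =>
      match q with
      | inl q => next_state inl
          (fun b => inl (inr (if b then inl (entry_state d)
                              else inr (entry_state e)))) (stp q h)
      | inr (inl q) => next_state (fun q => inr (inl q)) inr (stp q h)
      | inr (inr q) => next_state (fun q => inr (inr q)) inr (stp q h)
      end
  | While c d => fun q h =>
      match q with
      | inl q => next_state inl
          (fun b => if b then inl (inr (entry_state d)) else inr false) (stp q h)
      | inr q => next_state inr (fun _ => inl (inl (entry_state c))) (stp q h)
      end
  end.

Inductive steps S (f : S -> {ffun 'I_4 -> cell} -> (S + bool) * actions) :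
    S -> tapes -> bool -> tapes -> nat -> Prop :=
| SLast q tp b a : f q (tops tp) = (inr b, a) -> steps f q tp b (act tp a) 1
| SNext q tp q' a b tp' t : f q (tops tp) = (inl q', a) ->
    steps f q' (act tp a) b tp' t -> steps f q tp b tp' t.+1.

(** The embedding [i] redirects the exits of a command by [k]: either the enclosing command exits
    too, or control continues in a state [q1]. The continuation form of the second case chains
    commands without a notion of partial run. *)
Lemma steps_lift S S' (f : S -> {ffun 'I_4 -> cell} -> (S + bool) * actions)
    (f' : S' -> {ffun 'I_4 -> cell} -> (S' + bool) * actions) i k q tp b tp1 t :
  (forall q h, f' (i q) h = next_state i k (f q h)) -> steps f q tp b tp1 t ->
  match k b with
  | inr b' => steps f' (i q) tp b' tp1 t
  | inl q1 => forall b' tp2 t', steps f' q1 tp1 b' tp2 t' ->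
                steps f' (i q) tp b' tp2 (t + t')
  end.
Proof.
move=> E; elim=> {q tp b tp1 t} [q tp b a Ef|q tp q' a b tp' t Ef _ IH].
- case Ek: (k b) => [q1|b1].
    by move=> b' tp2 t' H; apply: SNext H; rewrite E Ef /next_state /= Ek.
  by apply: SLast; rewrite E Ef /next_state /= Ek.
- case Ek: (k b) IH => [q1|b1] IH.
    by move=> b' tp2 t' /IH H; apply: SNext H; rewrite E Ef.
  by apply: SNext IH; rewrite E Ef.
Qed.

Lemma holds_stack_keep t s : holds_stack t s ->
  holds_stack (twrite t (tread t, MStay)) s.
Proof.
case: t => l r [m [n [/= -> ->]]]; exists m.
case: s => [|b s]; last by exists n.
by case: n => [|n]; [exists 1|exists n.+1].
Qed.

Lemma holds_stack_top t s : holds_stack t s ->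
  (tread t == Some true) = head false s.
Proof. by case: t => l r [m [[|n] [/= _ ->]]]; case: s => //= -[]. Qed.

Lemma holds_stack_pop t s : holds_stack t s ->
  holds_stack (twrite t (None, MRight)) (behead s).
Proof.
case: t => l r [m [n [/= -> ->]]]; exists m.+1.
by case: s => [|b s]; [exists n.-1; case: n|exists n].
Qed.

Lemma holds_stack_push t s b : holds_stack t s ->
  holds_stack (twrite (twrite t (tread t, MLeft)) (Some b, MStay)) (b :: s).
Proof.
case: t => l r [m [n [/= -> ->]]]; exists m.-1.
case: s => [|x s] /=; last by exists n; case: m.
by exists n.-1.+1; case: m; case: n.
Qed.

Lemma get_set s r x r' :
  get (set_reg s r x) r' = if same_reg r' r then x else get s r'.
Proof. by case: s; case: r; case: r'. Qed.

Lemma exec_steps c s b s' t : exec c s b s' t -> forall tp, represents tp s ->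
  exists2 tp', steps (@stp c) (entry_state c) tp b tp' t & represents tp' s'.
Proof.
elim=> {c s b s' t}.
- move=> s r b tp H.
  eexists; first by apply: (@SNext _ _ _ _ true); [by []|apply: SLast].
  move=> i; rewrite get_set; have := H i; rewrite /act /put !ffunE.
  case: same_regP => [<-|_] Hi.
    have -> : tape_of (reg_of i) = i.
      by apply: val_inj; case: i {Hi} => -[|[|[|[|]]]].
    exact: holds_stack_push.
  exact/holds_stack_keep/holds_stack_keep.
- move=> s r tp H; eexists; first exact: SLast.
  move=> i; rewrite get_set; have := H i; rewrite /act /put !ffunE.
  by case: same_regP => [<-|_] Hi; [apply: holds_stack_pop|apply: holds_stack_keep].
- move=> s r tp H; rewrite -(holds_stack_top (t := tp (tape_of r))); last first.
    by have := H (tape_of r); rewrite reg_ofK.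
  exists (act tp (keep (tops tp))).
    by apply: SLast; rewrite /= ffunE.
  by move=> i; rewrite /act /keep ffunE; apply: holds_stack_keep.
- move=> c d e s b s1 t1 b' s2 t2 _ IH1 _ IH2 tp /IH1[tp1 H1 /IH2[tp2 H2 R2]].
  exists tp2 => //.
  have := steps_lift (i := inl)
    (k := fun b => inl (inr (if b then inl (entry_state d) else inr (entry_state e))))
    (f' := @stp (If c d e)) (fun _ _ => erefl) H1 => /=; apply.
  clear IH1 IH2 H1; case: b H2 => H2.
    exact: (steps_lift (i := fun q => inr (inl q)) (k := inr)
              (f' := @stp (If c d e)) (fun _ _ => erefl) H2).
  exact: (steps_lift (i := fun q => inr (inr q)) (k := inr)
            (f' := @stp (If c d e)) (fun _ _ => erefl) H2).
- move=> c d s s1 t _ IH tp /IH[tp1 H1 R1]; exists tp1 => //.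
  exact: (steps_lift (i := inl)
    (k := fun b => if b then inl (inr (entry_state d)) else inr false)
    (f' := @stp (While c d)) (fun _ _ => erefl) H1).
- move=> c d s s1 t1 b s2 t2 b' s3 t3 _ IH1 _ IH2 _ IH3 tp.
  move=> /IH1[tp1 H1 /IH2[tp2 H2 /IH3[tp3 H3 R3]]]; exists tp3 => //.
  rewrite -addnA.
  have := steps_lift (i := inl)
    (k := fun b => if b then inl (inr (entry_state d)) else inr false)
    (f' := @stp (While c d)) (fun _ _ => erefl) H1 => /=; apply.
  have := steps_lift (i := inr) (k := fun _ => inl (inl (entry_state c)))
     (f' := @stp (While c d)) (fun _ _ => erefl) H2 => /=; exact.
Qed.

Definition TM_of (c : cmd) : TM := @MkTM 3 (option (St c))
  (Some (entry_state c)) (fun q => ~~ isSome q)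
  (fun q h => if q is Some q then
      let: (x, a) := stp q h in (if x is inl q' then Some q' else None, a)
    else (None, keep h)).

Lemma steps_TM_of c q tp b tp' t : steps (@stp c) q tp b tp' t ->
  iter t (@tmstep (TM_of c)) (Some q, tp) = (None, tp').
Proof.
elim=> {q tp b tp' t} [q tp b a E|q tp q' a b tp' t E _ IH].
  by rewrite /= /tmstep /= E.
by rewrite iterSr -IH /= {2}/tmstep /= E.
Qed.

Lemma bits_map_Some s n : bits (map Some s ++ nseq n None) = s.
Proof. by elim: s => [|b s /= ->] //; case: n. Qed.

Lemma exec_computes_in c w b s' t T : exec c (Store w [::] [::] [::]) b s' t ->
  t <= T -> computes_in (TM_of c) w T (smain s').
Proof.
move=> H tT.
have init : represents (@tminit (TM_of c) w).2 (Store w [::] [::] [::]).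
  move=> i; rewrite /tminit /=; case: eqP => [->|ni].
    by exists 0, 0; rewrite /= cats0.
  exists 0, 0; split => //; move: i ni => [[|[|[|[|i]]]] hi] //= ni.
  by case: ni; apply: val_inj.
have [tp' /steps_TM_of E R] := exec_steps H init.
(* A halted configuration is a fixed point, so [T] may exceed the exact time. *)
have stay n : iter n (@tmstep (TM_of c)) (None, tp') = (None, tp').
  by elim: n => //= n ->.
have -> : T = (T - t) + t by rewrite subnK.
rewrite /computes_in /= iterD.
have -> : tminit (TM_of c) w = (Some (entry_state c), (@tminit (TM_of c) w).2) by [].
rewrite E stay; split=> //=.
by have [m [n [_ ->]]] := R ord0; rewrite bits_map_Some.
Qed.

(** * Moving encoded data between the stacks *)

Definition nop : cmd := Top Main.

Fixpoint pushes (rs : seq reg) (b : bool) : cmd :=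
  if rs is r :: rs' then Seq (Push r b) (pushes rs' b) else nop.

Definition shift_bit (src : reg) (op : bool) (dst : seq reg) : cmd :=
  If (Top src)
    (Seq (Pop src) (Seq (pushes dst true) (if op then Push Cnt true else Pop Cnt)))
    (Seq (Pop src) (Seq (pushes dst false) (if op then Pop Cnt else Push Cnt true))).

(* Pops a balanced word with opening symbol [op] from [src] and pushes it on
   every stack of [dst], thereby reversing it.  [Cnt] receives a marker [false]
   and then the current depth in unary. *)
Definition shift (src : reg) (op : bool) (dst : seq reg) : cmd :=
  Seq (Push Cnt false) (Seq (Pop src) (Seq (pushes dst op) (Seq (Push Cnt true)
    (Seq (While (Top Cnt) (shift_bit src op dst)) (Pop Cnt))))).

Definition runsb c s b s' B := exists2 t, t <= B & exec c s b s' t.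
Definition runs c s s' B := exists b, runsb c s b s' B.

Lemma runsb_seq c d s s1 b s2 B1 B2 :
  runs c s s1 B1 -> runsb d s1 b s2 B2 -> runsb (Seq c d) s b s2 (B1 + B2).
Proof.
move=> [b1 [t1 h1 H1]] [t2 h2 H2]; exists (t1 + t2); first exact: leq_add.
by apply: EIf H1 _; case: b1.
Qed.

Lemma runs_seq c d s s1 s2 B1 B2 :
  runs c s s1 B1 -> runs d s1 s2 B2 -> runs (Seq c d) s s2 (B1 + B2).
Proof. by move=> H1 [b H2]; exists b; apply: runsb_seq H1 H2. Qed.

Lemma runs_le c s s' B B' : runs c s s' B -> B <= B' -> runs c s s' B'.
Proof. by move=> [b [t h H]] hB; exists b, t; first exact: leq_trans hB. Qed.

Lemma runs_push s r b : runs (Push r b) s (set_reg s r (b :: get s r)) 2.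
Proof. by exists false, 2; last constructor. Qed.

Lemma runs_pop s r : runs (Pop r) s (set_reg s r (behead (get s r))) 1.
Proof. by exists false, 1; last constructor. Qed.

Lemma runs_nop s : runs nop s s 1.
Proof. by exists (head false (get s Main)), 1; last constructor. Qed.

Lemma runs_if c d e s (b : bool) s1 s2 B1 B2 : runsb c s b s1 B1 ->
  runs (if b then d else e) s1 s2 B2 -> runs (If c d e) s s2 (B1 + B2).
Proof.
move=> [t1 h1 H1] [b2 [t2 h2 H2]]; exists b2, (t1 + t2); first exact: leq_add.
exact: EIf H1 H2.
Qed.

Definition push_all (rs : seq reg) (b : bool) (s : store) : store :=
  foldl (fun s r => set_reg s r (b :: get s r)) s rs.

Lemma runs_pushes rs b s :
  runs (pushes rs b) s (push_all rs b s) (2 * size rs + 1).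
Proof.
elim: rs s => [|r rs IH] s /=; first exact: runs_nop.
by apply: runs_le (runs_seq (runs_push s r b) (IH _)) _; lia.
Qed.

(** * Balanced words and their transport between stacks *)

Inductive bal (op : bool) : seq bool -> Prop :=
| Bal0 : bal op [::]
| BalS u v : bal op u -> bal op v -> bal op (op :: u ++ ~~ op :: v).

Lemma bal_cat op u v : bal op u -> bal op v -> bal op (u ++ v).
Proof.
by elim=> {u} // u u' Hu _ Hu' IH /IH Hv; rewrite /= -catA; apply: BalS.
Qed.

(** Reversal exchanges opening and closing bits; this is why [shift] takes the opening bit as a
    parameter and serves for both directions. *)
Lemma bal_rev op u : bal op u -> bal (~~ op) (rev u).
Proof.
elim=> {u} [|u v _ Hu _ Hv]; first by constructor.
rewrite rev_cons rev_cat rev_cons -!cats1 -!catA; apply: bal_cat Hv _.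
by rewrite -[in X in _ ++ X](negbK op); apply: (BalS Hu); constructor.
Qed.

Section Shift.
Variables (src : reg) (op : bool) (dst : seq reg).
(* [F x c w]: [src] contains [x], [Cnt] contains [c], and the word [w] has been
   pushed on [dst]. *)
Variable F : seq bool -> seq bool -> seq bool -> store.
Hypothesis get_src : forall x c w, get (F x c w) src = x.
Hypothesis set_src : forall x c w x', set_reg (F x c w) src x' = F x' c w.
Hypothesis get_cnt : forall x c w, get (F x c w) Cnt = c.
Hypothesis set_cnt : forall x c w c', set_reg (F x c w) Cnt c' = F x c' w.
Hypothesis push_dst : forall x c w b, push_all dst b (F x c w) = F x c (b :: w).

(** Bounds the time per bit: two steps for each destination, and at most seven for the tests, the
    pop, the counter and the final [nop] of [pushes]. *)
Let k := 2 * size dst + 7.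

Lemma shift_bit_op x c w :
  runs (shift_bit src op dst) (F (op :: x) c w) (F x (true :: c) (op :: w)) k.-1.
Proof.
have top : runsb (Top src) (F (op :: x) c w) op (F (op :: x) c w) 1.
  by exists 1; last by have := ETop (F (op :: x) c w) src; rewrite get_src.
have := runs_pop (F (op :: x) c w) src; rewrite get_src set_src => pop.
have := runs_pushes dst op (F x c w); rewrite push_dst => pushd.
have := runs_push (F x c (op :: w)) Cnt true; rewrite get_cnt set_cnt => pushc.
have all := runs_seq pop (runs_seq pushd pushc).
apply: runs_le (runs_if top (B2 := 1 + (2 * size dst + 1 + 2)) _) _; rewrite /k; last by lia.
by case: op all.
Qed.

Lemma shift_bit_cl x c w : runs (shift_bit src op dst) (F (~~ op :: x) (true :: c) w)
  (F x c (~~ op :: w)) k.-1.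
Proof.
have top : runsb (Top src) (F (~~ op :: x) (true :: c) w) (~~ op)
                 (F (~~ op :: x) (true :: c) w) 1.
  by exists 1; last by have := ETop (F (~~ op :: x) (true :: c) w) src; rewrite get_src.
have := runs_pop (F (~~ op :: x) (true :: c) w) src; rewrite get_src set_src => pop.
have := runs_pushes dst (~~ op) (F x (true :: c) w); rewrite push_dst => pushd.
have := runs_pop (F x (true :: c) (~~ op :: w)) Cnt; rewrite get_cnt set_cnt => popc.
have all := runs_seq pop (runs_seq pushd popc).
apply: runs_le (runs_if top (B2 := 1 + (2 * size dst + 1 + 1)) _) _; rewrite /k; last by lia.
by case: op all.
Qed.

Let loop := While (Top Cnt) (shift_bit src op dst).

Lemma loop_step x c w s1 s2 B :
  runs (shift_bit src op dst) (F x (true :: c) w) s1 k.-1 ->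
  runs loop s1 s2 B -> runs loop (F x (true :: c) w) s2 (B + k).
Proof.
move=> [b1 [t1 h1 H1]] [b2 [t2 h2 H2]]; exists b2, (1 + t1 + t2).
  by move: h1; rewrite /k; lia.
apply: EWhileT H1 H2.
by have := ETop (F x (true :: c) w) Cnt; rewrite get_cnt.
Qed.

(** A run of a while loop is not a concatenation of two runs of the loop. Hence the iterations that
    process [u] are prepended to a given run starting after [u]; the counter is then back at its old
    height, above the marker. *)
Lemma loop_bal u : bal op u -> forall x c w s' B,
  runs loop (F x (true :: c) (catrev u w)) s' B ->
  runs loop (F (u ++ x) (true :: c) w) s' (B + k * size u).
Proof.
elim=> {u} [|u v _ IHu _ IHv] x c w s' B H; first by rewrite muln0 addn0.
apply: (@runs_le _ _ _ (B + k * size v + k + k * size u + k)); last first.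
  by rewrite /= size_cat /=; lia.
rewrite /= -catA; apply: loop_step (shift_bit_op _ _ _) _.
apply: IHu; apply: loop_step; first exact: shift_bit_cl.
by apply: IHv; move: H; rewrite /= catrev_catl.
Qed.

Lemma runs_shift u x c w : bal op u ->
  runs (shift src op dst) (F (op :: u ++ ~~ op :: x) c w)
    (F x c (catrev (op :: rcons u (~~ op)) w)) (k * (size u + 2) + 8).
Proof.
move=> Hu.
have s1 := runs_push (F (op :: u ++ ~~ op :: x) c w) Cnt false.
rewrite get_cnt set_cnt in s1.
have s2 := runs_pop (F (op :: u ++ ~~ op :: x) (false :: c) w) src.
rewrite get_src set_src /= in s2.
have s3 := runs_pushes dst op (F (u ++ ~~ op :: x) (false :: c) w).
rewrite push_dst in s3.
have s4 := runs_push (F (u ++ ~~ op :: x) (false :: c) (op :: w)) Cnt true.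
rewrite get_cnt set_cnt in s4.
have s6 := runs_pop (F x (false :: c) (catrev (op :: rcons u (~~ op)) w)) Cnt.
rewrite get_cnt set_cnt /= in s6.
have s5 : runs loop (F x (false :: c) (catrev (op :: rcons u (~~ op)) w))
               (F x (false :: c) (catrev (op :: rcons u (~~ op)) w)) 1.
  exists false, 1 => //; apply: EWhileF.
  by have := ETop (F x (false :: c) (catrev (op :: rcons u (~~ op)) w)) Cnt;
    rewrite get_cnt.
have {}s5 : runs loop (F (u ++ ~~ op :: x) (true :: false :: c) (op :: w))
    (F x (false :: c) (catrev (op :: rcons u (~~ op)) w)) (1 + k + k * size u).
  apply: loop_bal => //; apply: loop_step; first exact: shift_bit_cl.
  by move: s5; rewrite /= -cats1 catrev_catl.
apply: runs_le (runs_seq s1 (runs_seq s2 (runs_seq s3 (runs_seq s4 (runs_seq s5 s6))))) _.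
by rewrite /k; nia.
Qed.
End Shift.

Lemma data_ind' (P : data -> Prop) :
  (forall ds, (forall d, List.In d ds -> P d) -> P (Data ds)) -> forall d, P d.
Proof.
move=> H; fix IH 1 => -[ds]; apply: H.
elim: ds => [|d ds IHds] x; first by case.
by case=> [<-|]; [apply: IH|apply: IHds].
Qed.

Lemma word_bal d : exists2 u, bal true u & word_of d = true :: rcons u false.
Proof.
elim/data_ind': d => ds IH; exists (flatten (map word_of ds)); last by rewrite -cats1.
elim: ds IH => [|d ds IHds] IH /=; first by constructor.
have [u Hu ->] := IH d (or_introl erefl).
rewrite -cats1 /= -catA /=; apply: (BalS Hu); apply: IHds => x xs.
by apply: IH; right.
Qed.

Section Moves.
Variable d : data.
Let w := word_of d.
Variables (m a b c : seq bool).

(** For at most two destinations, the time per bit in [runs_shift] is at most 2 * 2 + 7 = 11. *)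
Lemma shift_main dst F : (forall x c w, get (F x c w) Main = x) ->
  (forall x c w x', set_reg (F x c w) Main x' = F x' c w) ->
  (forall x c w, get (F x c w) Cnt = c) ->
  (forall x c w c', set_reg (F x c w) Cnt c' = F x c' w) ->
  (forall x c w b, push_all dst b (F x c w) = F x c (b :: w)) -> size dst <= 2 ->
  runs (shift Main true dst) (F (w ++ m) c [::]) (F m c (rev w)) (11 * size w + 8).
Proof.
move=> h1 h2 h3 h4 h5 h6; rewrite /w; have [u Hu ->] := word_bal d.
apply: runs_le; first by have := runs_shift h1 h2 h3 h4 h5 m c [::] Hu;
  rewrite /= -cat_rcons; apply.
by rewrite /= size_rcons; nia.
Qed.

Lemma shift_back src F : (forall x c w, get (F x c w) src = x) ->
  (forall x c w x', set_reg (F x c w) src x' = F x' c w) ->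
  (forall x c w, get (F x c w) Cnt = c) ->
  (forall x c w c', set_reg (F x c w) Cnt c' = F x c' w) ->
  (forall x c w b, push_all [:: Main] b (F x c w) = F x c (b :: w)) ->
  runs (shift src false [:: Main]) (F (rev w ++ m) c [::]) (F m c w)
    (11 * size w + 8).
Proof.
move=> h1 h2 h3 h4 h5; rewrite /w; have [u Hu ->] := word_bal d.
have E1 : rev (true :: rcons u false) ++ m = false :: rev u ++ ~~ false :: m.
  by rewrite rev_cons rev_rcons cat_rcons.
have E2 : catrev (false :: rcons (rev u) (~~ false)) [::] = true :: rcons u false.
  by rewrite -/(rev _) rev_cons rev_rcons revK.
apply: runs_le.
  by have := runs_shift h1 h2 h3 h4 h5 m c [::] (bal_rev Hu); rewrite E1 E2; apply.
by rewrite /= size_rcons size_rev; nia.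
Qed.

Definition to_a := shift Main true [:: AuxA].
Definition to_b := shift Main true [:: AuxB].
Definition to_ab := shift Main true [:: AuxA; AuxB].
Definition drop_top := shift Main true [::].
Definition from_a := shift AuxA false [:: Main].
Definition from_b := shift AuxB false [:: Main].

Lemma runs_to_a :
  runs to_a (Store (w ++ m) a b c) (Store m (rev w ++ a) b c) (11 * size w + 8).
Proof. exact: (@shift_main _ (fun x c w => Store x (w ++ a) b c)). Qed.

Lemma runs_to_b :
  runs to_b (Store (w ++ m) a b c) (Store m a (rev w ++ b) c) (11 * size w + 8).
Proof. exact: (@shift_main _ (fun x c w => Store x a (w ++ b) c)). Qed.

Lemma runs_to_ab : runs to_ab (Store (w ++ m) a b c)
  (Store m (rev w ++ a) (rev w ++ b) c) (11 * size w + 8).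
Proof. exact: (@shift_main _ (fun x c w => Store x (w ++ a) (w ++ b) c)). Qed.

Lemma runs_drop_top :
  runs drop_top (Store (w ++ m) a b c) (Store m a b c) (11 * size w + 8).
Proof. exact: (@shift_main _ (fun x c w => Store x a b c)). Qed.
End Moves.

Lemma runs_from_a d m a b c : runs from_a (Store m (rev (word_of d) ++ a) b c)
  (Store (word_of d ++ m) a b c) (11 * size (word_of d) + 8).
Proof. exact: (@shift_back d a c _ (fun x c w => Store (w ++ m) x b c)). Qed.

Lemma runs_from_b d m a b c : runs from_b (Store m a (rev (word_of d) ++ b) c)
  (Store (word_of d ++ m) a b c) (11 * size (word_of d) + 8).
Proof. exact: (@shift_back d b c _ (fun x c w => Store (w ++ m) a x c)). Qed.

Definition dup := Seq to_ab (Seq from_a from_b).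

Lemma runs_dup d m a b c : runs dup (Store (word_of d ++ m) a b c)
  (Store (word_of d ++ word_of d ++ m) a b c) (33 * size (word_of d) + 24).
Proof.
apply: runs_le (runs_seq (runs_to_ab _ _ _ _ _)
  (runs_seq (runs_from_a _ _ _ _ _) (runs_from_b _ _ _ _ _))) _.
lia.
Qed.

Definition pair_top :=
  Seq to_a (Seq to_b (Seq (Push Main false) (Seq from_b (Seq from_a (Push Main true))))).

Lemma runs_pair_top d e m a b c :
  runs pair_top (Store (word_of d ++ word_of e ++ m) a b c)
    (Store (word_of (Data [:: d; e]) ++ m) a b c)
    (22 * (size (word_of d) + size (word_of e)) + 36).
Proof.
apply: runs_le.
  apply: runs_seq (runs_to_a _ _ _ _ _) _; apply: runs_seq (runs_to_b _ _ _ _ _) _.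
  apply: runs_seq (runs_push _ _ _) _; apply: runs_seq (runs_from_b _ _ _ _ _) _.
  apply: runs_seq (runs_from_a _ _ _ _ _) _.
  by rewrite /= cats0 -!catA; apply: runs_push.
lia.
Qed.

Definition fst_top := Seq (Pop Main) (Seq to_a (Seq drop_top (Seq (Pop Main) from_a))).

Lemma runs_fst_top d e m a b c :
  runs fst_top (Store (word_of (Data [:: d; e]) ++ m) a b c)
    (Store (word_of d ++ m) a b c)
    (22 * size (word_of (Data [:: d; e])) + 30).
Proof.
apply: runs_le.
  apply: runs_seq (runs_pop _ _) _; rewrite /= cats0 -!catA.
  apply: runs_seq (runs_to_a _ _ _ _ _) _; apply: runs_seq (runs_drop_top _ _ _ _ _) _.
  by apply: runs_seq (runs_pop _ _) _; apply: runs_from_a.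
by rewrite /= !size_cat /=; lia.
Qed.

Definition snd_top := Seq (Pop Main) (Seq drop_top (Seq to_a (Seq (Pop Main) from_a))).

Lemma runs_snd_top d e m a b c :
  runs snd_top (Store (word_of (Data [:: d; e]) ++ m) a b c)
    (Store (word_of e ++ m) a b c)
    (22 * size (word_of (Data [:: d; e])) + 30).
Proof.
apply: runs_le.
  apply: runs_seq (runs_pop _ _) _; rewrite /= cats0 -!catA.
  apply: runs_seq (runs_drop_top _ _ _ _ _) _; apply: runs_seq (runs_to_a _ _ _ _ _) _.
  by apply: runs_seq (runs_pop _ _) _; apply: runs_from_a.
by rewrite /= !size_cat /=; lia.
Qed.

(** The words of [Data [:: d; Data ds]] and [Data (d :: ds)] differ only in the two brackets around
    [ds], which are dropped here and inserted by [uncons_top]. *)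
Definition cons_top := Seq (Pop Main) (Seq to_a (Seq to_b (Seq (Pop Main)
  (Seq from_b (Seq (Pop Main) (Seq from_a (Push Main true))))))).

Lemma runs_cons_top d ds m a b c :
  runs cons_top (Store (word_of (Data [:: d; Data ds]) ++ m) a b c)
    (Store (word_of (Data (d :: ds)) ++ m) a b c)
    (22 * size (word_of (Data [:: d; Data ds])) + 40).
Proof.
apply: runs_le.
  apply: runs_seq (runs_pop _ _) _; rewrite /= cats0.
  have -> : (word_of d ++ true :: flatten [seq word_of i | i <- ds] ++ [:: false]) ++ [:: false]
    = word_of d ++ word_of (Data ds) ++ [:: false] by rewrite -catA.
  rewrite -!catA.
  apply: runs_seq (runs_to_a _ _ _ _ _) _; apply: runs_seq (runs_to_b _ _ _ _ _) _.
  apply: runs_seq (runs_pop _ _) _; apply: runs_seq (runs_from_b _ _ _ _ _) _.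
  apply: runs_seq (runs_pop _ _) _; apply: runs_seq (runs_from_a _ _ _ _ _) _.
  by rewrite /= -!catA; apply: runs_push.
by rewrite /= !size_cat /= !size_cat /=; lia.
Qed.

Definition uncons_top := Seq (Pop Main) (Seq to_a (Seq (Push Main true) (Seq to_b
  (Seq (Push Main false) (Seq from_b (Seq from_a (Push Main true))))))).

Lemma runs_uncons_top d ds m a b c :
  runs uncons_top (Store (word_of (Data (d :: ds)) ++ m) a b c)
    (Store (word_of (Data [:: d; Data ds]) ++ m) a b c)
    (22 * size (word_of (Data (d :: ds))) + 80).
Proof.
apply: runs_le.
  apply: runs_seq (runs_pop _ _) _; rewrite /= -!catA.
  apply: runs_seq (runs_to_a _ _ _ _ _) _; apply: runs_seq (runs_push _ _ _) _.
  rewrite /=.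
  have E : true :: flatten [seq word_of i | i <- ds] ++ false :: m
    = word_of (Data ds) ++ m by rewrite /= -catA.
  rewrite E.
  apply: runs_seq (runs_to_b _ _ _ _ _) _; apply: runs_seq (runs_push _ _ _) _.
  apply: runs_seq (runs_from_b _ _ _ _ _) _; apply: runs_seq (runs_from_a _ _ _ _ _) _.
  by rewrite /= -!catA; apply: runs_push.
by rewrite /= !size_cat /=; lia.
Qed.

(** * Functions computable in polynomial and in exponential time *)

Class Enc (T : Type) := enc : T -> data.
Arguments enc {T Enc} _.

#[export] Instance enc_data : Enc data := id.
#[export] Instance enc_nat : Enc nat := dnat.
#[export] Instance enc_bool : Enc bool := fun b => dnat b.
#[export] Instance enc_pair T U (eT : Enc T) (eU : Enc U) : Enc (T * U) :=
  fun p => Data [:: enc p.1; enc p.2].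
#[export] Instance enc_seq T (eT : Enc T) : Enc (seq T) := fun s => Data (map enc s).

Definition W {T} {eT : Enc T} (x : T) : seq bool := word_of (enc x).
Definition sz {T} {eT : Enc T} (x : T) : nat := size (W x).

Lemma sz_pair {T U} {eT : Enc T} {eU : Enc U} (x : T) (y : U) :
  sz (x, y) = sz x + sz y + 2.
Proof.
rewrite /sz -[W (x, y)]/(true :: (W x ++ W y ++ [::]) ++ [:: false]).
by rewrite /= !size_cat /=; lia.
Qed.

Lemma sz_cons {T} {eT : Enc T} (x : T) s : sz (x :: s) = sz x + sz s.
Proof.
set u := flatten (map word_of (map enc s)).
rewrite /sz -[W (x :: s)]/(true :: (W x ++ u) ++ [:: false]).
by rewrite -[W s]/(true :: u ++ [:: false]) /= !size_cat /=; lia.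
Qed.

Lemma sz_nil {T} {eT : Enc T} : sz ([::] : seq T) = 2. Proof. by []. Qed.

Lemma sz_cat {T} {eT : Enc T} (s t : seq T) : sz (s ++ t) + 2 = sz s + sz t.
Proof. by elim: s => [|x s IH] /=; rewrite ?sz_nil ?sz_cons; lia. Qed.

Lemma word_ge2 d : 2 <= size (word_of d).
Proof. by have [u _ ->] := word_bal d; rewrite /= size_rcons. Qed.

Lemma sz_ge2 {T} {eT : Enc T} (x : T) : 2 <= sz x.
Proof. exact: word_ge2. Qed.

Lemma sz_size {T} {eT : Enc T} (s : seq T) : 2 * size s + 2 <= sz s.
Proof. by elim: s => [|x s IH] //=; rewrite sz_cons; have := @sz_ge2 _ eT x; lia. Qed.

(** The argument is replaced by the value while the rest of the main stack and the other stacks,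
    whatever they contain, are preserved. This is what makes programs composable. *)
Definition computes_fun (P : cmd) T U (eT : Enc T) (eU : Enc U) (f : T -> U)
    (B : nat -> nat) :=
  forall x m a b c,
    runs P (Store (W x ++ m) a b c) (Store (W (f x) ++ m) a b c) (B (sz x)).
Arguments computes_fun P {T U eT eU} f B.

Definition mono (B : nat -> nat) := {homo B : m n / m <= n}.

Lemma computes_size {T U} {eT : Enc T} {eU : Enc U} P (f : T -> U) B x :
  computes_fun P f B -> sz (f x) <= sz x + B (sz x).
Proof.
move=> /(_ x [::] [::] [::] [::])[b [t h /exec_size H]].
have : size (W (f x) ++ [::]) <= size (W x ++ [::]) + t by [].
by rewrite !cats0 -/(sz x) -/(sz (f x)); lia.
Qed.

Lemma computes_le {T U} {eT : Enc T} {eU : Enc U} P (f : T -> U) B B' :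
  computes_fun P f B -> (forall n, B n <= B' n) -> computes_fun P f B'.
Proof. by move=> H hB x m a b c; apply: runs_le (H _ _ _ _ _) _. Qed.

(** The second bit of a word is set exactly if the root has a child. So one test reads booleans,
    encoded as the numbers 0 and 1, and tells nonempty lists from empty ones. *)
Definition test_top (P : cmd) := Seq dup (Seq P (Seq (Pop Main) (Top Main))).

Lemma runs_test {T U} {eT : Enc T} {eU : Enc U} P (f : T -> U) Bf x m a b c : computes_fun P f Bf ->
  runsb (test_top P) (Store (W x ++ m) a b c) (head false (behead (W (f x))))
    (Store (behead (W (f x)) ++ W x ++ m) a b c) (33 * sz x + Bf (sz x) + 26).
Proof.
move=> Hf; have [w E] : exists w, W (f x) = true :: w.
  by have [u _ E] := word_bal (enc (f x)); exists (rcons u false).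
have wn : 0 < size w by have := @sz_ge2 _ eU (f x); rewrite /sz E.
have pop : runs (Pop Main) (Store (W (f x) ++ W x ++ m) a b c)
    (Store (w ++ W x ++ m) a b c) 1.
  by rewrite E; apply: runs_pop.
have top : runsb (Top Main) (Store (w ++ W x ++ m) a b c) (head false w)
    (Store (w ++ W x ++ m) a b c) 1.
  by exists 1 => //; case: w wn {E pop} => // i w _; apply: ETop.
rewrite E /=.
have [t h H] := runsb_seq (runs_dup _ m a b c) (runsb_seq (Hf x _ a b c) (runsb_seq pop top)).
by exists t => //; apply: leq_trans h _; rewrite -/(W _) -/(sz x); lia.
Qed.

Section Combinators.
Variables (T U V : Type).
Context {eT : Enc T} {eU : Enc U} {eV : Enc V}.

Lemma computes_comp P Q (f : T -> U) (h : U -> V) Bf Bh : mono Bh ->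
  computes_fun P f Bf -> computes_fun Q h Bh ->
  computes_fun (Seq P Q) (fun x => h (f x)) (fun n => Bf n + Bh (n + Bf n)).
Proof.
move=> mBh Hf Hh x m a b c; apply: runs_le (runs_seq (Hf _ _ _ _ _) (Hh _ _ _ _ _)) _.
by rewrite leq_add2l mBh // (computes_size x Hf).
Qed.

Lemma computes_pair P Q (f : T -> U) (h : T -> V) Bf Bh :
  computes_fun P f Bf -> computes_fun Q h Bh ->
  computes_fun (Seq dup (Seq P (Seq to_a (Seq Q (Seq from_a pair_top)))))
    (fun x => (f x, h x)) (fun n => 150 * (n + Bf n + Bh n + 1)).
Proof.
move=> Hf Hh x m a b c; apply: runs_le.
  apply: runs_seq (runs_dup _ _ _ _ _) _; apply: runs_seq (Hf _ _ _ _ _) _.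
  apply: runs_seq (runs_to_a _ _ _ _ _) _; apply: runs_seq (Hh _ _ _ _ _) _.
  by apply: runs_seq (runs_from_a _ _ _ _ _) _; apply: runs_pair_top.
have := computes_size x Hf; have := computes_size x Hh.
by rewrite -/(W _) -/(W (h x)) -/(W (f x)) -/(sz x) -/(sz (f x)) -/(sz (h x)); lia.
Qed.

Lemma computes_fst : computes_fun fst_top (@fst T U) (fun n => 22 * n + 30).
Proof. by move=> [x y] m a b c; apply: runs_fst_top. Qed.

Lemma computes_snd : computes_fun snd_top (@snd T U) (fun n => 22 * n + 30).
Proof. by move=> [x y] m a b c; apply: runs_snd_top. Qed.

Lemma computes_cons :
  computes_fun cons_top (fun p : T * seq T => p.1 :: p.2) (fun n => 22 * n + 40).
Proof. by move=> [x s] m a b c; apply: runs_cons_top. Qed.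

(** Conversions that keep the encoding take a single step; this covers constructors, projections and
    unary numbers seen as lists. *)
Lemma computes_recode (f : T -> U) :
  (forall x, enc (f x) = enc x) -> computes_fun nop f (fun _ => 1).
Proof. by move=> E x m a b c; rewrite /W E; apply: runs_nop. Qed.

Fixpoint push_word (w : seq bool) : cmd :=
  if w is b :: w' then Seq (push_word w') (Push Main b) else nop.

Lemma runs_push_word w m a b c :
  runs (push_word w) (Store m a b c) (Store (w ++ m) a b c) (2 * size w + 1).
Proof.
elim: w => [|x w IH] /=; first exact: runs_nop.
by apply: runs_le (runs_seq IH (runs_push _ _ _)) _; lia.
Qed.

Lemma computes_const (y : U) :
  computes_fun (Seq drop_top (push_word (W y))) (fun _ : T => y)
    (fun n => 11 * n + 2 * sz y + 9).
Proof.
move=> x m a b c; apply: runs_le.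
  by apply: runs_seq (runs_drop_top _ _ _ _ _) _; apply: runs_push_word.
by rewrite -/(W _) -/(sz _) -/(sz y); lia.
Qed.

(** The test leaves the encoding of the boolean without its first bit: three bits remain of [true]
    and one of [false]. *)
Definition if_fun P Q R :=
  If (test_top P) (Seq (Pop Main) (Seq (Pop Main) (Seq (Pop Main) Q)))
    (Seq (Pop Main) R).

Lemma computes_if P Q R (p : T -> bool) (f h : T -> U) Bp Bf Bh :
  computes_fun P p Bp -> computes_fun Q f Bf -> computes_fun R h Bh ->
  computes_fun (if_fun P Q R) (fun x => if p x then f x else h x)
    (fun n => 33 * n + Bp n + Bf n + Bh n + 33).
Proof.
move=> Hp Hf Hh x m a b c.
have [t ht test] := runs_test x m a b c Hp.
apply: (@runs_le _ _ _ (33 * sz x + Bp (sz x) + 26 +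
    (3 + Bf (sz x) + Bh (sz x)))); last by lia.
apply: (runs_if (ex_intro2 _ _ t ht test)).
case: (p x).
  apply: runs_le.
    apply: runs_seq (runs_pop _ _) _; apply: runs_seq (runs_pop _ _) _.
    by apply: runs_seq (runs_pop _ _) _; apply: Hf.
  by lia.
apply: runs_le; first by apply: runs_seq (runs_pop _ _) _; apply: Hh.
by lia.
Qed.

(** Pushing back the bit popped by the test restores a nonempty list; of an empty one a single bit
    is left to be popped. *)
Definition case_fun P Q R := If (test_top P)
  (Seq (Push Main true) (Seq uncons_top (Seq pair_top Q))) (Seq (Pop Main) R).

Lemma computes_case P Q R (l : T -> seq U) (f : (U * seq U) * T -> V) (h : T -> V)
    Bl Bf Bh : mono Bf ->
  computes_fun P l Bl -> computes_fun Q f Bf -> computes_fun R h Bh ->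
  computes_fun (case_fun P Q R)
    (fun x => if l x is y :: s then f ((y, s), x) else h x)
    (fun n => 300 * (n + Bl n + 1) + Bf (2 * n + Bl n + 4) + Bh n).
Proof.
move=> mBf Hl Hf Hh x m a b c.
have [t ht test] := runs_test x m a b c Hl.
have hl := computes_size x Hl.
have hm : Bf (sz (l x) + sz x + 4) <= Bf (2 * sz x + Bl (sz x) + 4).
  by apply: mBf; lia.
apply: (@runs_le _ _ _ (33 * sz x + Bl (sz x) + 26 +
    (60 * sz (l x) + 30 * sz x + 200 + Bf (sz (l x) + sz x + 4) + Bh (sz x)))); last first.
  by move: hm hl; lia.
apply: (runs_if (ex_intro2 _ _ t ht test)).
case: (l x) => [|y s] /=.
  by apply: runs_le; [apply: runs_seq (runs_pop _ _) _; apply: Hh|lia].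
have [u _ Ey] := word_bal (enc y).
rewrite [X in if X then _ else _](_ : _ = true); last by rewrite Ey.
apply: runs_le.
  apply: runs_seq (runs_push _ _ _) _.
  apply: runs_seq (runs_uncons_top (enc y) (map enc s) (W x ++ m) a b c) _.
  apply: runs_seq (runs_pair_top (enc (y, s)) (enc x) m a b c) _.
  exact: (Hf ((y, s), x) m a b c).
have E1 : size (word_of (Data (enc y :: map enc s))) = sz y + sz s := sz_cons y s.
have E2 : size (word_of (enc (y, s))) = sz y + sz s + 2 := sz_pair y s.
have E3 : size (word_of (enc x)) = sz x by [].
rewrite E1 E2 E3 !sz_pair !sz_cons.
rewrite (_ : sz y + sz s + 2 + sz x + 2 = sz y + sz s + sz x + 4); last by lia.
by lia.
Qed.

End Combinators.

Definition while_fun P Q := Seq (While (test_top P)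
  (Seq (Pop Main) (Seq (Pop Main) (Seq (Pop Main) Q)))) (Pop Main).

Lemma computes_while T (eT : Enc T) P Q (p : T -> bool) (f : T -> T) Bp Bf M :
  mono Bp -> mono Bf -> computes_fun P p Bp -> computes_fun Q f Bf ->
  forall n x m a b c, (forall i, i < n -> p (iter i f x)) -> ~~ p (iter n f x) ->
  (forall i, i <= n -> sz (iter i f x) <= M) ->
  runs (while_fun P Q) (Store (W x ++ m) a b c) (Store (W (iter n f x) ++ m) a b c)
    (n.+1 * (33 * M + Bp M + Bf M + 34)).
Proof.
move=> mBp mBf Hp Hf n x m a b c h1 h2 h3.
have H : runs (While (test_top P) (Seq (Pop Main) (Seq (Pop Main) (Seq (Pop Main) Q))))
    (Store (W x ++ m) a b c) (Store (false :: W (iter n f x) ++ m) a b c)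
    (n.+1 * (33 * M + Bp M + Bf M + 33)); last first.
  by apply: runs_le; [apply: runs_seq H (runs_pop _ _)|nia].
elim: n x h1 h2 h3 => [|n IH] x h1 h2 h3.
  have [t h H] := runs_test x m a b c Hp.
  exists false, t.
    by have := mBp _ _ (h3 0 isT); have /= := h3 0 isT; lia.
  by move: H; rewrite (negbTE h2) => H; apply: EWhileF H.
have [t h H] := runs_test x m a b c Hp.
move: H; rewrite (h1 0 isT) => H.
have [b2 [t2 hh2 H2]] : runs (Seq (Pop Main) (Seq (Pop Main) (Seq (Pop Main) Q)))
    (Store (behead (W true) ++ W x ++ m) a b c) (Store (W (f x) ++ m) a b c)
    (3 + Bf (sz x)).
  apply: runs_le.
    apply: runs_seq (runs_pop _ _) _; apply: runs_seq (runs_pop _ _) _.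
    by apply: runs_seq (runs_pop _ _) _; apply: Hf.
  by lia.
have [||i hi|b3 [t3 hh3 H3]] := IH (f x).
- by move=> i hi; rewrite -iterSr; apply: h1.
- by rewrite -iterSr.
- by rewrite -iterSr; apply: h3.
exists b3, (t + t2 + t3).
  by have := mBp _ _ (h3 0 isT); have := mBf _ _ (h3 0 isT); have /= := h3 0 isT; lia.
by rewrite -iterSr in H3; apply: EWhileT H H2 H3.
Qed.

(** * Polynomial and exponential growth *)

Definition pb (B : nat -> nat) := exists c, forall n, B n <= (n + 2) ^ c.
Definition eb (B : nat -> nat) := exists c, forall n, B n <= 2 ^ ((n + 2) ^ c).

Lemma mono_exp c : mono (fun n => (n + 2) ^ c).
Proof. by case: c => [|c] m n h //; rewrite leq_exp2r // leq_add2r. Qed.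

Lemma mono_exp2 c : mono (fun n => 2 ^ ((n + 2) ^ c)).
Proof. by move=> m n h; rewrite leq_exp2l // mono_exp. Qed.

(** The base n + 2 is at least 2 even for n = 0, so that constants are absorbed by the exponent. *)
Lemma pb_const k : pb (fun _ => k).
Proof.
exists k => n; apply: leq_trans (ltnW (ltn_expl k (ltnSn 1))) _.
by case: k => // k; rewrite leq_exp2r // leq_addl.
Qed.

Lemma pb_id : pb id.
Proof. by exists 1 => n; rewrite expn1 leq_addr. Qed.

Lemma pb_add B1 B2 : pb B1 -> pb B2 -> pb (fun n => B1 n + B2 n).
Proof.
move=> [c1 h1] [c2 h2]; exists (c1 + c2).+1 => n.
have g c : 0 < (n + 2) ^ c by rewrite expn_gt0 addn2.
have := h1 n; have := h2 n; have := g c1; have := g c2.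
by rewrite expnS expnD; nia.
Qed.

Lemma pb_mul B1 B2 : pb B1 -> pb B2 -> pb (fun n => B1 n * B2 n).
Proof. by move=> [c1 h1] [c2 h2]; exists (c1 + c2) => n; rewrite expnD leq_mul. Qed.

Lemma exp_exp_bound n c d : ((n + 2) ^ c + 2) ^ d <= (n + 2) ^ ((c + 2) * d).
Proof.
rewrite expnM; case: d => [|d]; first by rewrite !expn0.
rewrite leq_exp2r //.
have g : 0 < (n + 2) ^ c by rewrite expn_gt0 addn2.
by rewrite expnD; nia.
Qed.

Lemma pb_comp B1 B2 : pb B1 -> pb B2 -> pb (fun n => B1 (B2 n)).
Proof.
move=> [c1 h1] [c2 h2]; exists ((c2 + 2) * c1) => n.
apply: leq_trans (h1 _) _; apply: leq_trans (exp_exp_bound _ _ _).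
exact: mono_exp.
Qed.

Lemma pb_le B1 B2 : pb B2 -> (forall n, B1 n <= B2 n) -> pb B1.
Proof. by move=> [c h] hB; exists c => n; apply: leq_trans (h n). Qed.

Lemma pb_exp c : pb (fun n => (n + 2) ^ c). Proof. by exists c. Qed.

Lemma pb_expn B k : pb B -> pb (fun n => B n ^ k).
Proof.
move=> h; elim: k => [|k IH]; first exact: (pb_const 1).
by apply: pb_le (pb_mul h IH) _ => n; rewrite expnS.
Qed.

Lemma eb_pb B : pb B -> eb B.
Proof.
by move=> [c h]; exists c => n; apply: leq_trans (h n) _; rewrite ltnW // ltn_expl.
Qed.

Lemma eb_le B1 B2 : eb B2 -> (forall n, B1 n <= B2 n) -> eb B1.
Proof. by move=> [c h] hB; exists c => n; apply: leq_trans (h n). Qed.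

Lemma eb_exp2 B : pb B -> eb (fun n => 2 ^ B n).
Proof. by move=> [c h]; exists c => n; rewrite leq_exp2l. Qed.

(** The degree of the polynomial moves into the exponent. An exponential of an exponential would be
    too large, and so [ET_comp] and [ET_PT_comp] each demand that one of the two functions be
    polynomial. *)
Lemma eb_pow B1 B2 : pb B1 -> eb B2 -> eb (fun n => B1 (B2 n)).
Proof.
move=> [c1 h1] [c2 h2].
have [d hd] : pb (fun n => c1 * ((n + 2) ^ c2 + 2)).
  exact: pb_mul (pb_const _) (pb_add (pb_exp _) (pb_const _)).
exists d => n; apply: leq_trans (h1 _) _.
apply: (@leq_trans (2 ^ (c1 * ((n + 2) ^ c2 + 2)))); last by rewrite leq_exp2l.
rewrite mulnC expnM; case: c1 {h1 hd} => // c1; rewrite leq_exp2r //.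
have g : 0 < 2 ^ ((n + 2) ^ c2) by rewrite expn_gt0.
by have := h2 n; rewrite expnD; nia.
Qed.

Lemma eb_add B1 B2 : eb B1 -> eb B2 -> eb (fun n => B1 n + B2 n).
Proof.
move=> [c1 h1] [c2 h2].
have [d hd] : pb (fun n => (n + 2) ^ c1 + (n + 2) ^ c2 + 1).
  exact: pb_add (pb_add (pb_exp _) (pb_exp _)) (pb_const _).
exists d => n.
apply: (@leq_trans (2 ^ ((n + 2) ^ c1 + (n + 2) ^ c2 + 1))); last by rewrite leq_exp2l.
have g c : 0 < 2 ^ ((n + 2) ^ c) by rewrite expn_gt0.
have := h1 n; have := h2 n; have := g c1; have := g c2.
by rewrite !expnD; nia.
Qed.

Lemma eb_mul B1 B2 : eb B1 -> eb B2 -> eb (fun n => B1 n * B2 n).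
Proof.
move=> [c1 h1] [c2 h2].
have [d hd] : pb (fun n => (n + 2) ^ c1 + (n + 2) ^ c2).
  exact: pb_add (pb_exp _) (pb_exp _).
exists d => n.
apply: (@leq_trans (2 ^ ((n + 2) ^ c1 + (n + 2) ^ c2))); last by rewrite leq_exp2l.
by rewrite expnD leq_mul.
Qed.

Lemma eb_comp B1 B2 : eb B1 -> pb B2 -> eb (fun n => B1 (B2 n)).
Proof.
move=> [c1 h1] [c2 h2]; have [d hd] := pb_comp (pb_exp c1) (pb_exp c2).
exists d => n; apply: leq_trans (h1 _) _; rewrite leq_exp2l //.
by apply: leq_trans (hd n); apply: mono_exp.
Qed.

Ltac pb := repeat first
  [ assumption | apply: pb_id | apply: pb_const | apply: pb_exp | apply: pb_add
  | apply: pb_mul | apply: pb_expn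
  | match goal with |- pb (fun n => (?e + 2) ^ ?c) =>
      apply: (pb_comp (B1 := fun n => (n + 2) ^ c)) end ].

Definition PT {T U} {eT : Enc T} {eU : Enc U} (f : T -> U) :=
  exists P c, computes_fun P f (fun n => (n + 2) ^ c).

Definition ET {T U} {eT : Enc T} {eU : Enc U} (f : T -> U) :=
  exists P c, computes_fun P f (fun n => 2 ^ ((n + 2) ^ c)).

Lemma PT_of {T U} {eT : Enc T} {eU : Enc U} P (f : T -> U) B : computes_fun P f B -> pb B -> PT f.
Proof. by move=> H [c h]; exists P, c; apply: computes_le H _. Qed.

Lemma ET_of {T U} {eT : Enc T} {eU : Enc U} P (f : T -> U) B : computes_fun P f B -> eb B -> ET f.
Proof. by move=> H [c h]; exists P, c; apply: computes_le H _. Qed.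

Lemma PT_eq {T U} {eT : Enc T} {eU : Enc U} (f h : T -> U) : f =1 h -> PT f -> PT h.
Proof. by move=> E [P [c H]]; exists P, c => x m a b d; rewrite -E. Qed.

Lemma ET_eq {T U} {eT : Enc T} {eU : Enc U} (f h : T -> U) : f =1 h -> ET f -> ET h.
Proof. by move=> E [P [c H]]; exists P, c => x m a b d; rewrite -E. Qed.

Lemma PT_sz {T U} {eT : Enc T} {eU : Enc U} (f : T -> U) :
  PT f -> exists c, forall x, sz (f x) <= (sz x + 2) ^ c.
Proof.
move=> [P [c H]]; have [d hd] := pb_add pb_id (pb_exp c).
by exists d => x; apply: leq_trans (computes_size x H) (hd _).
Qed.

Section PolyTime.
Context {T U V : Type} {eT : Enc T} {eU : Enc U} {eV : Enc V}.

Lemma PT_comp (h : U -> V) (f : T -> U) : PT h -> PT f -> PT (fun x => h (f x)).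
Proof.
move=> [Q [d Hh]] [P [c Hf]]; apply: PT_of (computes_comp (mono_exp d) Hf Hh) _.
by pb.
Qed.

Lemma ET_comp (h : U -> V) (f : T -> U) : PT h -> ET f -> ET (fun x => h (f x)).
Proof.
move=> [Q [d Hh]] [P [c Hf]]; apply: ET_of (computes_comp (mono_exp d) Hf Hh) _.
have ec : eb (fun n => 2 ^ ((n + 2) ^ c)) by exists c.
apply: eb_add => //; apply: eb_pow (pb_exp d) (eb_add _ ec).
exact/eb_pb/pb_id.
Qed.

Lemma ET_PT_comp (h : U -> V) (f : T -> U) : ET h -> PT f -> ET (fun x => h (f x)).
Proof.
move=> [Q [d Hh]] [P [c Hf]]; apply: ET_of (computes_comp (mono_exp2 d) Hf Hh) _.
apply: eb_add; first exact/eb_pb/pb_exp.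
have ec : eb (fun n => 2 ^ ((n + 2) ^ d)) by exists d.
by apply: eb_comp ec _; pb.
Qed.

Lemma PT_pair (f : T -> U) (h : T -> V) : PT f -> PT h -> PT (fun x => (f x, h x)).
Proof.
by move=> [P [c Hf]] [Q [d Hh]]; apply: PT_of (computes_pair Hf Hh) _; pb.
Qed.

Lemma ET_pair (f : T -> U) (h : T -> V) : ET f -> ET h -> ET (fun x => (f x, h x)).
Proof.
move=> [P [c Hf]] [Q [d Hh]]; apply: ET_of (computes_pair Hf Hh) _.
apply: eb_mul; first exact/eb_pb/pb_const.
apply: eb_add; last exact/eb_pb/pb_const.
apply: eb_add; last by exists d.
by apply: eb_add; [exact/eb_pb/pb_id|exists c].
Qed.

Lemma ET_PT (f : T -> U) : PT f -> ET f.
Proof. by move=> [P [c Hf]]; apply: ET_of Hf _; apply/eb_pb/pb_exp. Qed.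

Lemma PT_const (y : U) : PT (fun _ : T => y).
Proof. by apply: PT_of (computes_const y) _; pb. Qed.

Lemma PT_recode (f : T -> U) : (forall x, enc (f x) = enc x) -> PT f.
Proof. by move=> E; apply: PT_of (computes_recode E) _; pb. Qed.

Lemma PT_if (p : T -> bool) (f h : T -> U) :
  PT p -> PT f -> PT h -> PT (fun x => if p x then f x else h x).
Proof.
by move=> [P [c Hp]] [Q [d Hf]] [R [e Hh]]; apply: PT_of (computes_if Hp Hf Hh) _; pb.
Qed.

Lemma PT_case (l : T -> seq U) (f : U -> seq U -> T -> V) (h : T -> V) :
  PT l -> PT (fun p => f p.1.1 p.1.2 p.2) -> PT h ->
  PT (fun x => if l x is y :: s then f y s x else h x).
Proof.
move=> [P [c Hl]] [Q [d Hf]] [R [e Hh]].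
by apply: PT_of (computes_case (mono_exp d) Hl Hf Hh) _; pb.
Qed.

(** The sizes of all intermediate values need a bound of their own: polynomially many rounds of a
    polynomial-time function, such as doubling, may produce exponentially long values. *)
Lemma PT_iter (p : U -> bool) (f : U -> U) (i0 h : T -> U) B1 B2 :
  PT p -> PT f -> PT i0 -> pb B1 -> pb B2 ->
  (forall x, exists n, [/\ forall i, i < n -> p (iter i f (i0 x)),
    ~~ p (iter n f (i0 x)), n <= B1 (sz x),
    forall i, i <= n -> sz (iter i f (i0 x)) <= B2 (sz x) & h x = iter n f (i0 x)]) ->
  PT h.
Proof.
move=> [P [c Hp]] [Q [d Hf]] [R [e Hi]] pb1 pb2 hh.
pose B n := (n + 2) ^ e + (B1 n).+1 * (33 * B2 n + (B2 n + 2) ^ c + (B2 n + 2) ^ d + 34).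
apply: (PT_of (P := Seq R (while_fun P Q)) (B := B)); last first.
  have p1 : pb (fun n => (B1 n).+1).
    by apply: pb_le (pb_add (pb_const 1) pb1) _ => k; rewrite add1n.
  by rewrite /B; pb.
move=> x m a b c'; have [n [h1 h2 h3 h4 ->]] := hh x; apply: runs_le.
  apply: runs_seq (Hi _ _ _ _ _) _.
  exact: (computes_while (mono_exp c) (mono_exp d) Hp Hf _ _ _ _ h1 h2 h4).
by rewrite /B leq_add2l leq_mul // ltnS.
Qed.

Lemma ET_iter (p : U -> bool) (f : U -> U) (i0 h : T -> U) B1 B2 :
  PT p -> PT f -> PT i0 -> eb B1 -> eb B2 ->
  (forall x, exists n, [/\ forall i, i < n -> p (iter i f (i0 x)),
    ~~ p (iter n f (i0 x)), n <= B1 (sz x),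
    forall i, i <= n -> sz (iter i f (i0 x)) <= B2 (sz x) & h x = iter n f (i0 x)]) ->
  ET h.
Proof.
move=> [P [c Hp]] [Q [d Hf]] [R [e Hi]] eb1 eb2 hh.
pose B n := (n + 2) ^ e + (B1 n).+1 * (33 * B2 n + (B2 n + 2) ^ c + (B2 n + 2) ^ d + 34).
apply: (ET_of (P := Seq R (while_fun P Q)) (B := B)); last first.
  apply: eb_add; first exact/eb_pb/pb_exp.
  apply: eb_mul.
    apply: (@eb_le _ (fun k => B1 k + 1)) => [|k]; last by rewrite addn1.
    by apply: eb_add => //; apply/eb_pb/pb_const.
  apply: (eb_pow (B1 := fun n => 33 * n + (n + 2) ^ c + (n + 2) ^ d + 34)) eb2.
  by pb.
move=> x m a b c'; have [n [h1 h2 h3 h4 ->]] := hh x; apply: runs_le.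
  apply: runs_seq (Hi _ _ _ _ _) _.
  exact: (computes_while (mono_exp c) (mono_exp d) Hp Hf _ _ _ _ h1 h2 h4).
by rewrite /B leq_add2l leq_mul // ltnS.
Qed.

Lemma iter_exists (p : U -> bool) (f : U -> U) (Inv : U -> Prop) (mu : U -> nat) u :
  Inv u -> (forall u, Inv u -> p u -> Inv (f u)) ->
  (forall u, Inv u -> p u -> mu (f u) < mu u) ->
  exists n, [/\ forall i, i < n -> p (iter i f u), ~~ p (iter n f u), n <= mu u &
    forall i, i <= n -> Inv (iter i f u)].
Proof.
move=> Iu HI Hmu; have [k] := ubnP (mu u).
elim: k u Iu => // k IH u Iu hk; case pu: (p u).
  have [|n [h1 h2 h3 h4]] := IH (f u) (HI u Iu pu).
    exact: leq_trans (Hmu u Iu pu) hk.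
  exists n.+1; split.
  - by case=> // i hi; rewrite iterSr h1.
  - by rewrite iterSr.
  - exact: leq_ltn_trans h3 (Hmu u Iu pu).
  - by case=> // i hi; rewrite iterSr; apply: h4.
by exists 0; rewrite pu; split=> // -[].
Qed.

Lemma PT_while (p : U -> bool) (f : U -> U) (i0 : T -> U) (res : U -> V) (h : T -> V)
    (Inv : T -> U -> Prop) (mu : U -> nat) B1 B2 :
  PT p -> PT f -> PT i0 -> PT res -> pb B1 -> pb B2 ->
  (forall x, Inv x (i0 x)) ->
  (forall x u, Inv x u -> p u -> Inv x (f u)) ->
  (forall x u, Inv x u -> p u -> mu (f u) < mu u) ->
  (forall x, mu (i0 x) <= B1 (sz x)) ->
  (forall x u, Inv x u -> sz u <= B2 (sz x)) ->
  (forall x u, Inv x u -> ~~ p u -> res u = h x) ->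
  PT h.
Proof.
move=> Hp Hf Hi Hres pb1 pb2 I0 IS mulow hmu hsz hres.
have n_ex x := iter_exists (I0 x) (IS x) (mulow x).
pose stop x n := [&& all (fun i => p (iter i f (i0 x))) (iota 0 n),
  ~~ p (iter n f (i0 x)) & n <= mu (i0 x)].
have stop_ex x : exists n, stop x n.
  have [n [h1 h2 h3 _]] := n_ex x; exists n; rewrite /stop h2 h3 !andbT.
  by apply/allP => i; rewrite mem_iota => /h1.
(* The final value of the loop must be a function of the input before [res] can be composed with it;
   minimality over a decidable condition turns the existence of a number of rounds into a
   function. *)
pose k x := ex_minn (stop_ex x).
have HI x i : i <= k x -> Inv x (iter i f (i0 x)).
  rewrite /k; case: ex_minnP => n /and3P[/allP hn _ _] _.
  elim: i => // i IH hi; rewrite iterS; apply: IS; first exact/IH/ltnW.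
  by apply: hn; rewrite mem_iota.
have np x : ~~ p (iter (k x) f (i0 x)).
  by rewrite /k; case: ex_minnP => n /and3P[_ ->].
apply: (PT_eq (f := fun x => res (iter (k x) f (i0 x)))) => [x|].
  exact: hres (HI x _ (leqnn _)) (np x).
apply: PT_comp Hres _; apply: (PT_iter Hp Hf Hi pb1 pb2) => x; exists (k x); split=> //.
- rewrite /k; case: ex_minnP => n /and3P[/allP hn _ _] _ i hi.
  by apply: hn; rewrite mem_iota.
- apply: leq_trans (hmu x); rewrite /k.
  by case: ex_minnP => n /and3P[].
- by move=> i /HI /hsz.
Qed.

End PolyTime.

Lemma PT_id {T} {eT : Enc T} : PT (fun x : T => x).
Proof. exact: PT_recode. Qed.

Lemma PT_fst {G T U} {eG : Enc G} {eT : Enc T} {eU : Enc U} (f : G -> T * U) :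
  PT f -> PT (fun x => (f x).1).
Proof. by apply: (PT_comp (h := fst)); refine (PT_of (@computes_fst _ _ _ _) _); pb. Qed.

Lemma PT_snd {G T U} {eG : Enc G} {eT : Enc T} {eU : Enc U} (f : G -> T * U) :
  PT f -> PT (fun x => (f x).2).
Proof. by apply: (PT_comp (h := snd)); refine (PT_of (@computes_snd _ _ _ _) _); pb. Qed.

Lemma PT_cons {G T} {eG : Enc G} {eT : Enc T} (f : G -> T) (s : G -> seq T) :
  PT f -> PT s -> PT (fun x => f x :: s x).
Proof.
move=> Hf Hs; apply: (PT_comp (h := fun p => p.1 :: p.2)) (PT_pair Hf Hs).
by refine (PT_of (@computes_cons _ _) _); pb.
Qed.

(** * A library of polynomial-time functions *)

(* [pt] decomposes functions syntactically; [pt_more] and [pt_user] are hooks that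
   are redefined as the library grows. *)
Ltac pt_more := fail.

Ltac pt_step := cbv beta; match goal with
  | |- @PT _ _ _ _ (fun x => x) => exact PT_id
  | |- @PT _ _ _ _ (fun _ => ?t) => exact (PT_const t)
  | H : @PT _ _ _ _ ?f |- @PT _ _ _ _ ?f => exact H
  | |- @PT _ _ _ _ fst => exact (PT_fst PT_id)
  | |- @PT _ _ _ _ snd => exact (PT_snd PT_id)
  | |- @PT _ _ _ _ (fun x => fst (@?f x)) => refine (PT_fst (f := f) _)
  | |- @PT _ _ _ _ (fun x => snd (@?f x)) => refine (PT_snd (f := f) _)
  | |- @PT _ _ _ _ (fun x => (@?f x, @?h x)) => refine (PT_pair (f := f) (h := h) _ _)
  | |- @PT _ _ _ _ (fun x => @?f x :: @?h x) => refine (PT_cons (f := f) (s := h) _ _)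
  | |- @PT _ _ _ _ (fun x => match @?p x with true => @?f x | false => @?h x end) =>
      refine (PT_if (p := p) (f := f) (h := h) _ _ _)
  | |- _ => pt_more
  | H : @PT _ _ _ _ ?v |- @PT _ _ _ _ (fun x => ?v (@?f x)) =>
      refine (PT_comp (h := v) (f := f) H _)
  | H : @PT _ _ _ _ (fun p => ?v p.1 p.2) |- @PT _ _ _ _ (fun x => ?v (@?f x) (@?h x)) =>
      refine (PT_comp (h := fun p => v p.1 p.2) (f := fun x => (f x, h x)) H _)
  end.
Ltac pt := repeat pt_step.

Lemma PT_case' {G T U} {eG : Enc G} {eT : Enc T} {eU : Enc U}
    (l : G -> seq T) (f : T -> seq T -> G -> U) (h : G -> U) :
  PT l -> PT (fun p : (T * seq T) * G => f p.1.1 p.1.2 p.2) -> PT h ->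
  PT (fun x => match l x with [::] => h x | y :: s => f y s x end).
Proof. exact: PT_case. Qed.

Ltac pt_more ::= match goal with
  | |- @PT _ _ _ _ (fun x => match @?l x with [::] => @?h x | y :: s => @?f x y s end) =>
      refine (PT_case' (l := l) (f := fun y s x => f x y s) (h := h) _ _ _)
  end.

(** The function also sees the tail; its length provides indices, as in [PT_iota]. *)
Fixpoint foldt {A E} (F : A -> E -> seq E -> A) (a : A) (l : seq E) : A :=
  if l is x :: s then foldt F (F a x s) s else a.

Section Fold.
Context {G A E : Type} {eG : Enc G} {eA : Enc A} {eE : Enc E}.

Lemma PT_foldt (F : A -> E -> seq E -> G -> A) (l : G -> seq E) (a : G -> A)
    (I : G -> A -> seq E -> Prop) B :
  PT (fun p : (E * seq E) * (A * G) => F p.2.1 p.1.1 p.1.2 p.2.2) ->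
  PT l -> PT a -> pb B -> (forall g, I g (a g) (l g)) ->
  (forall g acc x s, sz x + sz s <= sz (l g) ->
     I g acc (x :: s) -> I g (F acc x s g) s) ->
  (forall g acc s, I g acc s -> sz acc <= B (sz g)) ->
  PT (fun g => foldt (fun acc x s => F acc x s g) (a g) (l g)).
Proof.
move=> HF Hl Ha pbB I0 IS hB; have [c hc] := PT_sz Hl.
pose step (u : seq E * (A * G)) :=
  if u.1 is x :: s then (s, (F u.2.1 x s u.2.2, u.2.2)) else u.
pose (Inv := fun g (u : seq E * (A * G)) =>
  [/\ u.2.2 = g, I g u.2.1 u.1, sz u.1 <= sz (l g) &
  foldt (fun acc x s => F acc x s g) u.2.1 u.1 =
  foldt (fun acc x s => F acc x s g) (a g) (l g)]).
refine (@PT_while G (seq E * (A * G)) A _ _ _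
  (fun u => if u.1 is x :: s then true else false)
  step (fun g => (l g, (a g, g))) (fun u => u.2.1) _ Inv (fun u => size u.1)
  (fun n => (n + 2) ^ c) (fun n => (n + 2) ^ c + (B n + n + 2) + 2)
  _ _ _ _ _ _ _ _ _ _ _ _).
- by pt.
- rewrite /step; pt.
  exact: (PT_comp (h := fun p : (E * seq E) * (A * G) => F p.2.1 p.1.1 p.1.2 p.2.2)
    (f := fun p : (E * seq E) * (seq E * (A * G)) => (p.1, p.2.2)) HF ltac:(pt)).
- by pt.
- by pt.
- by pb.
- by pb.
- by move=> g; split.
- move=> g [[|x s] [acc g']] [/= -> Ig hs Ef] // _; split=> //=.
    by apply: IS => //; rewrite -sz_cons.
  by apply: leq_trans hs; rewrite sz_cons leq_addl.
- by move=> g [[|x s] [acc g']].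
- move=> g /=; apply: leq_trans (hc g).
  by have := @sz_size _ eE (l g); lia.
- move=> g [s [acc g']] [/= -> Ig hs _]; rewrite !sz_pair.
  by have := hc g; have := hB _ _ _ Ig; lia.
- by move=> g [[|x s] [acc g']] [].
Qed.
End Fold.

Lemma PT_catrev {G E} {eG : Enc G} {eE : Enc E} (s t : G -> seq E) :
  PT s -> PT t -> PT (fun g => catrev (s g) (t g)).
Proof.
move=> Hs Ht; have [c hc] := PT_sz Hs; have [d hd] := PT_sz Ht.
apply: (@PT_eq _ _ _ _ (fun g => foldt (fun acc x _ => x :: acc) (t g) (s g))).
  by move=> g; elim: (s g) (t g) => //= x l IH a.
apply: (PT_foldt (F := fun acc x _ _ => x :: acc)
  (I := fun g acc l => sz acc + sz l <= sz (s g) + sz (t g))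
  (B := fun n => (n + 2) ^ c + (n + 2) ^ d)) => //.
- by pt.
- by pb.
- by move=> g; rewrite addnC.
- by move=> g acc x l _; rewrite !sz_cons; lia.
- by move=> g acc l; have := hc g; have := hd g; lia.
Qed.

Lemma PT_rev {G E} {eG : Enc G} {eE : Enc E} (s : G -> seq E) :
  PT s -> PT (fun g => rev (s g)).
Proof. by move=> Hs; apply: PT_catrev Hs _; pt. Qed.

Lemma PT_cat {G E} {eG : Enc G} {eE : Enc E} (s t : G -> seq E) :
  PT s -> PT t -> PT (fun g => s g ++ t g).
Proof.
move=> Hs Ht; apply: PT_eq (PT_catrev (PT_rev Hs) Ht) => g.
by rewrite catrevE revK.
Qed.

Fixpoint mapt {T U} (F : T -> seq T -> U) (l : seq T) : seq U :=
  if l is x :: s then F x s :: mapt F s else [::].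

Lemma PT_mapt {G T U} {eG : Enc G} {eT : Enc T} {eU : Enc U}
    (F : T -> seq T -> G -> U) (l : G -> seq T) :
  PT (fun p : (T * seq T) * G => F p.1.1 p.1.2 p.2) -> PT l ->
  PT (fun g => mapt (fun x s => F x s g) (l g)).
Proof.
move=> HF Hl; have [c hc] := PT_sz Hl; have [d hd] := PT_sz HF.
apply: (@PT_eq _ _ _ _ (fun g => rev (foldt (fun acc x s => F x s g :: acc) [::] (l g)))).
  move=> g; rewrite -[RHS]cat0s -[in RHS](revK [::]) /= -[in LHS](cat0s [::]).
  suff H a : rev (foldt (fun acc x s => F x s g :: acc) a (l g)) =
             rev a ++ mapt (fun x s => F x s g) (l g) by rewrite H.
  elim: (l g) a => [|x s IH] a /=; first by rewrite cats0.
  by rewrite IH rev_cons cat_rcons.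
apply: PT_rev.
(* Bounds the size of one image: the base adds up a bound for [x] and [s], the size of [g], the
   brackets of the two pairs and the 2 in the bound for [F]. In the invariant, every remaining
   element reserves this amount. *)
pose M n := ((n + 2) ^ c + 2 + n + 2 + 2) ^ d.
apply: (PT_foldt (F := fun acc x s g => F x s g :: acc) (a := fun _ => [::])
  (I := fun g acc s => sz acc + size s * M (sz g) <= 2 + size (l g) * M (sz g))
  (B := fun n => 2 + (n + 2) ^ c * M n)) => //.
- by pt; exact: (PT_comp (h := fun p : (T * seq T) * G => F p.1.1 p.1.2 p.2)
    (f := fun p : (T * seq T) * (seq U * G) => (p.1, p.2.2)) HF ltac:(pt)).
- by pt.
- by rewrite /M; pb.
- move=> g acc x s hs; rewrite sz_cons /= mulSn => H; apply: leq_trans H.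
  have /= := hd ((x, s), g); rewrite !sz_pair => h1.
  have h2 : sz (F x s g) <= M (sz g); last by lia.
  apply: leq_trans h1 _; rewrite /M.
  by case: d {hd M} => // d; rewrite leq_exp2r //; have := hc g; lia.
- move=> g acc s H; apply: leq_trans (leq_trans H _); first by rewrite leq_addr.
  by rewrite leq_add2l leq_mul //; have := hc g; have := @sz_size _ eT (l g); lia.
Qed.

Lemma PT_map {G T U} {eG : Enc G} {eT : Enc T} {eU : Enc U}
    (F : T -> G -> U) (l : G -> seq T) :
  PT (fun p : T * G => F p.1 p.2) -> PT l ->
  PT (fun g => [seq F x g | x <- l g]).
Proof.
move=> HF Hl; apply: (@PT_eq _ _ _ _ (fun g => mapt (fun x _ => F x g) (l g))).
  by move=> g; elim: (l g) => //= x s ->.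
apply: PT_mapt => //.
exact: (PT_comp (h := fun p : T * G => F p.1 p.2)
    (f := fun p : (T * seq T) * G => (p.1.1, p.2)) HF ltac:(pt)).
Qed.

Lemma PT_flatten {G T} {eG : Enc G} {eT : Enc T} (l : G -> seq (seq T)) :
  PT l -> PT (fun g => flatten (l g)).
Proof.
move=> Hl; have [c hc] := PT_sz Hl.
apply: (@PT_eq _ _ _ _ (fun g => foldt (fun acc x _ => acc ++ x) [::] (l g))).
  move=> g; rewrite -[RHS]cat0s; elim: (l g) [::] => [|x s IH] a /=.
    by rewrite cats0.
  by rewrite IH catA.
apply: (PT_foldt (F := fun acc x _ _ => acc ++ x) (a := fun _ => [::])
  (I := fun g acc s => sz acc + sz s <= 2 + sz (l g))
  (B := fun n => 2 + (n + 2) ^ c)) => //.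
- by apply: PT_cat; pt.
- by pt.
- by pb.
- move=> g acc x s _; rewrite sz_cons; have := @sz_cat _ eT acc x; lia.
- by move=> g acc s; have := hc g; lia.
Qed.

(* Acceptance may depend on the elements collected before; the result is in
   reverse order. *)
Definition collect {T : Type} (P : T -> seq T -> bool) (a l : seq T) : seq T :=
  foldl (fun acc x => if P x acc then x :: acc else acc) a l.

Lemma PT_collect {G T} {eG : Enc G} {eT : Enc T} (P : T -> seq T -> G -> bool)
    (l : G -> seq T) :
  PT (fun p : T * (seq T * G) => P p.1 p.2.1 p.2.2) -> PT l ->
  PT (fun g => collect (fun x acc => P x acc g) [::] (l g)).
Proof.
move=> HP Hl; have [c hc] := PT_sz Hl.
pose F (acc : seq T) x (s : seq T) g := if P x acc g then x :: acc else acc.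
apply: (@PT_eq _ _ _ _ (fun g => foldt (fun acc x s => F acc x s g) [::] (l g))).
  by move=> g; rewrite /collect; elim: (l g) [::] => //= x s IH a.
apply: (PT_foldt (F := F) (a := fun _ => [::])
  (I := fun g acc s => sz acc + sz s <= 2 + sz (l g))
  (B := fun n => 2 + (n + 2) ^ c)) => //.
- rewrite /F; pt.
  exact: (PT_comp (h := fun p : T * (seq T * G) => P p.1 p.2.1 p.2.2)
    (f := fun p : (T * seq T) * (seq T * G) => (p.1.1, p.2)) HP ltac:(pt)).
- by pt.
- by pb.
- by move=> g acc x s _; rewrite /F sz_cons; case: (P _ _ _); rewrite ?sz_cons; lia.
- by move=> g acc s; have := hc g; lia.
Qed.

Lemma PT_filter {G T} {eG : Enc G} {eT : Enc T} (P : T -> G -> bool) (l : G -> seq T) :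
  PT (fun p : T * G => P p.1 p.2) -> PT l -> PT (fun g => [seq x <- l g | P x g]).
Proof.
move=> HP Hl; apply: (@PT_eq _ _ _ _
    (fun g => flatten [seq if P x g then [:: x] else [::] | x <- l g])).
  by move=> g; elim: (l g) => //= x s ->; case: (P x g).
apply: PT_flatten; apply: (PT_map (F := fun x g => if P x g then [:: x] else [::])) => //.
by pt.
Qed.

Lemma PT_has {G T} {eG : Enc G} {eT : Enc T} (P : T -> G -> bool) (l : G -> seq T) :
  PT (fun p : T * G => P p.1 p.2) -> PT l -> PT (fun g => has (fun x => P x g) (l g)).
Proof.
move=> HP Hl; apply: (@PT_eq _ _ _ _
    (fun g => match [seq x <- l g | P x g] with [::] => false | _ :: _ => true end)).
  by move=> g; elim: (l g) => //= x s <-; case: (P x g).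
apply: PT_case'; [exact: PT_filter|by pt|by pt].
Qed.

Lemma PT_andb {G} {eG : Enc G} (p q : G -> bool) : PT p -> PT q -> PT (fun g => p g && q g).
Proof. by move=> Hp Hq; apply: PT_if => //; pt. Qed.

Lemma PT_orb {G} {eG : Enc G} (p q : G -> bool) : PT p -> PT q -> PT (fun g => p g || q g).
Proof. by move=> Hp Hq; apply: PT_if => //; pt. Qed.

Lemma PT_negb {G} {eG : Enc G} (p : G -> bool) : PT p -> PT (fun g => ~~ p g).
Proof. by move=> Hp; apply: PT_if => //; pt. Qed.

Lemma PT_all {G T} {eG : Enc G} {eT : Enc T} (P : T -> G -> bool) (l : G -> seq T) :
  PT (fun p : T * G => P p.1 p.2) -> PT l -> PT (fun g => all (fun x => P x g) (l g)).
Proof.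
move=> HP Hl; apply: (@PT_eq _ _ _ _ (fun g => ~~ has (fun x => ~~ P x g) (l g))).
  by move=> g; elim: (l g) => //= x s <-; case: (P x g).
by apply: PT_negb; apply: PT_has => //; apply: PT_negb.
Qed.

Lemma PT_nth {G T} {eG : Enc G} {eT : Enc T} (x0 : T) (l : G -> seq T) (i : nat) :
  PT l -> PT (fun g => nth x0 (l g) i).
Proof.
elim: i l => [|i IH] l Hl.
  apply: (@PT_eq _ _ _ _ (fun g => match l g with [::] => x0 | x :: _ => x end)).
    by move=> g; case: (l g).
  by apply: PT_case' => //; pt.
apply: (@PT_eq _ _ _ _ (fun g => nth x0 match l g with [::] => [::] | _ :: s => s end i)).
  by move=> g; case: (l g) => //=; rewrite nth_nil.
by apply: IH; apply: PT_case' => //; pt.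
Qed.

Lemma PT_head {G T} {eG : Enc G} {eT : Enc T} (x0 : T) (l : G -> seq T) :
  PT l -> PT (fun g => head x0 (l g)).
Proof.
by move=> Hl; apply: PT_eq (PT_nth x0 0 Hl) => g; rewrite nth0.
Qed.

(* The elements of a fixed list need no encoding: each one has its own program. *)
Lemma PT_fixed_map {G T U} {eG : Enc G} {eU : Enc U} (F : T -> G -> U) (l : seq T) :
  (forall x, PT (F x)) -> PT (fun g => [seq F x g | x <- l]).
Proof.
by move=> H; elim: l => [|x l IH] /=; [pt|apply: PT_cons].
Qed.

Lemma PT_fixed_has {G T} {eG : Enc G} (F : T -> G -> bool) (l : seq T) :
  (forall x, PT (F x)) -> PT (fun g => has (fun x => F x g) l).
Proof.
by move=> H; elim: l => [|x l IH] /=; [pt|apply: PT_orb].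
Qed.

Lemma PT_fixed_all {G T} {eG : Enc G} (F : T -> G -> bool) (l : seq T) :
  (forall x, PT (F x)) -> PT (fun g => all (fun x => F x g) l).
Proof.
by move=> H; elim: l => [|x l IH] /=; [pt|apply: PT_andb].
Qed.

(** A balanced word determines where it ends. The arbitrary continuations [u] and [v] are what the
    induction over a list of children needs. *)
Lemma word_of_prefix d e u v : word_of d ++ u = word_of e ++ v -> d = e /\ u = v.
Proof.
elim/data_ind': d e u v => ds IH [es] u v /=.
set F := fun ds => flatten (map word_of ds).
rewrite -/(F ds) -/(F es) -!catA /= => -[].
suff H : F ds ++ false :: u = F es ++ false :: v -> ds = es /\ u = v.
  by move=> /H[-> ->].
elim: ds IH es => [|d ds IHds] IH [|e es] /=.
- by case.
- by case: e.
- by case: d {IH}.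
rewrite -!catA => E; have [->  E'] := IH d (or_introl erefl) _ _ _ E.
by have [|-> ->] := IHds _ _ E' => // x xs; apply: IH; right.
Qed.

Lemma word_of_inj : injective word_of.
Proof.
by move=> d e E; apply: (@word_of_prefix _ _ [::] [::] _).1; rewrite E.
Qed.

HB.instance Definition _ := Equality.copy data (inj_type word_of_inj).

Definition kids (d : data) : seq data := let: Data ds := d in ds.

Lemma PT_kids {G} {eG : Enc G} (f : G -> data) : PT f -> PT (fun g => kids (f g)).
Proof.
move=> Hf; apply: PT_comp Hf; apply: PT_recode => -[ds] /=.
by rewrite /enc /enc_seq /= map_id.
Qed.

Lemma PT_Data {G} {eG : Enc G} (f : G -> seq data) : PT f -> PT (fun g => Data (f g)).
Proof.
move=> Hf; apply: (PT_comp (h := Data)) Hf; apply: PT_recode => ds.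
by rewrite /enc /enc_seq /= map_id.
Qed.

Lemma PT_enc {G T} {eG : Enc G} {eT : Enc T} (f : G -> T) :
  PT f -> PT (fun g => enc (f g)).
Proof. by move=> Hf; apply: (PT_comp (h := enc)) Hf; apply: PT_recode. Qed.

Ltac pt_more ::= match goal with
  | |- @PT _ _ _ _ (fun x => match @?l x with [::] => @?h x | y :: s => @?f x y s end) =>
      refine (PT_case' (l := l) (f := fun y s x => f x y s) (h := h) _ _ _)
  | |- @PT _ _ _ _ (fun g => kids (@?f g)) => refine (PT_kids (f := f) _)
  | |- @PT _ _ _ _ (fun g => Data (@?f g)) => refine (PT_Data (f := f) _)
  | |- @PT _ _ _ _ (fun g => enc (@?f g)) => refine (PT_enc (f := f) _)
  end.

Lemma eq_Data (s t : seq data) : (Data s == Data t) = (s == t).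
Proof. by apply/eqP/eqP => [[]|->]. Qed.

(** * Equality of encoded data *)

Section DataEq.

(** A mismatch is signalled by emptying the first list and making the second one nonempty: the loop
    stops, and the two lists are unequal for good. *)
Definition deq_step (u : seq data * seq data) : seq data * seq data :=
  match u.1 with
  | [::] => u
  | d :: r => match u.2 with
    | [::] => ([::], [:: Data [::]])
    | e :: q => match kids d with
      | [::] => match kids e with
        | [::] => (r, q)
        | _ :: _ => ([::], [:: Data [::]])
        end
      | x :: s => match kids e with
        | [::] => ([::], [:: Data [::]])
        | y :: t => (x :: Data s :: r, y :: Data t :: q)
        end
      end
    end
  end.

Lemma sz_Data (s : seq data) : sz (Data s) = sz s.
Proof. by rewrite /sz /W /enc /= /enc_seq map_id. Qed.

(* Compares two trees by unfolding both simultaneously with two work lists. *)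
Lemma PT_deq : PT (fun p : data * data => p.1 == p.2).
Proof.
pose (Inv := fun (p : data * data) (u : seq data * seq data) =>
  [/\ (p.1 == p.2) = (u.1 == u.2), sz u.1 <= sz p.1 + 2 & sz u.2 <= sz p.2 + 4]).
refine (@PT_while (data * data) (seq data * seq data) bool _ _ _
  (fun u => match u.1 with [::] => false | _ :: _ => true end)
  deq_step (fun p => ([:: p.1], [:: p.2]))
  (fun u => match u.2 with [::] => true | _ :: _ => false end) _ Inv
  (* Splitting the first node into its first child and the rest keeps the encoded size and lengthens
     the list by one; removing a leaf loses two bits and one element. Both decrease this measure. *)
  (fun u => 2 * sz u.1 - size u.1) (fun n => 2 * n + 4) (fun n => 2 * n + 8)
  _ _ _ _ _ _ _ _ _ _ _ _).
- by pt.
- by rewrite /deq_step; pt.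
- by pt.
- by pt.
- by pb.
- by pb.
- move=> [d e]; split=> /=; rewrite ?eqseq_cons ?andbT // !sz_cons sz_nil.
    by [].
  by lia.
- move=> [d e] [[|[ds] r] [|[es] q]] [/= E h1 h2] // _.
  + by split=> //=; rewrite ?E ?sz_cons ?sz_Data ?sz_nil //; pose proof (sz_ge2 e); lia.
  + move: E h1 h2; rewrite /deq_step /= !sz_cons !sz_Data.
    case: ds => [|x s]; case: es => [|y t] /=; rewrite ?sz_cons ?sz_nil => E h1 h2;
      split=> /=; rewrite ?E ?(sz_cons, sz_Data, sz_nil) ?(eqseq_cons, eq_Data) //; try lia; rewrite ?andbA; lia.
- move=> [d e] [[|[ds] r] [|[es] q]] [/= E h1 h2] // _.
    by rewrite /deq_step /= sz_nil sz_cons; pose proof (sz_ge2 (Data ds)); pose proof (sz_size r); lia.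
  rewrite /deq_step /= sz_cons sz_Data.
  pose proof (sz_size r) as hr.
  case: ds {E h1} => [|x s]; case: es {h2} => [|y t] /=; rewrite ?(sz_cons, sz_Data, sz_nil); try lia.
    by pose proof (sz_ge2 x); pose proof (sz_size s); lia.
- by move=> [d e] /=; rewrite sz_cons sz_nil sz_pair; lia.
- by move=> [d e] [l1 l2] [_ /= h1 h2]; rewrite !sz_pair; pose proof (sz_ge2 d); lia.
- by move=> [d e] [[|? ?] l2] [-> _ _] // _; case: l2.
Qed.

End DataEq.

Class EncInj (T : Type) (eT : Enc T) := enc_inj : injective (@enc T eT).

Lemma PT_eqop {G} {T : eqType} {eG : Enc G} {eT : Enc T} {iT : EncInj eT}
    (f h : G -> T) : PT f -> PT h -> PT (fun g => f g == h g).
Proof.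
move=> Hf Hh; apply: (@PT_eq _ _ _ _ (fun g => enc (f g) == enc (h g))).
  by move=> g; apply/eqP/eqP => [/iT|->].
by apply: (PT_comp (h := fun p => p.1 == p.2) PT_deq (f := fun g => (enc (f g), enc (h g)))); pt.
Qed.

#[export] Instance encinj_data : EncInj enc_data. Proof. by []. Qed.

#[export] Instance encinj_nat : EncInj enc_nat.
Proof. by move=> m n [] /(congr1 size); rewrite !size_nseq. Qed.

#[export] Instance encinj_pair T U (eT : Enc T) (eU : Enc U) :
  EncInj eT -> EncInj eU -> EncInj (enc_pair eT eU).
Proof. by move=> iT iU [x y] [x' y'] [/iT -> /iU ->]. Qed.

#[export] Instance encinj_seq T (eT : Enc T) : EncInj eT -> EncInj (enc_seq eT).
Proof. by move=> iT s t [] /(inj_map iT). Qed.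

Lemma PT_mem {G} {T : eqType} {eG : Enc G} {eT : Enc T} {iT : EncInj eT}
    (x : G -> T) (s : G -> seq T) : PT x -> PT s -> PT (fun g => x g \in s g).
Proof.
move=> Hx Hs; apply: (@PT_eq _ _ _ _ (fun g => has (fun y => x g == y) (s g))).
  by move=> g; rewrite -has_pred1; apply: eq_has => y; rewrite /= eq_sym.
by apply: (PT_has (P := fun y g => x g == y)) => //; apply: PT_eqop; pt.
Qed.

#[export] Instance enc_unit : Enc unit := fun _ => Data [::].

(** A unary number and a list of units have the same encoding, so lengths and counters reduce to
    lists without any computation. *)
Lemma enc_units (s : seq unit) : enc (size s) = enc s.
Proof. by congr Data; elim: s => //= x s <-. Qed.

Lemma PT_size {G T} {eG : Enc G} {eT : Enc T} (s : G -> seq T) :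
  PT s -> PT (fun g => size (s g)).
Proof.
move=> Hs; apply: (@PT_eq _ _ _ _ (fun g => size [seq tt | _ <- s g])).
  by move=> g; rewrite size_map.
apply: (PT_comp (h := @size unit)); first by apply: PT_recode => u; rewrite enc_units.
by apply: (PT_map (F := fun _ _ => tt)) => //; pt.
Qed.

Lemma PT_units {G} {eG : Enc G} (n : G -> nat) : PT n -> PT (fun g => nseq (n g) tt).
Proof.
move=> Hn; apply: (PT_comp (h := fun n => nseq n tt)) Hn.
by apply: PT_recode => k; rewrite -enc_units size_nseq.
Qed.

Lemma PT_succ {G} {eG : Enc G} (n : G -> nat) : PT n -> PT (fun g => (n g).+1).
Proof.
move=> Hn; apply: (@PT_eq _ _ _ _ (fun g => size (tt :: nseq (n g) tt))).
  by move=> g; rewrite /= size_nseq.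
by apply: PT_size; apply: PT_cons; [pt|apply: PT_units].
Qed.

(** The successive proper tails of a list of length n have lengths n - 1, ..., 0. *)
Lemma PT_iota {G} {eG : Enc G} (n : G -> nat) : PT n -> PT (fun g => iota 0 (n g)).
Proof.
move=> Hn; apply: (@PT_eq _ _ _ _ (fun g => rev (mapt (fun _ s => size s) (nseq (n g) tt)))).
  move=> g; elim: (n g) => //= k IH.
  by rewrite rev_cons IH size_nseq -[RHS]/(iota 0 k.+1) -[k.+1]addn1 iotaD cats1.
apply: PT_rev; apply: (PT_mapt (F := fun _ s _ => size s)); last exact: PT_units.
by apply: PT_size; pt.
Qed.

Fixpoint tuples {T} (n : nat) (l : seq T) : seq (seq T) :=
  if n is n'.+1 then flatten [seq [seq x :: s | s <- tuples n' l] | x <- l]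
  else [:: [::]].

(** The length is fixed, so there is one program for each length and the number of tuples is
    polynomial. Fixing the signature, the variables and the arities of the definable symbols matters
    here. *)
Lemma PT_tuples {G T} {eG : Enc G} {eT : Enc T} n (l : G -> seq T) :
  PT l -> PT (fun g => tuples n (l g)).
Proof.
move=> Hl; elim: n => [|n IH]; first exact: PT_const.
apply: PT_flatten; apply: (PT_map (F := fun x g => [seq x :: s | s <- tuples n (l g)])) => //.
apply: (PT_map (F := fun s p => p.1 :: s)); first by pt.
by apply: (PT_comp (h := fun g => tuples n (l g)) (f := snd)) => //; pt.
Qed.

Lemma mem_tuples {T : eqType} n (l s : seq T) :
  (s \in tuples n l) = (size s == n) && all (mem l) s.
Proof.
elim: n s => [|n IH] s; first by rewrite inE; case: s.
apply/idP/andP => [/flatten_mapP[x xl /mapP[t]]|].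
  by rewrite IH => /andP[/eqP <- tl ->]; split=> //=; rewrite xl tl.
case: s => [[]|x s [sn /= /andP[xl sl]]] //; apply/flatten_mapP; exists x => //.
by apply/mapP; exists s => //; rewrite IH sl andbT; exact: sn.
Qed.

Lemma size_tuples {T} n (l : seq T) : size (tuples n l) = size l ^ n.
Proof.
elim: n => //= n IH; rewrite size_flatten /shape -map_comp.
rewrite (eq_map (g := fun=> size l ^ n)); last by move=> x; rewrite /= size_map.
rewrite expnS; move: (size l ^ n) => c.
by elim: l {IH} => //= x s ->.
Qed.

Fixpoint subs (d : data) : seq data :=
  let: Data ds := d in d :: flatten (map subs ds).

Lemma PT_subs {G} {eG : Enc G} (d : G -> data) : PT d -> PT (fun g => subs (d g)).
Proof.
move=> Hd; apply: (PT_comp (h := subs)) Hd => {d}.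
apply: (@PT_eq _ _ _ _ (fun d => rev (rev (subs d)))).
  by move=> d; rewrite revK.
apply: PT_rev.
pose step (u : seq data * seq data) : seq data * seq data :=
  match u.1 with [::] => u | d :: r => (kids d ++ r, d :: u.2) end.
(* Every round removes two bits from the work list and adds a subtree of size at most [sz d + 2] to
   the output. Charging [sz d + 2] to each bit of the work list bounds the output quadratically. *)
pose (Inv := fun (d : data) (u : seq data * seq data) =>
  [/\ catrev (flatten (map subs u.1)) u.2 = rev (subs d), sz u.1 <= sz d + 2 &
      sz u.2 + sz u.1 * (sz d + 2) <= 2 + (sz d + 2) * (sz d + 2)]).
refine (@PT_while data (seq data * seq data) (seq data) _ _ _
  (fun u => match u.1 with [::] => false | _ :: _ => true end)
  step (fun d => ([:: d], [::])) snd _ Inv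
  (fun u => sz u.1) (fun n => n + 2) (fun n => n + 2 + 2 + (n + 2) * (n + 2) + 2)
  _ _ _ _ _ _ _ _ _ _ _ _).
- by pt.
- by rewrite /step; pt; apply: PT_cat; pt.
- by pt.
- by pt.
- by pb.
- by pb.
- move=> d; split=> /=; rewrite ?cats0 ?sz_cons ?sz_nil //.
- move=> d [[|[ds] r] out] [/= E h1 h2] // _.
  rewrite /step /=; pose proof (sz_cat ds r) as hc; move: h1 h2; rewrite !sz_cons sz_Data.
  move=> h1 h2; split=> /=.
  + by rewrite -E map_cat flatten_cat.
  + by lia.
  + rewrite sz_cons sz_Data; move: h2; have -> : sz ds + sz r = (sz (ds ++ r)).+2 by lia.
    by rewrite mulSn mulSn; lia.
- move=> d [[|[ds] r] out] [/= E h1 h2] // _.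
  by rewrite /step /=; pose proof (sz_cat ds r); rewrite sz_cons sz_Data; lia.
- by move=> d; rewrite sz_cons sz_nil.
- by move=> d [r out] [/= E h1 h2]; rewrite sz_pair; lia.
- by move=> d [[|? ?] out] [/= <- _ _].
Qed.

Lemma subs_refl d : d \in subs d.
Proof. by case: d => ds; rewrite inE eqxx. Qed.

Lemma subs_trans e d x : e \in subs d -> x \in subs e -> x \in subs d.
Proof.
elim/data_ind': d => ds IH; rewrite [subs _]/= inE => /orP[/eqP -> //|].
move=> /flatten_mapP[d' d'ds ed'] /IH H; rewrite inE; apply/orP; right.
apply/flatten_mapP; exists d' => //; apply: H => //.
by elim: ds d'ds {IH} => //= y s IH; rewrite inE => /orP[/eqP ->|/IH]; [left|right].
Qed.

Lemma subs_kid d e : e \in kids d -> e \in subs d.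
Proof.
case: d => ds /= eds; rewrite inE; apply/orP; right.
by apply/flatten_mapP; exists e => //; apply: subs_refl.
Qed.

(** * The list of all sublists *)

Definition pow {T} (l : seq T) : seq (seq T) :=
  foldr (fun x acc => acc ++ map (cons x) acc) [:: [::]] l.

Lemma mem_pow {T : eqType} (l s : seq T) : s \in pow l -> {subset s <= l}.
Proof.
elim: l s => [|x l IH] s /=; first by rewrite inE => /eqP ->.
rewrite mem_cat => /orP[/IH H y /H|/mapP[t /IH H ->] y]; rewrite !inE.
  by move=> ->; rewrite orbT.
by case: eqP => //= _ /H.
Qed.

(** Sublists represent subsets: filtering one fixed list chooses a canonical list for each subset,
    so contexts can be compared as lists. *)
Lemma filter_pow {T : eqType} (P : pred T) (l : seq T) : filter P l \in pow l.
Proof.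
elim: l => //= x l IH; rewrite mem_cat; case: (P x); last by rewrite IH.
by apply/orP; right; apply: map_f.
Qed.

Lemma ET_pow {T} {eT : Enc T} : ET (@pow T).
Proof.
pose step (u : seq T * seq (seq T)) :=
  match u.1 with [::] => u | x :: s => (s, u.2 ++ map (cons x) u.2) end.
apply: (@ET_eq _ _ _ _ (fun l => ([::] : seq T, pow l).2)) => //.
apply: ET_comp; first by pt.
have Hstep : PT step.
  rewrite /step; pt; apply: PT_cat; pt.
  by apply: (PT_map (F := fun y (p : T * seq T * (seq T * seq (seq T))) => p.1.1 :: y)); pt.
apply: (@ET_iter _ _ _ _ (fun u : seq T * seq (seq T) => match u.1 with [::] => false | _ :: _ => true end)
  step (fun l => (rev l, [:: [::]])) _ id (fun n => n + 4 * 2 ^ n + 2)) => //.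
- by pt.
- by pt; apply: PT_rev; pt.
- exact/eb_pb/pb_id.
- apply: eb_add; last exact/eb_pb/pb_const.
  apply: eb_add; first exact/eb_pb/pb_id.
  by apply: eb_mul; [exact/eb_pb/pb_const|apply: eb_exp2; exact: pb_id].
move=> l.
(* Processing [x] multiplies the size of the accumulator by at most [2 ^ sz x], which the shrinking
   work list pays for; 4 is the size of the initial accumulator [[:: [::]]]. *)
pose (Inv := fun (u : seq T * seq (seq T)) =>
  [/\ foldl (fun acc x => acc ++ map (cons x) acc) u.2 u.1 = pow l, sz u.1 <= sz l &
      sz u.2 * 2 ^ (sz u.1) <= 4 * 2 ^ (sz l)]).
have sz_rev (s : seq T) : sz (rev s) = sz s.
  elim: s => // x s IH; rewrite rev_cons -cats1 sz_cons -IH.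
  by pose proof (sz_cat (rev s) [:: x]) as H; rewrite sz_cons sz_nil in H; lia.
have sz_step x (s : seq (seq T)) : sz (s ++ map (cons x) s) <= sz s * 2 ^ (sz x).
  pose proof (sz_cat s (map (cons x) s)) as h1.
  have h2 : sz (map (cons x) s) = sz s + size s * sz x.
    by elim: s {h1} => [|y s IH] /=; rewrite ?sz_nil ?sz_cons ?IH; lia.
  pose proof (sz_size s) as h3; pose proof (sz_ge2 x) as h4.
  have h5 : sz x + 2 <= 2 ^ sz x.
    by elim: (sz x) h4 => [|[|[|n]] IH] // _; rewrite expnS; have := IH isT; lia.
  by nia.
have [||u Iu pu|n [h1 h2 h3 h4]] := @iter_exists _ (fun u : seq T * seq (seq T) =>
  match u.1 with [::] => false | _ :: _ => true end) step Inv (fun u => size u.1)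
  (rev l, [:: [::]]).
- split=> /=; rewrite ?sz_rev ?foldl_rev //.
- move=> [[|x s] acc] [/= E h1 h2] // _; split=> //=.
    by apply: leq_trans h1; rewrite sz_cons leq_addl.
  apply: leq_trans h2; rewrite sz_cons expnD mulnA leq_mul2r; apply/orP; right.
  exact: sz_step.
- by case: u pu {Iu} => -[].
exists n; split=> //.
- by apply: leq_trans h3 _; rewrite /= size_rev; pose proof (sz_size l); lia.
- move=> i /h4[_ hh1 hh2]; case: (iter i _ _) hh1 hh2 => a b /= hh1 hh2.
  rewrite sz_pair; have : 1 * sz b <= 2 ^ sz a * sz b by rewrite leq_mul2r expn_gt0 orbT.
  by lia.
- by case: (h4 n (leqnn _)); case: (iter n _ _) h2 => -[|x s] b //= _ <-.
Qed.

(** * Derivation trees of regular tree grammars *)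

Lemma tree_ind' T (P : tree T -> Prop) :
  (forall a ts, (forall t, List.In t ts -> P t) -> P (Node a ts)) -> forall t, P t.
Proof.
move=> H; fix IH 1 => -[a ts]; apply: H.
elim: ts => [|t ts IHts] x; first by case.
by case=> [<-|]; [apply: IH|apply: IHts].
Qed.

Lemma in_nth T (x0 : T) s i : i < size s -> List.In (nth x0 s i) s.
Proof.
by elim: s i => [|x s IH] [|i] //= hi; [left|right; apply: IH].
Qed.

Section Derives.
Variables (T : Type) (a0 : T).

Definition dflt_tree : tree T := Node a0 [::].
Definition dflt_rhs : tree (T + nat) := Node (inl a0) [::].

Variable G : grammar T.

(** Derivations in big steps: they follow the structure of right-hand sides and ignore the order of
    rewriting, as the saturation does. *)
Inductive derives : tree (T + nat) -> tree T -> Prop :=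
| DNode a qs ts : size qs = size ts ->
    (forall i, i < size ts -> derives (nth dflt_rhs qs i) (nth dflt_tree ts i)) ->
    derives (Node (inl a) qs) (Node a ts)
| DRule B t u : List.In (B, t) (rules G) -> derives t u ->
    derives (Node (inr B) [::]) u.

Lemma derives_map_tree t : derives (map_tree inl t) t.
Proof.
elim/tree_ind': t => a ts IH /=; apply: DNode; first by rewrite size_map.
move=> i hi; rewrite (nth_map dflt_tree) //; apply: IH.
exact: in_nth.
Qed.

Lemma gstep_derives t t' u : gstep G t t' -> derives t' u -> derives t u.
Proof.
move=> H; elim: H u => {t t'} [B t Bt u|a ts1 t t' ts2 _ IH u]; first exact: DRule.
move E: (Node a _) => v H; case: H E => {v u}.
  move=> b qs ts st H [-> Eqs]; subst qs; apply: DNode.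
    by move: st; rewrite !size_cat.
  move=> i /H; rewrite !nth_cat; case: ltnP => // _.
  by case: (i - size ts1) => //= /IH.
by move=> B v w _ _ [_]; case: ts1.
Qed.

Local Notation rt := (Relation_Operators.clos_refl_trans _ (gstep G)).

Lemma rt_child a p s t t' : rt t t' -> rt (Node a (p ++ t :: s)) (Node a (p ++ t' :: s)).
Proof.
elim=> {t t'} [t t' H|t|t t' t'' _ IH1 _ IH2].
- by apply: Relation_Operators.rt_step; apply: GChild.
- exact: Relation_Operators.rt_refl.
- exact: Relation_Operators.rt_trans IH1 IH2.
Qed.

Lemma rt_children a qs us p : size qs = size us ->
  (forall i, i < size us -> rt (nth dflt_rhs qs i) (nth dflt_rhs us i)) ->
  rt (Node a (p ++ qs)) (Node a (p ++ us)).
Proof.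
elim: qs us p => [|q qs IH] [|u us] p //= ; first by move=> *; apply: Relation_Operators.rt_refl.
move=> [st] H; apply: Relation_Operators.rt_trans (rt_child _ _ _ (H 0 isT)) _ => /=.
rewrite -!cat_rcons; apply: IH => // i hi; exact: (H i.+1).
Qed.

Lemma derives_rt t u : derives t u -> rt t (map_tree inl u).
Proof.
elim=> {t u} [a qs ts st _ IH|B t u Bt _ IH] /=.
  apply: (rt_children _ [::]); rewrite size_map // => i hi.
  by rewrite (nth_map dflt_tree) //; apply: IH.
by apply: Relation_Operators.rt_trans IH; apply: Relation_Operators.rt_step; apply: GRoot.
Qed.

Lemma lang_derives t : lang G t <-> derives (Node (inr (axm G)) [::]) t.
Proof.
split=> [|/derives_rt //]; rewrite /lang.
have := derives_map_tree t; move: (map_tree _ _) (Node _ _) => u v Hu H.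
elim: H Hu => {u v} [u v H|u|u v w _ IH1 _ IH2] //.
  exact: gstep_derives H.
by move=> /IH2 /IH1.
Qed.

End Derives.

(** * Well-formedness as a deterministic top-down tree automaton *)

Section Static.
Variables (tau : signature) (k k' : nat) (par : 'I_k' -> nat) (strict : bool).

Local Notation sym := (sym tau k par).
Local Notation term := (term tau k par).
Local Notation psi := (psi tau k par).
Local Notation phi := (phi tau k par).

Definition dtr : tree sym := dflt_tree (SAnd tau k par).

(* Sort ([None] for terms, [Some false] for [psi], [Some true] for [phi]),
   symbols allowed, variables allowed, symbol being defined and parity of the
   number of negations since its [let]. *)
Definition sta : finType :=
  (option bool * {set 'I_k'} * {set 'I_k} * option 'I_k' * bool)%type.

Definition allowed (a : sym) (q : sta) : bool :=
  let: (lv, D, B, P, e) := q in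
  match a, lv with
  | SVar x, None => x \in B
  | SFun _, None | SIte, None => true
  | SRel _, Some _ | SAnd, Some _ | SOr, Some _ | SNot, Some _
  | SAll _, Some _ | SEx _, Some _ | SLet _ _, Some true => true
  | SDef Q, Some _ => (Q \in D) && ((Some Q == P) ==> e)
  | _, _ => false
  end.

(** An occurrence in a guard is ruled out for either parity, which a top-down automaton enforces by
    removing the symbol from those allowed. *)
Definition guard_defs (D : {set 'I_k'}) (P : option 'I_k') : {set 'I_k'} :=
  if P is Some p then if strict then D :\ p else D else D.

(** The body of a definition gets sort [psi], which excludes further definitions, and only its
    formal parameters as variables. Parity is tracked for the symbol being defined alone; the rest
    of the formula starts without such a symbol. *)
Definition child (a : sym) (q : sta) (i : nat) : sta :=
  let: (lv, D, B, P, e) := q in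
  match a with
  | SIte => if i == 0 then (Some false, guard_defs D P, B, P, e) else q
  | SRel _ | SDef _ => (None, D, B, P, e)
  | SNot => (lv, D, B, P, ~~ e)
  | SAll x | SEx x => (lv, D, x |: B, P, e)
  | SLet p xs => if i == 0 then (Some false, p |: D, [set x in xs], Some p, true)
                 else (Some true, p |: D, B, None, true)
  | SFun _ | SVar _ | SAnd | SOr => q
  end.

Inductive wt : sta -> tree sym -> Prop :=
| Wt q a ts : allowed a q -> size ts = rank a ->
    (forall i, i < size ts -> wt (child a q i) (nth dtr ts i)) -> wt q (Node a ts).

Definition okt (D : {set 'I_k'}) (B : {set 'I_k}) P e (t : term) : bool :=
  [&& tfv t \subset B, tdefs t \subset D & if P is Some p then tpos strict p e t else true].

Definition okp (D : {set 'I_k'}) (B : {set 'I_k}) P e (p : psi) : bool :=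
  [&& pfv p \subset B, pdefs p \subset D & if P is Some q then ppos strict q e p else true].

Definition okf (D : {set 'I_k'}) (B : {set 'I_k}) (p : phi) : bool :=
  fwf strict D p && (ffv p \subset B).

(** Needed for guards in the strict reading: the automaton goes on tracking parity there, and the
    condition holds vacuously because the symbol is absent. *)
Lemma notin_pos (b : bool) (P : 'I_k') :
  (forall (t : term) e, P \notin tdefs t -> tpos b P e t) /\
  (forall (p : psi) e, P \notin pdefs p -> ppos b P e p).
Proof.
have args n (ts : 'I_n -> term) e :
    (forall i e, P \notin tdefs (ts i) -> tpos b P e (ts i)) ->
    P \notin \bigcup_i tdefs (ts i) -> [forall i, tpos b P e (ts i)].
  move=> IH /bigcupP nP; apply/forallP => i; apply: IH.
  by apply/negP => Pi; apply: nP; exists i.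
apply: term_psi_mutind => //=.
- by move=> f ts IH e; apply: args.
- move=> c IHc t IHt u IHu e; rewrite !inE !negb_or => /andP[/andP[nc nt] nu].
  by rewrite IHt // IHu // !andbT; case: ifP => // _; apply: IHc.
- by move=> R ts IH e; apply: args.
- move=> Q ts IH e; rewrite !inE negb_or eq_sym => /andP[/negbTE -> nP].
  exact: args.
- by move=> p IHp q IHq e; rewrite inE negb_or => /andP[np nq]; rewrite IHp ?IHq.
- by move=> p IHp q IHq e; rewrite inE negb_or => /andP[np nq]; rewrite IHp ?IHq.
- by move=> p IH e np; apply: IH.
Qed.

Lemma nth_args n (ts : 'I_n -> term) (i : 'I_n) :
  nth dtr [seq tree_of_term (ts j) | j <- enum 'I_n] i = tree_of_term (ts i).
Proof. by rewrite (nth_map i) ?size_enum_ord // nth_ord_enum. Qed.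

Lemma size_args n (ts : 'I_n -> term) :
  size [seq tree_of_term (ts j) | j <- enum 'I_n] = n.
Proof. by rewrite size_map size_enum_ord. Qed.

Definition posall n P e (ts : 'I_n -> term) : bool :=
  if P is Some p then [forall i, tpos strict p e (ts i)] else true.

Lemma okt_args n (ts : 'I_n -> term) (D : {set 'I_k'}) (B : {set 'I_k}) P e :
  [&& \bigcup_i tfv (ts i) \subset B, \bigcup_i tdefs (ts i) \subset D & posall P e ts]
  = [forall i, okt D B P e (ts i)].
Proof.
apply/and3P/forallP => [[/bigcupsP h1 /bigcupsP h2 h3] i|h].
  rewrite /okt h1 // h2 //=; move: h3; rewrite /posall.
  by case: P => // p /forallP.
split.
- by apply/bigcupsP => i _; case/and3P: (h i).
- by apply/bigcupsP => i _; case/and3P: (h i).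
- rewrite /posall; case: P h => // p h.
  by apply/forallP => i; case/and3P: (h i).
Qed.

Lemma wt_args a q n (ts : 'I_n -> term) D B P e : allowed a q -> rank a = n ->
  (forall i, child a q i = (None, D, B, P, e)) ->
  (forall i, okt D B P e (ts i) -> wt (None, D, B, P, e) (tree_of_term (ts i))) ->
  [forall i, okt D B P e (ts i)] ->
  wt q (Node a [seq tree_of_term (ts i) | i <- enum 'I_n]).
Proof.
move=> al ra ch IH /forallP h; apply: Wt => //; rewrite size_args // => i hi.
by rewrite ch (nth_args ts (Ordinal hi)); apply: IH.
Qed.

Lemma wt_node1 a q t : allowed a q -> rank a = 1 -> wt (child a q 0) t ->
  wt q (Node a [:: t]).
Proof. by move=> al ra h; apply: Wt => // -[]. Qed.

Lemma wt_node2 a q t u : allowed a q -> rank a = 2 -> wt (child a q 0) t ->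
  wt (child a q 1) u -> wt q (Node a [:: t; u]).
Proof. by move=> al ra h h'; apply: Wt => // -[|[]]. Qed.

Lemma ok_wt :
  (forall (t : term) D B P e, okt D B P e t -> wt (None, D, B, P, e) (tree_of_term t)) /\
  (forall (p : psi) D B P e, okp D B P e p ->
     wt (Some false, D, B, P, e) (tree_of_psi p)).
Proof.
apply: term_psi_mutind => /=.
- move=> x D B P e /and3P[]; rewrite /= sub1set => xB _ _.
  by apply: Wt => // -[].
- move=> f ts IH D B P e; rewrite /okt /= -/(posall P e ts) okt_args.
  by apply: wt_args => // i; apply: IH.
- move=> c IHc t IHt u IHu D B P e.
  rewrite /okt /= !subUset => /and3P[/andP[/andP[c1 t1] u1] /andP[/andP[c2 t2] u2] h].
  apply: Wt => // -[|[|[|i]]] //= _.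
  + apply: IHc; rewrite /okp c1 /= /guard_defs.
    case: P h => [p|_]; last by rewrite c2.
    case: strict => /and3P[h _ _]; last by rewrite c2.
    by rewrite subsetD1 c2 h /= (proj2 (notin_pos _ p)).
  + apply: IHt; rewrite /okt t1 t2 /=.
    by case: P h => // p /and3P[].
  + apply: IHu; rewrite /okt u1 u2 /=.
    by case: P h => // p /and3P[].
- move=> x p IH D B P e; rewrite /okp /= subDset => H.
  by apply: wt_node1 => //; apply: IH.
- move=> x p IH D B P e; rewrite /okp /= subDset => H.
  by apply: wt_node1 => //; apply: IH.
- move=> R ts IH D B P e; rewrite /okp /= -/(posall P e ts) okt_args.
  by apply: wt_args => // i; apply: IH.
- move=> Q ts IH D B P e; rewrite /okp /= subUset sub1set => /and3P[h1 /andP[QD h2] h3].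
  apply: (@wt_args _ _ _ _ D B P e) => //=; last 2 first.
  + by move=> i; apply: IH.
  + rewrite -okt_args h1 h2 /posall; case: P h3 => // p /andP[] //.
  rewrite QD /=; case: P h3 => // p /andP[+ _].
  by rewrite -[Some _ == _]/(Q == p).
- move=> p IHp q IHq D B P e; rewrite /okp /= !subUset.
  move=> /and3P[/andP[p1 q1] /andP[p2 q2] h].
  apply: wt_node2 => //; [apply: IHp|apply: IHq]; rewrite /okp ?p1 ?p2 ?q1 ?q2 /=;
    by case: P h => // r /andP[].
- move=> p IHp q IHq D B P e; rewrite /okp /= !subUset.
  move=> /and3P[/andP[p1 q1] /andP[p2 q2] h].
  apply: wt_node2 => //; [apply: IHp|apply: IHq]; rewrite /okp ?p1 ?p2 ?q1 ?q2 /=;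
    by case: P h => // r /andP[].
- by move=> p IH D B P e H; apply: wt_node1 => //; apply: IH.
Qed.

Lemma okf_wt (p : phi) D B e : okf D B p -> wt (Some true, D, B, None, e) (tree_of_phi p).
Proof.
elim: p D B e => /=.
- move=> P xs d p IH D B e /andP[/= /and4P[h1 h2 h3 h4]]; rewrite subUset => /andP[_ h5].
  apply: wt_node2 => //=; last by apply: IH; rewrite /okf h4.
  by apply: (proj2 ok_wt); rewrite /okp h1 h2 h3.
- move=> x p IH D B e; rewrite /okf /= subDset => H.
  by apply: wt_node1 => //; apply: IH.
- move=> x p IH D B e; rewrite /okf /= subDset => H.
  by apply: wt_node1 => //; apply: IH.
- move=> R ts D B e; rewrite /okf /= => /andP[/forallP h1 /bigcupsP h2].
  apply: (@wt_args _ _ _ _ D B None e) => //= [i|]; first exact: (proj1 ok_wt).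
  by apply/forallP => i; rewrite /okt h1 h2.
- move=> Q ts D B e; rewrite /okf /= => /andP[/andP[QD /forallP h1] /bigcupsP h2].
  apply: (@wt_args _ _ _ _ D B None e) => //= [|i|]; first by rewrite QD.
    exact: (proj1 ok_wt).
  by apply/forallP => i; rewrite /okt h1 h2.
- move=> p IHp q IHq D B e; rewrite /okf /= subUset => /andP[/andP[p1 q1] /andP[p2 q2]].
  by apply: wt_node2 => //; [apply: IHp|apply: IHq]; rewrite /okf ?p1 ?p2 ?q1 ?q2.
- move=> p IHp q IHq D B e; rewrite /okf /= subUset => /andP[/andP[p1 q1] /andP[p2 q2]].
  by apply: wt_node2 => //; [apply: IHp|apply: IHq]; rewrite /okf ?p1 ?p2 ?q1 ?q2.
- by move=> p IH D B e H; apply: wt_node1 => //; apply: IH.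
Qed.

Lemma args_exist n (ts : seq (tree sym)) D B P e : size ts = n ->
  (forall i, i < size ts ->
     exists2 t : term, nth dtr ts i = tree_of_term t & okt D B P e t) ->
  exists2 us : 'I_n -> term, ts = [seq tree_of_term (us i) | i <- enum 'I_n] &
    [forall i, okt D B P e (us i)].
Proof.
move=> sz H.
have /fin_all_exists[us hus] (i : 'I_n) : exists t : term,
    nth dtr ts i = tree_of_term t /\ okt D B P e t.
  by have [|t h1 h2] := H i; [rewrite sz|exists t].
exists us; last by apply/forallP => i; case: (hus i).
apply: (@eq_from_nth _ dtr); first by rewrite size_args.
by move=> i; rewrite sz => hi; rewrite (nth_args us (Ordinal hi)); case: (hus (Ordinal hi)).
Qed.

(** Rank and sort suffice to read a term or formula off an accepted tree, symbol by symbol; the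
    conditions on variables, symbols and parity are those under which the state was entered. *)
Lemma wt_ok q t : wt q t ->
  let: (lv, D, B, P, e) := q in
  match lv with
  | None => exists2 u : term, t = tree_of_term u & okt D B P e u
  | Some false => exists2 p : psi, t = tree_of_psi p & okp D B P e p
  | Some true => P = None -> exists2 p : phi, t = tree_of_phi p & okf D B p
  end.
Proof.
elim=> {q t} -[[[[lv D] B] P] e] a ts al sz _ IH.
have one : size ts = 1 -> ts = [:: nth dtr ts 0] by case: ts {sz IH} => [|t []].
have two : size ts = 2 -> ts = [:: nth dtr ts 0; nth dtr ts 1].
  by case: ts {sz IH one} => [|t [|u []]].
have three : size ts = 3 -> ts = [:: nth dtr ts 0; nth dtr ts 1; nth dtr ts 2].
  by case: ts {sz IH one two} => [|t [|u [|v []]]].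
case: a al sz IH => /=.
- move=> R; case: lv => // b _ sz IH.
  have [us Ets] := args_exist sz IH; rewrite -okt_args => /and3P[h1 h2 h3].
  case: b; last first.
    by exists (PRel us); rewrite ?Ets // /okp /= h1 h2.
  move=> PN; exists (FRel us); rewrite ?Ets // /okf /= h1 andbT.
  by apply/forallP => i; move/bigcupsP: h2 => /(_ i isT).
- move=> f; case: lv => // _ sz IH.
  have [us Ets] := args_exist sz IH; rewrite -okt_args => ok.
  by exists (TApp us); rewrite ?Ets.
- case: lv => // _ sz IH; rewrite (three sz).
  have [c -> ] := IH 0 ltac:(by rewrite sz).
  have [t -> ] := IH 1 ltac:(by rewrite sz).
  have [u -> ] := IH 2 ltac:(by rewrite sz).
  move=> /and3P[u1 u2 u3] /and3P[t1 t2 t3] /and3P[c1 c2 c3].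
  exists (TIte c t u) => //; rewrite /okt /= !subUset c1 t1 u1 t2 u2 /= andbT.
  move: c2; rewrite /guard_defs; case: P c3 t3 u3 {IH} => [p|] c3 t3 u3; last by move=> ->.
  rewrite t3 u3 !andbT; case: strict c3 => c3; first by rewrite subsetD1.
  by rewrite c3 andbT.
- case: lv => // b _ sz IH; rewrite (two sz).
  have /= := IH 0 ltac:(by rewrite sz); have /= := IH 1 ltac:(by rewrite sz).
  case: b {IH} => [IH1 IH0 PN|[q -> /and3P[q1 q2 q3]] [p -> /and3P[p1 p2 p3]]].
    have [p -> /andP[p1 p2]] := IH0 PN; have [q -> /andP[q1 q2]] := IH1 PN.
    by exists (FAnd p q); rewrite // /okf /= subUset p1 p2 q1 q2.
  exists (PAnd p q) => //; rewrite /okp /= !subUset p1 p2 q1 q2 /=.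
  by case: P p3 q3 => // r -> ->.
- case: lv => // b _ sz IH; rewrite (two sz).
  have /= := IH 0 ltac:(by rewrite sz); have /= := IH 1 ltac:(by rewrite sz).
  case: b {IH} => [IH1 IH0 PN|[q -> /and3P[q1 q2 q3]] [p -> /and3P[p1 p2 p3]]].
    have [p -> /andP[p1 p2]] := IH0 PN; have [q -> /andP[q1 q2]] := IH1 PN.
    by exists (FOr p q); rewrite // /okf /= subUset p1 p2 q1 q2.
  exists (POr p q) => //; rewrite /okp /= !subUset p1 p2 q1 q2 /=.
  by case: P p3 q3 => // r -> ->.
- case: lv => // b _ sz IH; rewrite (one sz).
  have /= := IH 0 ltac:(by rewrite sz).
  case: b {IH} => [IH0 PN|[p -> h]]; last by exists (PNot p).
  by have [p -> h] := IH0 PN; exists (FNot p).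
- move=> x; case: lv => // b _ sz IH; rewrite (one sz).
  have /= := IH 0 ltac:(by rewrite sz).
  case: b {IH} => [IH0 PN|[p -> h]].
    have [p -> h] := IH0 PN; exists (FAll x p) => //.
    by rewrite /okf /= subDset.
  by exists (PAll x p) => //; rewrite /okp /= subDset.
- move=> x; case: lv => // b _ sz IH; rewrite (one sz).
  have /= := IH 0 ltac:(by rewrite sz).
  case: b {IH} => [IH0 PN|[p -> h]].
    have [p -> h] := IH0 PN; exists (FEx x p) => //.
    by rewrite /okf /= subDset.
  by exists (PEx x p) => //; rewrite /okp /= subDset.
- move=> x; case: lv => // xB sz _; exists (TVar tau par x); first by case: ts sz {one two three}.
  by rewrite /okt /= sub1set xB sub0set; case: P.
- move=> p xs; case: lv => // -[] // _ sz IH PN; rewrite (two sz).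
  have /= [d -> /and3P[d1 d2 d3]] := IH 0 ltac:(by rewrite sz).
  have /= [//|f -> /andP[f1 f2]] := IH 1 ltac:(by rewrite sz).
  exists (FLet xs d f) => //; rewrite /okf /= d1 d2 d3 f1 subUset f2 andbT /=.
  by rewrite subDset subsetU // d1.
- move=> Q; case: lv => // b /andP[QD hQ] sz IH.
  have [us Ets] := args_exist sz IH; rewrite -okt_args => /and3P[h1 h2 h3].
  case: b; last first.
    exists (PDef us); rewrite ?Ets // /okp /= subUset sub1set QD h1 h2 /=.
    by case: P hQ h3 {IH} => //= p; rewrite -[Some _ == _]/(Q == p) => -> ->.
  move=> PN; exists (FDef us); rewrite ?Ets // /okf /= h1 andbT QD /=.
  by apply/forallP => i; move/bigcupsP: h2 => /(_ i isT).
Qed.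

Definition q0 : sta := (Some true, set0, set0, None, true).

Lemma sentence_wt t : wt q0 t <->
  exists2 p : phi, t = tree_of_phi p & sentence strict p.
Proof.
split=> [/wt_ok /(_ erefl)[p -> ok]|[p -> ok]].
  by exists p => //; move: ok; rewrite /okf /sentence subset0.
by apply: okf_wt; move: ok; rewrite /okf /sentence subset0.
Qed.

End Static.

(** * Evaluation of trees in encoded structures *)

Section Semantics.
Variables (tau : signature) (k k' : nat) (par : 'I_k' -> nat).

Local Notation sym := (sym tau k par).
Local Notation nild := (Data [::]).

(** Evaluation works on the encoded structures, so that the functions executed by the algorithm are
    the very ones compared with the semantics below. *)
Definition dm (A : data) : seq nat := iota 0 (size (kids (nth nild (kids A) 0))).

Definition has_rel (A : data) (R : nat) (a : seq nat) : bool :=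
  enc a \in kids (nth nild (kids (nth nild (kids A) 1)) R).

Definition app_fun (A : data) (f : nat) (a : seq nat) : nat :=
  head 0 [seq d <- dm A | enc (a ++ [:: d]) \in kids (nth nild (kids (nth nild (kids A) 2)) f)].

Definition asg (A : data) : seq (seq nat) := tuples k (dm A).

Definition supd (s : seq nat) (x : 'I_k) (d : nat) : seq nat :=
  [seq if y == x then d else nth 0 s y | y <- enum 'I_k].

Definition denv := 'I_k' -> seq nat -> bool.

Definition updI (I : denv) (P : 'I_k') (Y : seq nat -> bool) : denv :=
  fun Q a => if Q == P then Y a else I Q a.

(* The value of a node labelled [a] under [s], where [ch i] is the value of the
   [i]-th child as a function of the assignment.  Truth values are 0 and 1. *)
Definition loc (a : sym) (A : data) (I : denv) (s : seq nat)
    (ch : nat -> seq nat -> nat) : nat :=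
  match a with
  | SRel R => has_rel A R [seq ch i s | i <- iota 0 (rar R)]
  | SFun f => app_fun A f [seq ch i s | i <- iota 0 (far f)]
  | SIte => if ch 0 s == 1 then ch 1 s else ch 2 s
  | SAnd => (ch 0 s == 1) && (ch 1 s == 1)
  | SOr => (ch 0 s == 1) || (ch 1 s == 1)
  | SNot => ch 0 s != 1
  | SAll x => all (fun d => ch 0 (supd s x d) == 1) (dm A)
  | SEx x => has (fun d => ch 0 (supd s x d) == 1) (dm A)
  | SVar x => nth 0 s x
  | SLet _ _ => 0
  | SDef P => I P [seq ch i s | i <- iota 0 (par P)]
  end.

Definition let_op (A : data) (xs : seq 'I_k) (d : seq nat -> nat)
    (a : seq nat) : bool :=
  has (fun s => ([seq nth 0 s x | x : 'I_k <- xs] == a) && (d s == 1)) (asg A).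

Definition ntuples (A : data) (P : 'I_k') : nat := size (tuples (par P) (dm A)).

Definition let_iter (A : data) (P : 'I_k') (xs : seq 'I_k)
    (d : denv -> seq nat -> nat) (I : denv) (i : nat) : seq nat -> bool :=
  iter i (fun Y => let_op A xs (d (updI I P Y))) (fun _ => false).

Fixpoint tree_val (t : tree sym) (A : data) (I : denv) (s : seq nat) : nat :=
  let: Node a ts := t in
  let ch := nth (fun _ _ _ => 0) (map tree_val ts) in
  match a with
  | SLet P xs =>
      ch 1 A (updI I P (let_iter A P xs (ch 0 A) I (ntuples A P))) s
  | _ => loc a A I s (fun i => ch i A I)
  end.

Definition is_let (a : sym) : bool := if a is SLet _ _ then true else false.

Lemma nth_tree_val ts i : i < size ts ->
  nth (fun _ _ _ => 0) (map tree_val ts) i = tree_val (nth (dtr tau k par) ts i).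
Proof. by move=> h; rewrite (nth_map (dtr tau k par)). Qed.

Lemma supd_asg A s x d : s \in asg A -> d \in dm A -> supd s x d \in asg A.
Proof.
rewrite !mem_tuples => /andP[/eqP ss /allP sA] dA; rewrite size_map size_enum_ord eqxx /=.
apply/allP => _ /mapP[y _ ->]; case: ifP => // _; apply: sA.
by rewrite mem_nth // ss.
Qed.

Lemma loc_ext a A I s ch ch' : s \in asg A ->
  (forall i s', i < rank a -> s' \in asg A -> ch i s' = ch' i s') ->
  loc a A I s ch = loc a A I s ch'.
Proof.
move=> sA H.
have args n : n = rank a -> [seq ch i s | i <- iota 0 n] = [seq ch' i s | i <- iota 0 n].
  by move=> E; apply/eq_in_map => i; rewrite mem_iota /= => hi; apply: H; rewrite -?E.
case: a H args => [R|f|||||x|x|x|P xs|P] /= H args; rewrite ?args ?H //.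
- congr nat_of_bool; apply: eq_in_all => d dA; rewrite H // supd_asg //.
- congr nat_of_bool; apply: eq_in_has => d dA; rewrite H // supd_asg //.
Qed.

(** Truth values and elements share one range, which also contains the default 0; facts about terms
    and about formulas thus have the same form. *)
Definition vals (A : data) : seq nat := [:: 0, 1 & dm A].

Lemma bool_vals A (b : bool) : nat_of_bool b \in vals A.
Proof. by case: b; rewrite !inE. Qed.

Lemma tree_val_vals t A I s : s \in asg A -> tree_val t A I s \in vals A.
Proof.
elim/tree_ind': t I s => a ts IH I s sA.
have ch i I' s' : s' \in asg A -> nth (fun _ _ _ => 0) (map tree_val ts) i A I' s' \in vals A.
  move=> s'A; case: (ltnP i (size ts)) => hi.
    by rewrite nth_tree_val //; apply: IH => //; apply: in_nth.
  by rewrite nth_default ?size_map // inE.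
case: a => [R|f|||||x|x|x|P xs|P] /=; try exact: bool_vals.
- have H (r : seq nat) : {subset r <= dm A} -> head 0 r \in vals A.
    case: r => [|d r] H; first by rewrite inE.
    by rewrite /vals !inE H ?orbT // inE eqxx.
  by apply: H => d; rewrite mem_filter => /andP[].
- by case: ifP => _; apply: ch.
- move: sA; rewrite mem_tuples => /andP[/eqP ss /allP sA].
  have /sA /= h : nth 0 s x \in s by rewrite mem_nth // ss.
  by rewrite /vals !inE h !orbT.
- exact: ch.
Qed.

(** ** Agreement with the semantics of formulas *)

Section Bridge.
Variable A : structure tau.
Let dA := dstructure A.
Local Notation assignment := (assignment k A).

Definition enc_asg (s : assignment) : seq nat := [seq val (s x) | x <- enum 'I_k].
Definition enc_tup n (a : n.-tuple (dom A)) : seq nat := [seq val d | d <- tval a].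

Lemma dm_structure : dm dA = iota 0 (predsize A).+1.
Proof. by rewrite /dm /= size_nseq. Qed.

Opaque dm.

Lemma val_dm (d : dom A) : val d \in dm dA.
Proof. by rewrite dm_structure mem_iota /=. Qed.

Lemma dmP d : reflect (exists e : dom A, d = val e) (d \in dm dA).
Proof.
rewrite dm_structure mem_iota add0n /=; apply: (iffP idP) => [h|[e -> //]].
by exists (Ordinal h).
Qed.

Lemma enc_tup_inj n : injective (@enc_tup n).
Proof. by move=> a b /(inj_map val_inj)/val_inj. Qed.

Lemma has_rel_structure R (a : (rar R).-tuple (dom A)) :
  has_rel dA R (enc_tup a) = (a \in irel A R).
Proof.
rewrite /has_rel /= (nth_map R) ?size_enum_ord // nth_ord_enum /=.
rewrite -[a \in irel A R](mem_enum (mem (irel A R))).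
apply: mem_map => b c E; apply: enc_tup_inj.
exact: (@enc_inj (seq nat) (enc_seq enc_nat) (encinj_seq encinj_nat) _ _ E).
Qed.

Lemma app_fun_structure f (a : (far f).-tuple (dom A)) :
  app_fun dA f (enc_tup a) = val (ifun A f a).
Proof.
have graph : kids (nth nild (kids (nth nild (kids dA) 2)) f) =
    [seq dnats (rcons [seq val d | d <- tval a] (val (ifun A f a)))
    | a <- enum {: (far f).-tuple (dom A)}].
  by rewrite /= (nth_map f) ?size_enum_ord // nth_ord_enum.
have E : {in dm dA, (fun d => enc (enc_tup a ++ [:: d]) \in
    [seq dnats (rcons [seq val d | d <- tval a] (val (ifun A f a)))
    | a <- enum {: (far f).-tuple (dom A)}]) =1 pred1 (val (ifun A f a))}.
  move=> _ /dmP[e ->] /=; apply/mapP/eqP => [[b _ E]|E].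
    move: (@enc_inj (seq nat) (enc_seq enc_nat) (encinj_seq encinj_nat) _ _ E).
    rewrite cats1 => /rcons_inj[].
    by move=> /enc_tup_inj -> ->.
  exists a; first by rewrite mem_enum.
  by rewrite cats1 E.
rewrite /app_fun graph (eq_in_filter E).
rewrite dm_structure filter_pred1_uniq ?iota_uniq //.
by have := val_dm (ifun A f a); rewrite dm_structure.
Qed.

Lemma nth_enc_asg s (x : 'I_k) : nth 0 (enc_asg s) x = val (s x).
Proof. by rewrite (nth_map x) ?size_enum_ord // nth_ord_enum. Qed.

Lemma enc_asg_upd s x d : enc_asg (upd s x d) = supd (enc_asg s) x (val d).
Proof.
by apply: eq_map => y; rewrite ffunE nth_enc_asg; case: ifP.
Qed.

Lemma asgP s : reflect (exists u : assignment, s = enc_asg u) (s \in asg dA).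
Proof.
rewrite mem_tuples; apply: (iffP andP) => [[/eqP ss /allP sA]|[u ->]].
  have H (x : 'I_k) : exists e : dom A, nth 0 s x = val e.
    by apply/dmP/sA; rewrite mem_nth // ss.
  have [u hu] := fin_all_exists H; exists [ffun x => u x].
  apply: (@eq_from_nth _ 0); first by rewrite size_map size_enum_ord.
  move=> i; rewrite ss => hi.
  by rewrite (nth_enc_asg _ (Ordinal hi)) ffunE -hu.
split; first by rewrite size_map size_enum_ord.
by apply/allP => _ /mapP[x _ ->]; apply: val_dm.
Qed.

Definition env_rel (I : env par A) (J : denv) :=
  forall P (a : (par P).-tuple (dom A)), J P (enc_tup a) = (a \in I P).

Lemma args_eval n (ts : 'I_n -> term tau k par) I J s :
  (forall i J s, env_rel I J ->
     tree_val (tree_of_term (ts i)) dA J (enc_asg s) = val (teval I s (ts i))) ->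
  env_rel I J ->
  [seq nth (fun _ _ _ => 0) (map tree_val [seq tree_of_term (ts i) | i <- enum 'I_n]) i dA J
         (enc_asg s) | i <- iota 0 n] = enc_tup [tuple teval I s (ts i) | i < n].
Proof.
move=> IH IJ; rewrite -val_enum_ord -[LHS]map_comp /enc_tup /= -[RHS]map_comp.
apply: eq_map => i /=; rewrite nth_tree_val ?size_args // nth_args //.
exact: IH.
Qed.

Lemma has_dm (p : pred nat) : has p (dm dA) = [exists d : dom A, p (val d)].
Proof.
apply/hasP/existsP => [[_ /dmP[d ->] pd]|[d pd]]; first by exists d.
by exists (val d) => //; apply: val_dm.
Qed.

Lemma all_dm (p : pred nat) : all p (dm dA) = [forall d : dom A, p (val d)].
Proof.
apply/allP/forallP => [h d|h _ /dmP[d ->] //]; exact/h/val_dm.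
Qed.

Lemma nat_of_bool1 (b : bool) : (nat_of_bool b == 1) = b.
Proof. by case: b. Qed.

Lemma term_psi_eval :
  (forall (t : term tau k par) I J s, env_rel I J ->
     tree_val (tree_of_term t) dA J (enc_asg s) = val (teval I s t)) /\
  (forall (p : psi tau k par) I J s, env_rel I J ->
     tree_val (tree_of_psi p) dA J (enc_asg s) = psat I s p).
Proof.
apply: term_psi_mutind => /=.
- by move=> x I J s _; rewrite nth_enc_asg.
- by move=> f ts IH I J s IJ; rewrite (args_eval (I := I)) ?app_fun_structure // => i *; apply: IH.
- move=> c IHc t IHt u IHu I J s IJ.
  by rewrite (IHc I) // (IHt I) // (IHu I) // nat_of_bool1; case: ifP.
- move=> x p IH I J s IJ; rewrite has_dm; congr nat_of_bool.
  by apply: eq_existsb => d; rewrite -enc_asg_upd (IH I) // nat_of_bool1.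
- move=> x p IH I J s IJ; rewrite all_dm; congr nat_of_bool.
  by apply: eq_forallb => d; rewrite -enc_asg_upd (IH I) // nat_of_bool1.
- by move=> R ts IH I J s IJ; rewrite (args_eval (I := I)) ?has_rel_structure // => i *; apply: IH.
- move=> P ts IH I J s IJ; rewrite (args_eval (I := I)) //; last by move=> i *; apply: IH.
  by rewrite IJ.
- by move=> p IHp q IHq I J s IJ; rewrite (IHp I) // (IHq I) // !nat_of_bool1.
- by move=> p IHp q IHq I J s IJ; rewrite (IHp I) // (IHq I) // !nat_of_bool1.
- by move=> p IHp I J s IJ; rewrite (IHp I) // nat_of_bool1.
Qed.

Lemma env_rel_upd I J P (Y : {set (par P).-tuple (dom A)}) Z : env_rel I J ->
  (forall a, Z (enc_tup a) = (a \in Y)) -> env_rel (dfwith I Y) (updI J P Z).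
Proof.
move=> IJ ZY Q a; rewrite /updI; case: eqVneq => [E|QP]; last first.
  by rewrite dfwith_out // eq_sym.
by subst Q; rewrite dfwith_in ZY.
Qed.

(** [fixset] iterates its operator from the empty set as often as there are elements in the
    underlying type, here tuples, and [ntuples] counts these. So the two iterations agree stage by
    stage. *)
Lemma let_iter_fixset I J P (xs : (par P).-tuple 'I_k) (d : psi tau k par) a :
  env_rel I J ->
  let_iter dA P xs (tree_val (tree_of_psi d) dA) J (ntuples dA P) (enc_tup a) =
  (a \in fixset (lfp_op I xs d)).
Proof.
move=> IJ; rewrite /let_iter /fixset.
have -> : ntuples dA P = #|{: (par P).-tuple (dom A)}|.
  by rewrite /ntuples size_tuples dm_structure size_iota card_tuple card_ord.
elim: #|_| a => [|n IH] a /=; first by rewrite inE.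
set Y := iter n _ _ in IH *; set Z := iter n _ _ in IH *.
have IJ' := env_rel_upd IJ IH.
rewrite inE; apply/hasP/existsP => [[_ /asgP[s ->] /andP[/eqP E ds]]|[s /andP[/eqP E ds]]].
  exists s; rewrite -(nat_of_bool1 (psat _ _ _)) -(proj2 term_psi_eval _ _ _ _ IJ') ds andbT.
  apply/eqP/enc_tup_inj; rewrite -E /enc_tup /= -map_comp; apply: eq_map => x /=.
  by rewrite nth_enc_asg.
exists (enc_asg s); first by apply/asgP; exists s.
rewrite (proj2 term_psi_eval _ _ _ _ IJ') ds eqxx andbT -E /enc_tup /= -map_comp.
by apply/eqP/eq_map => x /=; rewrite nth_enc_asg.
Qed.

Lemma phi_eval (p : phi tau k par) I J s : env_rel I J ->
  tree_val (tree_of_phi p) dA J (enc_asg s) = fsat I s p.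
Proof.
elim: p I J s => /=.
- move=> P xs d p IH I J s IJ; apply: IH; apply: env_rel_upd => // a.
  exact: let_iter_fixset.
- move=> x p IH I J s IJ; rewrite has_dm; congr nat_of_bool.
  by apply: eq_existsb => d; rewrite -enc_asg_upd (IH I) // nat_of_bool1.
- move=> x p IH I J s IJ; rewrite all_dm; congr nat_of_bool.
  by apply: eq_forallb => d; rewrite -enc_asg_upd (IH I) // nat_of_bool1.
- move=> R ts I J s IJ; rewrite (args_eval (I := I)) ?has_rel_structure // => i *.
  exact: (proj1 term_psi_eval).
- move=> P ts I J s IJ; rewrite (args_eval (I := I)) ?IJ // => i *.
  exact: (proj1 term_psi_eval).
- by move=> p IHp q IHq I J s IJ; rewrite (IHp I) // (IHq I) // !nat_of_bool1.
- by move=> p IHp q IHq I J s IJ; rewrite (IHp I) // (IHq I) // !nat_of_bool1.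
- by move=> p IHp I J s IJ; rewrite (IHp I) // nat_of_bool1.
Qed.

Lemma models_tree_val (p : phi tau k par) :
  models A p = (tree_val (tree_of_phi p) dA (fun _ _ => false) (nseq k 0) == 1).
Proof.
have -> : nseq k 0 = enc_asg [ffun => ord0].
  rewrite /enc_asg (eq_map (g := fun=> 0)); last by move=> x; rewrite ffunE.
  by rewrite -{1}(size_enum_ord k); elim: (enum _) => //= x r ->.
have IJ : env_rel (fun P => set0) (fun _ _ => false) by move=> P a; rewrite inE.
by rewrite (phi_eval _ _ IJ) nat_of_bool1.
Qed.

Transparent dm.

End Bridge.
End Semantics.

(** * The saturation algorithm *)

Lemma PT_nat_of_bool {G} {eG : Enc G} (p : G -> bool) : PT p -> PT (fun g => nat_of_bool (p g)).
Proof. by move=> Hp; apply: (PT_comp (h := nat_of_bool)) Hp; apply: PT_recode. Qed.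

#[export] Instance encinj_bool : EncInj enc_bool.
Proof. by move=> [] []. Qed.

#[export] Instance enc_ord n : Enc 'I_n := fun i => dnat i.

#[export] Instance encinj_ord n : EncInj (@enc_ord n).
Proof. by move=> i j /encinj_nat /val_inj. Qed.

Ltac pt_user := fail.

Ltac pt_more ::= match goal with
  | |- @PT _ _ _ _ (fun x => match @?l x with [::] => @?h x | y :: s => @?f x y s end) =>
      refine (PT_case' (l := l) (f := fun y s x => f x y s) (h := h) _ _ _)
  | |- @PT _ _ _ _ (fun g => kids (@?f g)) => refine (PT_kids (f := f) _)
  | |- @PT _ _ _ _ (fun g => Data (@?f g)) => refine (PT_Data (f := f) _)
  | |- @PT _ _ _ _ (fun g => enc (@?f g)) => refine (PT_enc (f := f) _)
  | |- @PT _ _ _ _ (fun g => map (fun x => @?F g x) ?l) =>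
      refine (PT_fixed_map (F := fun x g => F g x) l _); let x := fresh "x" in intro x
  | |- @PT _ _ _ _ (fun g => map (fun x => @?F g x) (@?l g)) =>
      refine (PT_map (F := fun x g => F g x) (l := l) _ _)
  | |- @PT _ _ _ _ (fun g => has (fun x => @?F g x) ?l) =>
      refine (PT_fixed_has (F := fun x g => F g x) l _); let x := fresh "x" in intro x
  | |- @PT _ _ _ _ (fun g => has (fun x => @?F g x) (@?l g)) =>
      refine (PT_has (P := fun x g => F g x) (l := l) _ _)
  | |- @PT _ _ _ _ (fun g => all (fun x => @?F g x) ?l) =>
      refine (PT_fixed_all (F := fun x g => F g x) l _); let x := fresh "x" in intro x
  | |- @PT _ _ _ _ (fun g => all (fun x => @?F g x) (@?l g)) =>
      refine (PT_all (P := fun x g => F g x) (l := l) _ _)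
  | |- @PT _ _ _ _ (fun g => filter (fun x => @?F g x) (@?l g)) =>
      refine (PT_filter (P := fun x g => F g x) (l := l) _ _)
  | |- @PT _ _ _ _ (fun g => flatten (@?l g)) => refine (PT_flatten (l := l) _)
  | |- @PT _ _ _ _ (fun g => cat (@?s g) (@?t g)) => refine (PT_cat (s := s) (t := t) _ _)
  | |- @PT _ _ _ _ (fun g => andb (@?p g) (@?q g)) => refine (PT_andb (p := p) (q := q) _ _)
  | |- @PT _ _ _ _ (fun g => orb (@?p g) (@?q g)) => refine (PT_orb (p := p) (q := q) _ _)
  | |- @PT _ _ _ _ (fun g => negb (@?p g)) => refine (PT_negb (p := p) _)
  | |- @PT _ _ _ _ (fun g => nat_of_bool (@?p g)) => refine (PT_nat_of_bool (p := p) _)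
  | |- @PT _ _ _ _ (fun g => nth ?x (@?l g) ?i) => refine (PT_nth x (l := l) i _)
  | |- @PT _ _ _ _ (fun g => head ?x (@?l g)) => refine (PT_head x (l := l) _)
  | |- @PT _ _ _ _ (fun g => size (@?s g)) => refine (PT_size (s := s) _)
  | |- @PT _ _ _ _ (fun g => S (@?n g)) => refine (PT_succ (n := n) _)
  | |- @PT _ _ _ _ (fun g => iota 0 (@?n g)) => refine (PT_iota (n := n) _)
  | |- @PT _ _ _ _ (fun g => tuples ?n (@?l g)) => refine (PT_tuples n (l := l) _)
  | |- @PT _ _ _ _ (fun g => subs (@?d g)) => refine (PT_subs (d := d) _)
  | |- @PT _ _ _ _ (fun g => @eq_op _ (@?f g) (@?h g)) =>
      refine (PT_eqop (f := f) (h := h) _ _)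
  | |- @PT _ _ _ _ (fun g => @in_mem _ (@?x g) (@mem _ _ (@?s g))) =>
      refine (PT_mem (x := x) (s := s) _ _)
  | |- _ => pt_user
  end.

Lemma dnats_inj : injective dnats.
Proof. exact: (@enc_inj (seq nat) (enc_seq enc_nat) (encinj_seq encinj_nat)). Qed.

Section Algorithm.
Variables (tau : signature) (k k' : nat) (par : 'I_k' -> nat).
Local Notation sym := (sym tau k par).

Lemma dsym_inj : injective (@dsym tau k k' par).
Proof.
move=> [R|f|||||x|x|x|P xs|P] [R'|f'|||||x'|x'|x'|P' xs'|P'] /dnats_inj E;
  first [done|discriminate E|case: E => /val_inj E].
all: try by rewrite E.
by move: xs'; rewrite -E => xs' /(inj_map val_inj)/val_inj ->.
Qed.

HB.instance Definition _ := Equality.copy sym (inj_type dsym_inj).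

#[export] Instance enc_sym : Enc sym := @dsym tau k k' par.
#[export] Instance encinj_sym : EncInj enc_sym := dsym_inj.

Definition syms : seq sym :=
  [seq SRel k par R | R <- enum 'I_(nrel tau)] ++
  [seq SFun k par f | f <- enum 'I_(nfun tau)] ++
  [:: SIte tau k par; SAnd tau k par; SOr tau k par; SNot tau k par] ++
  [seq SAll tau par x | x <- enum 'I_k] ++ [seq SEx tau par x | x <- enum 'I_k] ++
  [seq SVar tau par x | x <- enum 'I_k] ++
  flatten [seq [seq SLet tau xs | xs <- enum {: (par P).-tuple 'I_k}] | P <- enum 'I_k'] ++
  [seq SDef tau k par P | P <- enum 'I_k'].

Lemma mem_syms a : a \in syms.
Proof.
have mm (T : finType) (h : T -> sym) x : h x \in [seq h y | y <- enum T].
  by apply: map_f; rewrite mem_enum.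
rewrite !mem_cat; case: a => [R|f|||||x|x|x|P xs|P];
  rewrite ?mm ?orbT ?inE ?eqxx ?orbT //.
have -> : SLet tau xs \in flatten [seq [seq SLet tau xs | xs <- enum {: (par P).-tuple 'I_k}] | P <- enum 'I_k'].
  by apply/flatten_mapP; exists P; rewrite ?mem_enum // mm.
by rewrite !orbT.
Qed.

#[export] Instance enc_sta : Enc (sta k k') := fun q => dnat (enum_rank q).

#[export] Instance encinj_sta : EncInj enc_sta.
Proof. by move=> p q /encinj_nat /val_inj /enum_rank_inj. Qed.

Variable strict : bool.
Local Notation sta := (sta k k').
Local Notation nild := (Data [::]).

(* A world of a structure is one of its environments: a fact about a formula
   with lets only refers to world 0, whereas in the body of a definition world
   [i] interprets the defined symbol by the [i]-th iterate. *)
Notation world := (data * nat)%type.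
Notation atom1 := (world * 'I_k' * seq nat)%type.
Notation atom2 := (world * seq nat * nat)%type.
(* [(u, q, c, v)]: some tree derived from [u] is accepted from state [q] and,
   in the environments given by [c], takes the values listed in [v]. *)
Notation fact := (data * sta * seq atom1 * seq atom2)%type.
Notation entry := (fact * sym * seq fact)%type.

Definition no_fact : fact := (nild, q0 k k', [::], [::]).

Definition poss (X : data) : seq data := kids (nth nild (kids X) 0).
Definition negs (X : data) : seq data := kids (nth nild (kids X) 1).
Definition strs (X : data) : seq data := poss X ++ negs X.
Definition grammar_rules (X : data) : seq data := kids (nth nild (kids (nth nild (kids X) 2)) 2).
(* 11 is the tag of nonterminals in [dlabel]. *)
Definition nonterm (B : data) : data := Data [:: Data [:: dnat 11; B]].
Definition start_node (X : data) : data :=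
  nonterm (nth nild (kids (nth nild (kids X) 2)) 1).
Definition nodes (X : data) : seq data := start_node X :: subs X.

(** The sum over all symbols bounds the number of iterations for each of them, so the worlds suffice
    whichever symbol is being defined. *)
Definition nworlds (A : data) : nat :=
  (size (flatten [seq tuples (par P) (dm A) | P <- enum 'I_k'])).+1.

Definition worlds (X : data) : seq world :=
  flatten [seq [seq (A, i) | i <- iota 0 (nworlds A)] | A <- strs X].

Definition is_phi (q : sta) : bool := q.1.1.1.1 == Some true.

Definition worlds_of (q : sta) (X : data) : seq world :=
  if is_phi q then [seq (A, 0) | A <- strs X] else worlds X.

Definition atoms1 (X : data) : seq atom1 :=
  flatten [seq flatten [seq [seq (w, P, a) | a <- tuples (par P) (dm w.1)] | P <- enum 'I_k']
          | w <- worlds X].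

Definition atoms2 (X : data) : seq atom2 :=
  flatten [seq flatten [seq [seq (w, s, d) | d <- vals w.1] | s <- asg k w.1] | w <- worlds X].

Definition lookup (v : seq atom2) (w : world) (s : seq nat) : nat :=
  head 0 [seq y.2 | y <- [seq y <- v | y.1 == (w, s)]].

Definition env_of (c : seq atom1) (w : world) : denv k' := fun P a => (w, P, a) \in c.

Definition local_rule (a : sym) (q : sta) (X : data) (x : fact) (ys : seq fact) : bool :=
  all (fun i : nat => (nth no_fact ys i).1.2 == x.1.2) (iota 0 (rank a)) &&
  all (fun w : world => all (fun s : seq nat => lookup x.2 w s ==
      loc a w.1 (env_of x.1.2 w) s (fun i s' => lookup (nth no_fact ys i).2 w s'))
    (asg k w.1)) (worlds_of q X).

(** The facts [y] and [z] are about the body and the rest. The context of [y] guesses all stages;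
    the guess is confirmed by comparing the operator, computed from the values of [y] in world [i],
    with world [i.+1]. The result of the last application has no world in [y] to go to and is the
    interpretation of [P] in [z]. *)
Definition let_rule (P : 'I_k') (xs : seq 'I_k) (X : data) (x y z : fact) : bool :=
  all (fun A : data =>
    [&& all (fun Q : 'I_k' => (Q == P) ||
          all (fun a : seq nat =>
             all (fun i : nat => (((A, i), Q, a) \in y.1.2) == (((A, 0), Q, a) \in x.1.2))
               (iota 0 (ntuples par A P)) &&
             ((((A, 0), Q, a) \in z.1.2) == (((A, 0), Q, a) \in x.1.2)))
          (tuples (par Q) (dm A))) (enum 'I_k'),
        all (fun a : seq nat => (((A, 0), P, a) \notin y.1.2) &&
            all (fun i : nat => let_op A xs (lookup y.2 (A, i)) a ==
               if i.+1 == ntuples par A P then ((A, 0), P, a) \in z.1.2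
               else ((A, i.+1), P, a) \in y.1.2) (iota 0 (ntuples par A P)))
          (tuples (par P) (dm A)) &
        all (fun s : seq nat => lookup x.2 (A, 0) s == lookup z.2 (A, 0) s) (asg k A)])
    (strs X).

Definition rule (a : sym) (q : sta) (X : data) (x : fact) (ys : seq fact) : bool :=
  [&& nth nild (kids x.1.1.1) 0 == dsym a, size (kids x.1.1.1) == (rank a).+1,
      x.1.1.2 == q, allowed a q,
      all (fun i : nat => ((nth no_fact ys i).1.1.1 == nth nild (kids x.1.1.1) i.+1) &&
                    ((nth no_fact ys i).1.1.2 == child strict a q i)) (iota 0 (rank a)) &
      if a is SLet P xs then let_rule P xs X x (nth no_fact ys 0) (nth no_fact ys 1)
      else local_rule a q X x ys].

(** Replacing a nonterminal by a right-hand side adds no node to the formula. The fact for the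
    nonterminal therefore copies symbol and children of the fact for the right-hand side. *)
Definition alias (X : data) (e : entry) (acc : seq entry) : bool :=
  has (fun e' : entry => [&& e'.1.2 == e.1.2, e'.2 == e.2, e'.1.1.1.1.2 == e.1.1.1.1.2,
      e'.1.1.1.2 == e.1.1.1.2, e'.1.1.2 == e.1.1.2 &
      has (fun r : data => (e.1.1.1.1.1 == nonterm (nth nild (kids r) 0)) &&
                    (e'.1.1.1.1.1 == nth nild (kids r) 1)) (grammar_rules X)]) acc.

(** Premises must have been collected before, which excludes cyclic justifications. *)
Definition justified (X : data) (e : entry) (acc : seq entry) : bool :=
  (all (fun y : fact => y \in [seq e'.1.1 | e' <- acc]) e.2 &&
   has (fun a => has (fun q => (e.1.2 == a) && rule a q X e.1.1 e.2) (enum sta)) syms)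
  || alias X e acc.

Definition acceptable (X : data) (e : entry) (acc : seq entry) : bool :=
  (e.1.1 \notin [seq e'.1.1 | e' <- acc]) && justified X e acc.

Notation input_with_sublists := (data * (seq (seq atom1) * seq (seq atom2)))%type.

Definition facts (Z : input_with_sublists) : seq fact :=
  flatten [seq flatten [seq flatten [seq [seq (u, q, c, v) | v <- Z.2.2] | c <- Z.2.1]
    | q <- enum sta] | u <- nodes Z.1].

Definition candidates (Z : input_with_sublists) : seq entry :=
  flatten [seq flatten [seq [seq (x, a, ys) | ys <- tuples (rank a) (facts Z)]
    | x <- facts Z] | a <- syms].

(** [no_fact] only serves to make one more pass than there are facts, so that some pass adds
    nothing. *)
Definition saturate (Z : input_with_sublists) : seq entry :=
  collect (acceptable Z.1) [::]
    (flatten [seq candidates Z | _ <- no_fact :: facts Z]).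

Definition separating (X : data) (x : fact) : bool :=
  [&& x.1.1.1 == start_node X, x.1.1.2 == q0 k k', x.1.2 == [::],
      all (fun A : data => lookup x.2 (A, 0) (nseq k 0) == 1) (poss X) &
      all (fun A : data => lookup x.2 (A, 0) (nseq k 0) != 1) (negs X)].

(* One more than the index of [y] in [l], as node 0 of the dag repeats the node of
   the separating fact. *)
Definition position (l : seq fact) (y : fact) : nat :=
  size (collect (fun (_ : fact) (acc : seq fact) => y \notin acc) [::] l).

Definition dag_node (T : seq entry) (e : entry) : sym * seq nat :=
  (e.1.2, [seq position [seq e'.1.1 | e' <- T] y | y <- e.2]).

Definition answer (Z : input_with_sublists) : dag tau k par :=
  let T := saturate Z in
  if [seq e <- T | separating Z.1 e.1.1] is e :: _
  then dag_node T e :: [seq dag_node T e | e <- T] else [::].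

(** ** Running time *)

Section Definable.
Context {G : Type} {eG : Enc G}.

Lemma PT_dm (A : G -> data) : PT A -> PT (fun g => dm (A g)).
Proof. by move=> HA; rewrite /dm; pt. Qed.

Lemma PT_asg (A : G -> data) : PT A -> PT (fun g => asg k (A g)).
Proof. by move=> HA; rewrite /asg; pt; apply: PT_dm. Qed.

Lemma PT_vals (A : G -> data) : PT A -> PT (fun g => vals (A g)).
Proof. by move=> HA; rewrite /vals; pt; apply: PT_dm. Qed.

Lemma PT_ntuples (A : G -> data) P : PT A -> PT (fun g => ntuples par (A g) P).
Proof. by move=> HA; rewrite /ntuples; pt; apply: PT_dm. Qed.

Lemma PT_has_rel (A : G -> data) R (a : G -> seq nat) : PT A -> PT a ->
  PT (fun g => has_rel (A g) R (a g)).
Proof. by move=> HA Ha; rewrite /has_rel; pt. Qed.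

Lemma PT_app_fun (A : G -> data) f (a : G -> seq nat) : PT A -> PT a ->
  PT (fun g => app_fun (A g) f (a g)).
Proof. by move=> HA Ha; rewrite /app_fun; pt; apply: PT_dm. Qed.

Lemma PT_lookup (v : G -> seq atom2) (w : G -> world) (s : G -> seq nat) :
  PT v -> PT w -> PT s -> PT (fun g => lookup (v g) (w g) (s g)).
Proof. by move=> Hv Hw Hs; rewrite /lookup; pt. Qed.

Lemma PT_supd (s : G -> seq nat) (x : 'I_k) (d : G -> nat) :
  PT s -> PT d -> PT (fun g => supd (s g) x (d g)).
Proof.
move=> Hs Hd; apply: (PT_fixed_map (F := fun y g => if y == x then d g else nth 0 (s g) y)).
by move=> y; case: (y == x); pt.
Qed.

End Definable.

Ltac pt_user ::= match goal with
  | |- @PT _ _ _ _ (fun g => dm (@?A g)) => refine (PT_dm (A := A) _)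
  | |- @PT _ _ _ _ (fun g => asg _ (@?A g)) => refine (PT_asg (A := A) _)
  | |- @PT _ _ _ _ (fun g => vals (@?A g)) => refine (PT_vals (A := A) _)
  | |- @PT _ _ _ _ (fun g => ntuples _ (@?A g) ?P) => refine (PT_ntuples (A := A) P _)
  | |- @PT _ _ _ _ (fun g => has_rel (@?A g) ?R (@?a g)) =>
      refine (PT_has_rel (A := A) R (a := a) _ _)
  | |- @PT _ _ _ _ (fun g => app_fun (@?A g) ?f (@?a g)) =>
      refine (PT_app_fun (A := A) f (a := a) _ _)
  | |- @PT _ _ _ _ (fun g => lookup (@?v g) (@?w g) (@?s g)) =>
      refine (PT_lookup (v := v) (w := w) (s := s) _ _ _)
  | |- @PT _ _ _ _ (fun g => supd (@?s g) ?x (@?d g)) =>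
      refine (PT_supd (s := s) x (d := d) _ _)
  end.

Lemma PT_loc {G} {eG : Enc G} (a : sym) (A : G -> data) (I : 'I_k' -> seq nat -> G -> bool)
    (s : G -> seq nat) (ch : nat -> seq nat -> G -> nat) : PT A -> PT s ->
  (forall P, PT (fun p : seq nat * G => I P p.1 p.2)) ->
  (forall i, PT (fun p : seq nat * G => ch i p.1 p.2)) ->
  PT (fun g => loc a (A g) (fun P t => I P t g) (s g) (fun i t => ch i t g)).
Proof.
move=> HA Hs HI Hch.
have Hc i (t : G -> seq nat) : PT t -> PT (fun g => ch i (t g) g).
  by move=> Ht; apply: (PT_comp (f := fun g => (t g, g)) (Hch i)); pt.
have Hc' (x : 'I_k) i : PT (fun p : nat * G => ch i (supd (s p.2) x p.1) p.2).
  by apply: (PT_comp (f := fun p : nat * G => (supd (s p.2) x p.1, p.2)) (Hch i)); pt.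
case: a => [R|f|||||x|x|x|P xs|P]; rewrite /loc; pt; try exact: Hc.
- exact: Hc'.
- exact: Hc'.
- by apply: (PT_comp (f := fun g => ([seq ch i (s g) g | i <- iota 0 (par P)], g)) (HI P));
    pt; apply: Hc.
Qed.

Section Definable2.
Context {G : Type} {eG : Enc G}.

Lemma PT_strs (X : G -> data) : PT X -> PT (fun g => strs (X g)).
Proof. by move=> HX; rewrite /strs /poss /negs; pt. Qed.

Lemma PT_worlds (X : G -> data) : PT X -> PT (fun g => worlds (X g)).
Proof. by move=> HX; rewrite /worlds /nworlds; pt; apply: PT_strs. Qed.

Lemma PT_worlds_of q (X : G -> data) : PT X -> PT (fun g => worlds_of q (X g)).
Proof.
move=> HX; rewrite /worlds_of; case: (is_phi q); last exact: PT_worlds.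
by pt; apply: PT_strs.
Qed.

Lemma PT_atoms1 (X : G -> data) : PT X -> PT (fun g => atoms1 (X g)).
Proof. by move=> HX; rewrite /atoms1; pt; apply: PT_worlds. Qed.

Lemma PT_atoms2 (X : G -> data) : PT X -> PT (fun g => atoms2 (X g)).
Proof. by move=> HX; rewrite /atoms2; pt; apply: PT_worlds. Qed.

Lemma PT_local_rule a q (X : G -> data) (x : G -> fact) (ys : G -> seq fact) :
  PT X -> PT x -> PT ys -> PT (fun g => local_rule a q (X g) (x g) (ys g)).
Proof.
move=> HX Hx Hys; rewrite /local_rule; pt.
  apply: (PT_loc a (A := fun p => p.2.1.1) (I := fun P t p => env_of (x p.2.2).1.2 p.2.1 P t)
    (s := fun p => p.1) (ch := fun i t p => lookup (nth no_fact (ys p.2.2) i).2 p.2.1 t)).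
  - by pt.
  - by pt.
  - by move=> P; rewrite /env_of; pt.
  - by move=> i; pt.
exact: PT_worlds_of.
Qed.

Lemma PT_let_rule P xs (X : G -> data) (x y z : G -> fact) :
  PT X -> PT x -> PT y -> PT z -> PT (fun g => let_rule P xs (X g) (x g) (y g) (z g)).
Proof.
move=> HX Hx Hy Hz; rewrite /let_rule /let_op; pt.
all: try exact: PT_strs.
Qed.
End Definable2.

Ltac pt_user2 := match goal with
  | |- @PT _ _ _ _ (fun g => local_rule ?a ?q (@?X g) (@?x g) (@?ys g)) =>
      refine (PT_local_rule a q (X := X) (x := x) (ys := ys) _ _ _)
  | |- @PT _ _ _ _ (fun g => let_rule ?P ?xs (@?X g) (@?x g) (@?y g) (@?z g)) =>
      refine (PT_let_rule P xs (X := X) (x := x) (y := y) (z := z) _ _ _ _)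
  | |- @PT _ _ _ _ (fun g => strs (@?X g)) => refine (PT_strs (X := X) _)
  end.
Ltac pt2 := repeat first [pt_step | pt_user2].

Lemma PT_rule {G} {eG : Enc G} a q (X : G -> data) (x : G -> fact) (ys : G -> seq fact) :
  PT X -> PT x -> PT ys -> PT (fun g => rule a q (X g) (x g) (ys g)).
Proof.
move=> HX Hx Hys; rewrite /rule; case: a => *; pt2.
Qed.

Lemma PT_alias {G} {eG : Enc G} (X : G -> data) (e : G -> entry) (acc : G -> seq entry) :
  PT X -> PT e -> PT acc -> PT (fun g => alias (X g) (e g) (acc g)).
Proof. by move=> HX He Hacc; rewrite /alias /nonterm /grammar_rules; pt. Qed.

Lemma PT_acceptable {G} {eG : Enc G} (X : G -> data) (e : G -> entry) (acc : G -> seq entry) :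
  PT X -> PT e -> PT acc -> PT (fun g => acceptable (X g) (e g) (acc g)).
Proof.
move=> HX He Hacc; rewrite /acceptable /justified; pt.
- by apply: PT_rule; pt.
- exact: PT_alias.
Qed.

Lemma PT_facts {G} {eG : Enc G} (Z : G -> input_with_sublists) : PT Z -> PT (fun g => facts (Z g)).
Proof. by move=> HZ; rewrite /facts /nodes /start_node /nonterm; pt. Qed.

Lemma PT_candidates {G} {eG : Enc G} (Z : G -> input_with_sublists) :
  PT Z -> PT (fun g => candidates (Z g)).
Proof. by move=> HZ; rewrite /candidates; pt; apply: PT_facts; pt. Qed.

Lemma PT_saturate {G} {eG : Enc G} (Z : G -> input_with_sublists) :
  PT Z -> PT (fun g => saturate (Z g)).
Proof.
move=> HZ; rewrite /saturate.
apply: (PT_collect (P := fun e acc g => acceptable (Z g).1 e acc)).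
  by apply: PT_acceptable; pt.
pt; first by apply: PT_candidates; pt.
by apply: PT_facts.
Qed.

Lemma PT_separating {G} {eG : Enc G} (X : G -> data) (x : G -> fact) :
  PT X -> PT x -> PT (fun g => separating (X g) (x g)).
Proof. by move=> HX Hx; rewrite /separating /start_node /nonterm /poss /negs; pt. Qed.

Lemma PT_position {G} {eG : Enc G} (l : G -> seq fact) (y : G -> fact) :
  PT l -> PT y -> PT (fun g => position (l g) (y g)).
Proof.
move=> Hl Hy; rewrite /position; pt.
by apply: (PT_collect (P := fun _ acc g => y g \notin acc)) => //; pt.
Qed.

Lemma PT_dag_node {G} {eG : Enc G} (T : G -> seq entry) (e : G -> entry) :
  PT T -> PT e -> PT (fun g => dag_node (T g) (e g)).
Proof. by move=> HT He; rewrite /dag_node; pt; apply: PT_position; pt. Qed.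

Lemma PT_answer {G} {eG : Enc G} (Z : G -> input_with_sublists) :
  PT Z -> PT (fun g => answer (Z g)).
Proof.
move=> HZ; rewrite /answer; pt.
- by apply: PT_separating; pt.
- exact: PT_saturate.
- by apply: PT_dag_node; pt; apply: PT_saturate; pt.
- by apply: PT_dag_node; pt; apply: PT_saturate; pt.
- by apply: PT_saturate; pt.
Qed.

Definition solve (X : data) : dag tau k par :=
  answer (X, (pow (atoms1 X), pow (atoms2 X))).

Lemma ET_solve : ET solve.
Proof.
apply: (ET_comp (h := answer)); first exact: PT_answer PT_id.
apply: ET_pair; first exact/ET_PT/PT_id.
apply: ET_pair; apply: ET_PT_comp ET_pow _.
- exact: PT_atoms1 PT_id.
- exact: PT_atoms2 PT_id.
Qed.

End Algorithm.

(** * Correctness of the algorithm *)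

Section Collect.
Variables (E K : eqType) (key : E -> K) (ok : E -> seq E -> bool).
Let acc e s := (key e \notin map key s) && ok e s.

Lemma collect_ind (P : E -> seq E -> bool) (Q : seq E -> Prop) a l : Q a ->
  (forall e s, e \in l -> P e s -> Q s -> Q (e :: s)) -> Q (collect P a l).
Proof.
elim: l a => //= x l IH a Qa H; apply: IH.
  by case: ifP => // Px; apply: H; rewrite ?inE ?eqxx.
by move=> e s el; apply: H; rewrite inE el orbT.
Qed.

Lemma collect_size (P : E -> seq E -> bool) a l : size a <= size (collect P a l).
Proof.
by apply: (collect_ind (Q := fun s => size a <= size s)) => //= e s _ _ /leqW.
Qed.

Lemma collect_stable (P : E -> seq E -> bool) a l : size (collect P a l) <= size a ->
  collect P a l = a /\ {in l, forall e, ~~ P e a}.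
Proof.
elim: l => //= x l IH; case: ifP => Px h.
  by have := leq_trans (collect_size P (x :: a) l) h; rewrite /= ltnn.
have [-> H] := IH h; split=> // e; rewrite inE => /orP[/eqP ->|/H //].
by rewrite Px.
Qed.

Fixpoint valid (s : seq E) : bool :=
  if s is e :: s' then acc e s' && valid s' else true.

Lemma valid_uniq s : valid s -> uniq (map key s).
Proof. by elim: s => //= e s IH /andP[/andP[-> _] /IH]. Qed.

Lemma collect_passes (U : Type) (r : seq U) a l :
  collect acc a (flatten [seq l | _ <- r]) = iter (size r) (fun s => collect acc s l) a.
Proof.
elim: r a => [|u r IH] a //.
by rewrite [size _]/= iterSr -IH /collect /= foldl_cat.
Qed.

(* As keys are never repeated, some pass collects nothing; from there on nothing
   changes. *)
Lemma saturated (U : Type) (r : seq U) (ks : seq K) l : size ks < size r ->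
  (forall e, e \in l -> key e \in ks) ->
  forall e, e \in l -> ~~ acc e (collect acc [::] (flatten [seq l | _ <- r])).
Proof.
move=> hr hks; rewrite collect_passes.
set f := fun s => collect acc s l.
pose good s := valid s /\ {subset map key s <= ks}.
have fgood s : good s -> good (f s).
  move=> gs; apply: collect_ind => // e t el ae [vt kt]; split; first by rewrite /= ae.
  by move=> y; rewrite inE => /orP[/eqP ->|/kt //]; apply: hks.
have gn n : good (iter n f [::]) by elim: n => [|n IH]; [split|exact: fgood].
have small n : size (iter n f [::]) <= size ks.
  case: (gn n) => /valid_uniq u k; rewrite -(size_map key).
  exact: uniq_leq_size.
suff [i [ir hi]] : exists i, i < size r /\ size (f (iter i f [::])) <= size (iter i f [::]).
  have [Ef H] := collect_stable hi.
  have -> : iter (size r) f [::] = iter i f [::]; last exact: H.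
  rewrite -(subnK (ltnW ir)) iterD; elim: (_ - _) => //= n ->.
  exact: Ef.
case: (boolP (has (fun i => size (f (iter i f [::])) <= size (iter i f [::])) (iota 0 (size r)))).
  by move=> /hasP[i]; rewrite mem_iota => /andP[_ hi] h; exists i.
rewrite -all_predC => /allP H.
have grow n : n <= size r -> n <= size (iter n f [::]).
  elim: n => // n IH hn; have /H : n \in iota 0 (size r) by rewrite mem_iota.
  by rewrite /= -ltnNge; apply: leq_ltn_trans (IH (ltnW hn)).
by have := leq_trans (grow _ (leqnn _)) (small _); rewrite leqNgt hr.
Qed.

End Collect.

Lemma all_exists_seq (T U : Type) (x0 : T) (y0 : U) (R : T -> U -> Prop) s :
  (forall x, List.In x s -> exists y, R x y) ->
  exists2 t, size t = size s & forall i, i < size s -> R (nth x0 s i) (nth y0 t i).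
Proof.
elim: s => [|x s IH] H; first by exists [::].
have [y Ry] := H x (or_introl erefl).
have [|t st Ht] := IH; first by move=> z zs; apply: H; right.
by exists (y :: t); rewrite /= ?st // => -[|i] //= /Ht.
Qed.

Lemma Forall2_nth (T U : Type) (x0 : T) (y0 : U) (R : T -> U -> Prop) s t :
  size t = size s -> (forall i, i < size s -> R (nth x0 s i) (nth y0 t i)) ->
  List.Forall2 R s t.
Proof.
elim: s t => [|x s IH] [|y t] //= [st] H.
constructor; first exact: (H 0).
by apply: IH => // i hi; apply: (H i.+1).
Qed.

Lemma mem_In (T : eqType) (x : T) s : x \in s <-> List.In x s.
Proof.
elim: s => //= y s [IH1 IH2]; rewrite inE; split.
  by case/orP => [/eqP ->|/IH1]; [left|right].
by case=> [->|/IH2 ->]; rewrite ?eqxx ?orbT.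
Qed.

Section Correctness.
Variables (tau : signature) (k k' : nat) (par : 'I_k' -> nat) (strict : bool).
Variable X0 : instance tau k par.

Local Notation sym := (sym tau k par).
Local Notation sta := (sta k k').
Local Notation nild := (Data [::]).
Local Notation dtr := (dtr tau k par).
Local Notation G := (gram X0).
Local Notation world := (data * nat)%type.
Local Notation atom1 := (world * 'I_k' * seq nat)%type.
Local Notation atom2 := (world * seq nat * nat)%type.
Local Notation fact := (data * sta * seq atom1 * seq atom2)%type.
Local Notation entry := (fact * sym * seq fact)%type.

Let X := dinstance X0.
Let Z := (X, (pow (atoms1 par X), pow (atoms2 k par X))).

Lemma strs_X A : A \in strs X <-> exists2 B, List.In B (pos X0 ++ neg X0) & A = dstructure B.
Proof.
rewrite /strs /poss /negs /= -map_cat.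
elim: (_ ++ _) => [|B s [IH1 IH2]] /=; first by split=> // -[].
rewrite inE; split.
  case/orP=> [/eqP ->|/IH1[C Cs ->]]; first by exists B => //; left.
  by exists C => //; right.
move=> [C [->|Cs] E]; first by rewrite E eqxx.
by rewrite IH2 ?orbT //; exists C.
Qed.

Lemma start_node_dtree : start_node X = dtree (Node (inr (axm G)) [::] : tree (sym + nat)).
Proof. by []. Qed.

Lemma grammar_rules_X r : r \in grammar_rules X <->
  exists B t, List.In (B, t) (rules G) /\ r = Data [:: dnat B; dtree t].
Proof.
rewrite /grammar_rules /=; elim: (rules G) => [|[B t] s [IH1 IH2]] /=.
  by split=> // -[B [t []]].
rewrite inE; split.
  case/orP=> [/eqP ->|/IH1[C [u [Cs ->]]]]; first by exists B, t; split=> //; left.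
  by exists C, u; split=> //; right.
move=> [C [u [[[<- <-]|Cs] E]]]; first by rewrite E eqxx.
by rewrite IH2 ?orbT //; exists C, u.
Qed.

Lemma node_kid (l : sym + nat) ts t : dtree (Node l ts) \in nodes X -> List.In t ts ->
  dtree t \in nodes X.
Proof.
rewrite /nodes inE start_node_dtree => /orP[/eqP[_ E]|H] tts.
  by case: ts E tts.
rewrite inE; apply/orP; right; apply: subs_trans H _; apply: subs_kid => /=.
rewrite inE; apply/orP; right.
by elim: ts tts => //= x s IH [->|/IH]; rewrite inE ?eqxx // => ->; rewrite orbT.
Qed.

Lemma node_rule B t : List.In (B, t) (rules G) -> dtree t \in nodes X.
Proof.
move=> Bt; have r : Data [:: dnat B; dtree t] \in grammar_rules X by apply/grammar_rules_X; exists B, t.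
rewrite inE; apply/orP; right.
apply: (@subs_trans (dgrammar G)); first by apply: subs_kid; rewrite /= !inE eqxx !orbT.
apply: (@subs_trans (Data (grammar_rules X))); first by apply: subs_kid; rewrite /= !inE eqxx !orbT.
apply: subs_trans (subs_kid r) _.
by apply: subs_kid; rewrite /= !inE eqxx orbT.
Qed.

Lemma dm0 A : A \in strs X -> 0 \in dm A.
Proof. by move=> /strs_X[B _ ->]; rewrite dm_structure inE. Qed.

Lemma ntuples_gt0 A P : A \in strs X -> 0 < ntuples par A P.
Proof.
move=> /dm0; rewrite /ntuples size_tuples; case: (dm A) => // d s _.
by rewrite expn_gt0.
Qed.

Lemma nworlds_gt A P i : i <= ntuples par A P -> i < nworlds par A.
Proof.
move=> hi; rewrite /nworlds ltnS; apply: leq_trans hi _; rewrite /ntuples.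
have : P \in enum 'I_k' by rewrite mem_enum.
elim: (enum _) => //= Q s IH; rewrite inE size_cat => /orP[/eqP ->|/IH h].
  exact: leq_addr.
exact: leq_trans h (leq_addl _ _).
Qed.

Lemma mem_worlds w : (w \in worlds par X) = (w.1 \in strs X) && (w.2 < nworlds par w.1).
Proof.
apply/flatten_mapP/andP => [[A AX /mapP[i]]|[wX hw]].
  by rewrite mem_iota => /andP[_ hi] -> /=.
exists w.1 => //; apply/mapP; exists w.2; rewrite ?mem_iota //.
by case: w {wX hw}.
Qed.

Lemma mem_atoms1 w P a : ((w, P, a) \in atoms1 par X) =
  (w \in worlds par X) && (a \in tuples (par P) (dm w.1)).
Proof.
apply/flatten_mapP/andP => [[w' wX /flatten_mapP[Q _ /mapP[b bQ [-> -> ->]]]]|[wX aP]] //.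
exists w => //; apply/flatten_mapP; exists P; first by rewrite mem_enum.
by apply/mapP; exists a.
Qed.

Lemma mem_atoms2 w s d : ((w, s, d) \in atoms2 k par X) =
  [&& w \in worlds par X, s \in asg k w.1 & d \in vals w.1].
Proof.
apply/flatten_mapP/and3P => [[w' wX /flatten_mapP[t tA /mapP[e eA [-> -> ->]]]]|[wX sA dA]] //.
exists w => //; apply/flatten_mapP; exists s => //.
by apply/mapP; exists d.
Qed.

Lemma mem_facts u q c v : ((u, q, c, v) \in facts k Z) =
  [&& u \in nodes X, c \in pow (atoms1 par X) & v \in pow (atoms2 k par X)].
Proof.
apply/flatten_mapP/and3P => [[u' uX /flatten_mapP[q' _ /flatten_mapP[c' cC /mapP[v' vV [-> _ -> ->]]]]]|[uX cC vV]] //.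
exists u => //; apply/flatten_mapP; exists q; first by rewrite mem_enum.
apply/flatten_mapP; exists c => //.
by apply/mapP; exists v.
Qed.

Lemma mem_candidates x a ys : ((x, a, ys) \in candidates tau k par Z) =
  (x \in facts k Z) && (ys \in tuples (rank a) (facts k Z)).
Proof.
apply/flatten_mapP/andP => [[b _ /flatten_mapP[x' xF /mapP[ys' yF [-> -> ->]]]]|[xF yF]] //.
exists a; first exact: mem_syms.
by apply/flatten_mapP; exists x => //; apply/mapP; exists ys.
Qed.

Lemma worlds_ofP (q : sta) w : reflect (w \in worlds par X /\ (is_phi q -> w.2 = 0))
  (w \in worlds_of par q X).
Proof.
rewrite /worlds_of; apply: (iffP idP).
  case: (is_phi q) => [/mapP[A AX ->]|wX]; split=> //.
  by rewrite mem_worlds AX.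
case: (is_phi q) => -[wX w0] //; move: wX; rewrite mem_worlds => /andP[wX _].
by apply/mapP; exists w.1 => //; rewrite -(w0 isT); case: w {wX w0}.
Qed.

(** Below a symbol other than a [let], the children of a formula with definitions either have the
    same worlds or, being of sort [psi] or terms, have all of them; so the values that a node needs
    are available. *)
Lemma worlds_of_child (a : sym) (q : sta) i w : ~~ is_let a -> allowed a q ->
  w \in worlds_of par q X -> w \in worlds_of par (child strict a q i) X.
Proof.
move=> nl al /worlds_ofP[wX w0]; apply/worlds_ofP; split=> // phi; apply: w0.
move: al phi; case: q => [[[[lv D] B] P] e]; case: a nl => //=.
by case: (i == 0).
Qed.

(** * Correctness of the single rules *)

Definition describes (c : seq atom1) (v : seq atom2) (q : sta) (t : tree sym) :=
  forall w, w \in worlds_of par q X -> forall s, s \in asg k w.1 ->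
  lookup v w s = tree_val t w.1 (env_of c w) s.

(** Being a filter of all atoms, the list of true values is among the enumerated sublists; it is the
    witness in the completeness proof. *)
Definition canonical (c : seq atom1) (t : tree sym) : seq atom2 :=
  [seq y <- atoms2 k par X | y.2 == tree_val t y.1.1.1 (env_of c y.1.1) y.1.2].

Lemma lookup_canonical c t w s : w \in worlds par X -> s \in asg k w.1 ->
  lookup (canonical c t) w s = tree_val t w.1 (env_of c w) s.
Proof.
move=> wX sA; rewrite /lookup; set d := tree_val _ _ _ _.
set l := [seq y <- _ | _].
have ld y : y \in l -> y.2 = d.
  by rewrite !mem_filter => /and3P[/eqP E /eqP -> _]; rewrite E.
have : (w, s, d) \in l.
  by rewrite !mem_filter /= !eqxx mem_atoms2 wX sA tree_val_vals.
by case: l ld => //= y l ld _; apply: ld; rewrite inE eqxx.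
Qed.

Lemma canonical_describes c q t : describes c (canonical c t) q t.
Proof. by move=> w /worlds_ofP[wX _] s; apply: lookup_canonical. Qed.

Lemma tree_val_loc a ts A I s : ~~ is_let a -> size ts = rank a -> s \in asg k A ->
  tree_val (Node a ts) A I s =
  loc a A I s (fun i s' => tree_val (nth dtr ts i) A I s').
Proof.
move=> nl st sA; transitivity (loc a A I s
    (fun i => nth (fun _ _ _ => 0) (map (@tree_val tau k k' par) ts) i A I)).
  by case: a nl st.
by apply: loc_ext => // i s' hi _; rewrite nth_tree_val ?st.
Qed.

Lemma tree_val_let P (xs : (par P).-tuple 'I_k) t u A I s :
  tree_val (Node (SLet tau xs) [:: t; u]) A I s =
  tree_val u A (updI I P (let_iter A P xs (tree_val t A) I (ntuples par A P))) s.
Proof. by []. Qed.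

Lemma let_op_ext A (xs : seq 'I_k) d d' a : {in asg k A, d =1 d'} ->
  let_op A xs d a = let_op A xs d' a.
Proof. by move=> E; apply: eq_in_has => s /E ->. Qed.

Lemma let_op_range A P (xs : (par P).-tuple 'I_k) d a :
  let_op A xs d a -> a \in tuples (par P) (dm A).
Proof.
move=> /hasP[s]; rewrite mem_tuples => /andP[/eqP ss /allP sA] /andP[/eqP <- _].
rewrite mem_tuples size_map size_tuple eqxx; apply/allP => _ /mapP[x _ ->].
by apply: sA; rewrite mem_nth // ss.
Qed.

Lemma let_iter_range A P (xs : (par P).-tuple 'I_k) d I i a :
  let_iter A P xs d I i a -> a \in tuples (par P) (dm A).
Proof. by case: i => // i; apply: let_op_range. Qed.

Lemma pow_atoms1 c w P a : c \in pow (atoms1 par X) -> (w, P, a) \in c ->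
  a \in tuples (par P) (dm w.1).
Proof. by move=> /mem_pow cA /cA; rewrite mem_atoms1 => /andP[]. Qed.

(** Environments are compared as functions on all lists. Outside the tuples of the right length over
    the domain they are all false, so agreement on these tuples is enough. *)
Lemma env_upd_eq A i (c c' : seq atom1) P (Y : seq nat -> bool) :
  A \in strs X -> c \in pow (atoms1 par X) -> c' \in pow (atoms1 par X) ->
  (forall a, Y a -> a \in tuples (par P) (dm A)) ->
  (forall Q a, Q != P -> a \in tuples (par Q) (dm A) ->
     (((A, i), Q, a) \in c') = (((A, 0), Q, a) \in c)) ->
  (forall a, a \in tuples (par P) (dm A) -> (((A, i), P, a) \in c') = Y a) ->
  env_of c' (A, i) = updI (env_of c (A, 0)) P Y.
Proof.
move=> AX cC c'C hY h1 h2; apply: functional_extensionality => Q.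
apply: functional_extensionality => a; rewrite /updI /env_of.
case: (boolP (a \in tuples (par Q) (dm A))) => [aQ|naQ].
  by case: eqVneq => [E|QP]; [subst Q; apply: h2|apply: h1].
rewrite (negbTE (contra (@pow_atoms1 _ (A, i) _ _ c'C) naQ)).
case: eqVneq => [E|QP]; last by rewrite (negbTE (contra (@pow_atoms1 _ (A, 0) _ _ cC) naQ)).
by subst Q; apply/esym/negbTE/(contra (hY a)).
Qed.

Lemma let_rule_sound P (xs : (par P).-tuple 'I_k) (x y z : fact) (q : sta) t u :
  x.1.2 \in pow (atoms1 par X) -> y.1.2 \in pow (atoms1 par X) ->
  z.1.2 \in pow (atoms1 par X) -> let_rule par P xs X x y z ->
  allowed (SLet tau xs) q ->
  describes y.1.2 y.2 (child strict (SLet tau xs) q 0) t ->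
  describes z.1.2 z.2 (child strict (SLet tau xs) q 1) u ->
  describes x.1.2 x.2 q (Node (SLet tau xs) [:: t; u]).
Proof.
move=> xC yC zC /allP H al Dy Dz [A i] /worlds_ofP[wX w0] s /= sA.
have phi : is_phi q by move: al; case: q {Dy Dz w0} => [[[[[[]|] ?] ?] ?] ?].
have {w0} -> : i = 0 := w0 phi.
move: wX; rewrite mem_worlds => /andP[/= AX _].
have /and3P[/allP h1 /allP h2 /allP h3] := H A AX.
rewrite (eqP (h3 s sA)) Dz //; last first.
  by apply/worlds_ofP; rewrite mem_worlds AX.
set I := env_of x.1.2 (A, 0).
set n := ntuples par A P in h1 h2 *.
set Y := let_iter A P xs (tree_val t A) I.
have h1Q Q a : Q != P -> a \in tuples (par Q) (dm A) ->
    (forall i, i < n -> (((A, i), Q, a) \in y.1.2) = (((A, 0), Q, a) \in x.1.2)) /\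
    (((A, 0), Q, a) \in z.1.2) = (((A, 0), Q, a) \in x.1.2).
  move=> QP aQ; have := h1 Q; rewrite mem_enum (negbTE QP) /= => /(_ isT) /allP/(_ a aQ).
  move=> /andP[/allP hi /eqP hz]; split=> // j jn.
  by apply/eqP/hi; rewrite mem_iota.
have Yr j a : Y j a -> a \in tuples (par P) (dm A) by apply: let_iter_range.
have wj j : j < n -> (A, j) \in worlds_of par (child strict (SLet tau xs) q 0) X.
  move=> jn; apply/worlds_ofP; split.
    by rewrite mem_worlds AX /= (@nworlds_gt _ P) // ltnW.
  by case: q {al Dy Dz phi} => [[[[? ?] ?] ?] ?].
have step j a : j < n -> env_of y.1.2 (A, j) = updI I P (Y j) ->
    let_op A xs (lookup y.2 (A, j)) a = Y j.+1 a.
  by move=> jn E; apply: let_op_ext => s' s'A; rewrite Dy ?wj // E.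
(* Correct values of the body in world [j] require the correct stage there, and they force the
   correct stage in world [j.+1]; hence an induction over the worlds. *)
have claim j : j < n -> env_of y.1.2 (A, j) = updI I P (Y j).
  elim: j => [|j IH] jn.
    apply: env_upd_eq => //.
    - by move=> Q a QP aQ; apply: (h1Q Q a QP aQ).1.
    - by move=> a /h2/andP[/negbTE -> _].
  apply: env_upd_eq => //; first exact: Yr.
  - by move=> Q a QP aQ; apply: (h1Q Q a QP aQ).1.
  - move=> a /h2/andP[_ /allP/(_ j)]; rewrite mem_iota => /(_ (ltnW jn)) /eqP.
    by rewrite (ltn_eqF jn) => <-; apply: step (ltnW jn) (IH (ltnW jn)).
have n0 : 0 < n := ntuples_gt0 P AX.
congr tree_val; apply: env_upd_eq => //; first exact: Yr.
- by move=> Q a QP aQ; apply: (h1Q Q a QP aQ).2.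
(* The last application of the operator happens in world [n.-1] and yields stage [n], the
   interpretation used by the rest. *)
- move=> a /h2/andP[_ /allP/(_ n.-1)].
  have n1 : n.-1 < n by rewrite prednK.
  have nI : n.-1 \in iota 0 n by rewrite mem_iota.
  move=> /(_ nI); rewrite prednK // eqxx => /eqP <-.
  by rewrite (step _ _ n1 (claim _ n1)) prednK.
Qed.

Lemma let_rule_complete P (xs : (par P).-tuple 'I_k) (c : seq atom1) t u :
  c \in pow (atoms1 par X) ->
  exists c1 c2, [/\ c1 \in pow (atoms1 par X), c2 \in pow (atoms1 par X) &
    forall n1 n2 n3 q1 q2 q3, let_rule par P xs X
      (n1, q1, c, canonical c (Node (SLet tau xs) [:: t; u]))
      (n2, q2, c1, canonical c1 t) (n3, q3, c2, canonical c2 u)].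
Proof.
move=> cC.
pose Y A := let_iter A P xs (tree_val t A) (env_of c (A, 0)).
(* The true stages: the context of the body interprets [P] in world [i] by stage [i], that of the
   rest by the final stage. All other symbols are copied from world 0 of [c]. *)
pose p1 (y : atom1) := if y.1.2 == P then Y y.1.1.1 y.1.1.2 y.2
  else ((y.1.1.1, 0), y.1.2, y.2) \in c.
pose p2 (y : atom1) := if y.1.2 == P then Y y.1.1.1 (ntuples par y.1.1.1 P) y.2
  else ((y.1.1.1, 0), y.1.2, y.2) \in c.
exists [seq y <- atoms1 par X | p1 y], [seq y <- atoms1 par X | p2 y].
split; try exact: filter_pow.
move=> n1 n2 n3 q1 q2 q3; apply/allP => A AX.
set n := ntuples par A P.
have wj j : j <= n -> (A, j) \in worlds par X.
  by move=> jn; rewrite mem_worlds AX /= (@nworlds_gt _ P).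
have Yr j a : Y A j a -> a \in tuples (par P) (dm A) by apply: let_iter_range.
have m1 j Q a : j <= n -> a \in tuples (par Q) (dm A) ->
    (((A, j), Q, a) \in [seq y <- atoms1 par X | p1 y]) = p1 ((A, j), Q, a).
  by move=> jn aQ; rewrite mem_filter mem_atoms1 wj //= aQ andbT.
have m2 Q a : a \in tuples (par Q) (dm A) ->
    (((A, 0), Q, a) \in [seq y <- atoms1 par X | p2 y]) = p2 ((A, 0), Q, a).
  by move=> aQ; rewrite mem_filter mem_atoms1 wj //= aQ andbT.
have claim j : j < n -> env_of [seq y <- atoms1 par X | p1 y] (A, j) =
    updI (env_of c (A, 0)) P (Y A j).
  move=> jn; apply: env_upd_eq => //; try exact: filter_pow; try exact: Yr.
  - by move=> Q a QP aQ; rewrite m1 ?(ltnW jn) // /p1 /= (negbTE QP).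
  - by move=> a aP; rewrite m1 ?(ltnW jn) // /p1 /= eqxx.
apply/and3P; split.
- apply/allP => Q _; apply/orP; case: eqVneq => [_|QP]; [by left|right].
  apply/allP => a aQ; apply/andP; split; last by rewrite m2 // /p2 /= (negbTE QP).
  apply/allP => j; rewrite mem_iota => /andP[_ jn].
  by rewrite m1 ?(ltnW jn) // /p1 /= (negbTE QP).
- apply/allP => a aP; apply/andP; split; first by rewrite m1 // /p1 /= eqxx.
  apply/allP => j; rewrite mem_iota => /andP[_ jn]; apply/eqP.
  have -> : let_op A xs (lookup (canonical [seq y <- atoms1 par X | p1 y] t) (A, j)) a =
      Y A j.+1 a.
    apply: let_op_ext => s sA; rewrite lookup_canonical ?wj ?(ltnW jn) //.
    by rewrite claim.
  case: eqP => [->|_]; first by rewrite m2 // /p2 /= eqxx.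
  by rewrite m1 // /p1 /= eqxx.
- apply/allP => s sA; rewrite !lookup_canonical ?wj // tree_val_let.
  apply/eqP; congr tree_val; apply/esym/env_upd_eq => //; try exact: filter_pow; try exact: Yr.
  + by move=> Q a QP aQ; rewrite m2 // /p2 /= (negbTE QP).
  + by move=> a aP; rewrite m2 // /p2 /= eqxx.
Qed.

Lemma local_rule_sound (a : sym) (q : sta) (x : fact) (ys : seq fact) ts :
  ~~ is_let a -> allowed a q -> size ts = rank a ->
  local_rule a q X x ys ->
  (forall i, i < rank a -> describes (nth (no_fact k k') ys i).1.2 (nth (no_fact k k') ys i).2
     (child strict a q i) (nth dtr ts i)) ->
  describes x.1.2 x.2 q (Node a ts).
Proof.
move=> nl al st /andP[/allP hc /allP hv] D w wq s sA.
rewrite (eqP (allP (hv w wq) s sA)) tree_val_loc //; apply: loc_ext => // i s' hi s'A.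
have := hc i; rewrite mem_iota => /(_ hi)/eqP E.
by rewrite D ?E //; apply: worlds_of_child.
Qed.

(** * Completeness of the saturation *)

Let T := saturate tau k par strict Z.
Let heads := [seq e.1.1 | e <- T].
Let key (e : entry) := e.1.1.

Lemma T_valid : valid key (justified strict X) T /\ {subset T <= candidates tau k par Z}.
Proof.
rewrite /T /saturate; apply: (collect_ind (Q := fun s =>
  valid key (justified strict X) s /\ {subset s <= candidates tau k par Z})).
  by split.
move=> e s eC ae [vs sC]; split; first by rewrite /= vs andbT.
move=> y; rewrite inE => /orP[/eqP ->|/sC //].
by case/flatten_mapP: eC.
Qed.

Lemma T_facts e : e \in T -> e.1.1 \in facts k Z /\ e.2 \in tuples (rank e.1.2) (facts k Z).
Proof.
by case: T_valid => _ /[apply]; case: e => [[x a] ys]; rewrite mem_candidates => /andP.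
Qed.

Lemma T_saturated e : e \in candidates tau k par Z -> justified strict X e T ->
  e.1.1 \in heads.
Proof.
move=> eC je; have := @saturated _ _ key (justified strict X) _
  (no_fact k k' :: facts k Z) (facts k Z) (candidates tau k par Z) (leqnn _).
have H : forall e, e \in candidates tau k par Z -> key e \in facts k Z.
  by move=> [[x a] ys]; rewrite mem_candidates => /andP[].
move=> /(_ H e eC); rewrite -/T /= je andbT negbK; exact.
Qed.

Lemma nonlet_rule (a : sym) (b : bool) (f : forall P, (par P).-tuple 'I_k -> bool) :
  ~~ is_let a -> (if a is SLet P xs then f P xs else b) = b.
Proof. by case: a. Qed.

Lemma by_rule (x : fact) (a : sym) (q : sta) (ys : seq fact) :
  x \in facts k Z -> size ys = rank a ->
  {subset ys <= heads} -> rule strict a q X x ys -> x \in heads.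
Proof.
move=> xF sy yT r; apply: (@T_saturated (x, a, ys)).
  rewrite mem_candidates xF mem_tuples sy eqxx; apply/allP => y /yT /mapP[e eT ->].
  by case: (T_facts eT).
rewrite /justified; apply/orP; left; apply/andP; split; first exact/allP.
apply/hasP; exists a; first exact: mem_syms.
by apply/hasP; exists q; rewrite ?mem_enum //= eqxx.
Qed.

(** The context is quantified inside the induction, because a definition evaluates its two children
    in contexts different from its own. *)
Lemma complete u t : derives (SAnd tau k par) G u t -> forall (q : sta) c,
  wt strict q t -> dtree u \in nodes X -> c \in pow (atoms1 par X) ->
  (dtree u, q, c, canonical c t) \in heads.
Proof.
elim=> {u t} [a qs ts sq _ IH|B u t Bu _ IH] q c wqt uX cC.
- have xF : (dtree (Node (inl a) qs), q, c, canonical c (Node a ts)) \in facts k Z.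
    by rewrite mem_facts uX cC filter_pow.
  inversion wqt as [q' a' ts' al st Hts]; subst q' a' ts'.
  have hyp i : i < rank a -> dtree (nth (dflt_rhs (SAnd tau k par)) qs i) \in nodes X /\
      forall c', c' \in pow (atoms1 par X) ->
      (dtree (nth (dflt_rhs (SAnd tau k par)) qs i), child strict a q i, c',
        canonical c' (nth dtr ts i)) \in heads.
    move=> hi; have iX : dtree (nth (dflt_rhs (SAnd tau k par)) qs i) \in nodes X.
      by apply: node_kid uX _; apply: in_nth; rewrite sq st.
    by split=> // c' c'C; apply: IH => //; [rewrite st|apply: Hts; rewrite st].
  have kid i : i < rank a -> nth nild (kids (dtree (Node (inl a) qs))) i.+1 =
      dtree (nth (dflt_rhs (SAnd tau k par)) qs i).
    by move=> hi; rewrite /= (nth_map (dflt_rhs (SAnd tau k par))) // sq st.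
  have sk : size (kids (dtree (Node (inl a) qs))) == (rank a).+1.
    by rewrite /= size_map sq st.
  case: (boolP (is_let a)) => la.
    case: a {IH} la al st xF wqt Hts hyp kid sk {uX} => // P xs _ al st xF wqt Hts hyp kid sk.
    have Ets : ts = [:: nth dtr ts 0; nth dtr ts 1] by case: ts st {sq wqt Hts xF hyp} => [|t [|t' []]].
    rewrite Ets in xF *.
    have [c1 [c2 [c1C c2C H]]] := let_rule_complete xs (nth dtr ts 0) (nth dtr ts 1) cC.
    apply: (@by_rule _ (SLet tau xs) q [:: (_, _, c1, _); (_, _, c2, _)]) => //.
      move=> y; rewrite !inE => /orP[] /eqP ->.
        exact: (hyp 0 isT).2.
      exact: (hyp 1 isT).2.
    apply/and5P; split=> //.
    apply/andP; split; last exact: H.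
    by apply/allP => -[|[|i]] // _; apply/andP; split; apply/eqP => //; apply/esym/kid.
  pose ys := [seq (dtree (nth (dflt_rhs (SAnd tau k par)) qs i), child strict a q i, c,
     canonical c (nth dtr ts i)) | i <- iota 0 (rank a)].
  have nys i : i < rank a -> nth (no_fact k k') ys i =
      (dtree (nth (dflt_rhs (SAnd tau k par)) qs i), child strict a q i, c,
     canonical c (nth dtr ts i)).
    by move=> hi; rewrite (nth_map 0) ?size_iota // nth_iota.
  apply: (@by_rule _ a q ys) => //; first by rewrite size_map size_iota.
    by move=> y /mapP[i]; rewrite mem_iota => /andP[_ hi] ->; apply: (hyp i hi).2.
  apply/and5P; split=> //; apply/andP; split.
    apply/allP => i; rewrite mem_iota => /andP[_ hi].
    by rewrite nys //; apply/andP; split; apply/eqP => //; apply/esym/kid.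
  rewrite nonlet_rule //.
  apply/andP; split.
    by apply/allP => i; rewrite mem_iota => /andP[_ hi]; rewrite nys.
  apply/allP => w wq; apply/allP => s sA; apply/eqP.
  rewrite [_.2]/= (@canonical_describes c q (Node a ts) w wq s sA) tree_val_loc //; apply: loc_ext => // i s' hi s'A.
  by rewrite nys //= lookup_canonical //; case/worlds_ofP: wq.
- have /mapP[e eT E] := IH q c wqt (node_rule Bu) cC.
  have [_ ysF] := T_facts eT.
  apply: (@T_saturated ((dtree (Node (inr B) [::]), q, c, canonical c t), e.1.2, e.2)).
    by rewrite mem_candidates mem_facts uX cC filter_pow ysF.
  rewrite /justified; apply/orP; right; apply/hasP; exists e => //.
  rewrite -E !eqxx /=; apply/hasP; exists (Data [:: dnat B; dtree u]); first by apply/grammar_rules_X; exists B, u.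
  by apply/andP; split; apply/eqP.
Qed.

(** * Soundness: unfolding the dag *)

Definition dag_of (e0 : entry) : dag tau k par :=
  dag_node T e0 :: [seq dag_node T e | e <- T].

(** The collection grows by one at each element and stops as soon as it contains [y]. *)
Lemma position_index (l : seq fact) y : y \in l -> position l y = (index y l).+1.
Proof.
rewrite /position; set F := fun (_ : fact) (acc : seq fact) => y \notin acc.
have stop a s : y \in a -> collect F a s = a.
  by elim: s a => //= x s IH a ya; rewrite /F ya /=; apply: IH.
suff H a : y \notin a -> y \in l -> size (collect F a l) = size a + (index y l).+1.
  by move=> yl; rewrite H.
elim: l a => //= x l IH a ya; rewrite /F ya inE /= eq_sym.
case: eqVneq => [->|xy] /= yl; first by rewrite stop ?inE ?eqxx //= addn1.
by rewrite IH ?inE ?negb_or 1?eq_sym ?xy //= addSnnS.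
Qed.

Lemma dag_of_position e0 e : e \in T ->
  onth (dag_of e0) (position heads e.1.1) = Some (dag_node T e).
Proof.
move=> eT; have eh : e.1.1 \in heads by apply: map_f.
rewrite position_index //= onth_map.
have iT : index e T < size T by rewrite index_mem.
(* No fact is collected twice, so a fact determines its entry. *)
have -> : index e.1.1 heads = index e T.
  have := @index_uniq _ e.1.1 (index e T) heads.
  rewrite size_map iT (nth_map e) // nth_index // => -> //.
  exact: valid_uniq T_valid.1.
have -> : onth T (index e T) = Some (nth e T (index e T)) by rewrite onthE (nth_map e).
by rewrite nth_index.
Qed.

Definition derivable (x : fact) (t : tree sym) :=
  [/\ forall u, x.1.1.1 = dtree u -> derives (SAnd tau k par) G u t,
      wt strict x.1.1.2 t & describes x.1.2 x.2 x.1.1.2 t].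

Lemma rule_derivable (a : sym) (q : sta) (x : fact) ys ts : x \in facts k Z ->
  {subset ys <= facts k Z} -> size ys = rank a -> rule strict a q X x ys -> size ts = rank a ->
  (forall i, i < rank a -> derivable (nth (no_fact k k') ys i) (nth dtr ts i)) ->
  derivable x (Node a ts).
Proof.
case: x => [[[u q'] c] v]; rewrite mem_facts => /and3P[uX cC vV] yF sy.
move=> /and5P[/eqP ka /eqP sk /eqP E al /andP[/allP hk dyn]] st D.
have {}hk i : i < rank a -> (nth (no_fact k k') ys i).1.1.1 = nth nild (kids u) i.+1 /\
    (nth (no_fact k k') ys i).1.1.2 = child strict a q i.
  by move=> hi; have := hk i; rewrite mem_iota => /(_ hi)/andP[/eqP -> /eqP ->].
rewrite /= in E ka sk al; rewrite E.
have inC i : i < rank a -> (nth (no_fact k k') ys i).1.2 \in pow (atoms1 par X).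
  move=> hi; have : nth (no_fact k k') ys i \in facts k Z by apply: yF; rewrite mem_nth ?sy.
  by case: (nth _ _ _) => [[[? ?] ?] ?]; rewrite mem_facts => /and3P[].
split=> /=.
- move=> [l qs] Eu; move: ka sk hk; rewrite Eu /= size_map => ka [sq] hk.
  (* A nonterminal carries the tag 11, which no symbol has. *)
  case: l ka {Eu} => [b|B] /=; last by case: (a).
  move=> /dsym_inj ->; apply: DNode; rewrite ?sq ?st // => i hi.
  have [h _ _] := D i hi; apply: h.
  by rewrite (hk i hi).1 (nth_map (dflt_rhs (SAnd tau k par))) // sq.
- apply: Wt => //; rewrite st => i hi; have [_ h _] := D i hi.
  by rewrite -(hk i hi).2.
- case: (boolP (is_let a)) => la; last first.
    move: dyn; rewrite nonlet_rule // => dyn.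
    apply: (local_rule_sound la al st dyn) => i hi.
    by rewrite -(hk i hi).2; have [] := D i hi.
  have Ets : rank a = 2 -> ts = [:: nth dtr ts 0; nth dtr ts 1].
    by rewrite -st; case: (ts) => [|t [|t' []]].
  case: a la st al sy D hk inC dyn Ets {ka sk E} => // P xs _ st al sy D hk inC dyn ->//.
  apply: (let_rule_sound (x := (u, q', c, v)) (y := nth (no_fact k k') ys 0)
    (z := nth (no_fact k k') ys 1)) => //; try exact: inC.
  + by rewrite -(hk 0 isT).2; have [] := D 0 isT.
  + by rewrite -(hk 1 isT).2; have [] := D 1 isT.
Qed.

Lemma alias_derivable (x y : fact) r t : r \in grammar_rules X ->
  x.1.1.1 = nonterm (nth nild (kids r) 0) -> y.1.1.1 = nth nild (kids r) 1 ->
  y.1.1.2 = x.1.1.2 -> y.1.2 = x.1.2 -> y.2 = x.2 ->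
  derivable y t -> derivable x t.
Proof.
move=> /grammar_rules_X[B [u [Bu ->]]] /= xq yq E1 E2 E3 []; rewrite E1 E2 E3 => yd yw ys.
split=> // -[l qs]; rewrite xq => -[El Eqs].
case: qs Eqs => // _; case: l El => [b|B'] /=.
  by case: b.
move=> /(@dnats_inj [:: 11; B] [:: 11; B'])[<-].
by apply: DRule Bu (yd u yq).
Qed.

(** Aliases and node 0 repeat the contents of other nodes and hence unfold to the same trees. *)
Lemma unfolds_same (g : dag tau k par) i j t : onth g i = onth g j ->
  unfolds g i t -> unfolds g j t.
Proof. by move=> E H; case: H E => n a js ts gn F E; apply: Unfolds F; rewrite -E. Qed.

(** Entries are collected in reverse order, so the premises of the head of [s] lie in its tail and
    the induction runs over suffixes of [T], while the dag remains that of all of [T]. *)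
Lemma sound e0 s : valid key (justified strict X) s -> {subset s <= T} ->
  forall e, e \in s -> exists t, unfolds (dag_of e0) (position heads e.1.1) t /\
    derivable e.1.1 t.
Proof.
elim: s => //= e s IH /andP[/andP[_ je] vs] sT.
have sT' : {subset s <= T} by move=> y ys; apply: sT; rewrite inE ys orbT.
have {}IH := IH vs sT'.
move=> e'; rewrite inE => /orP[/eqP ->|/IH //].
have eT : e \in T by apply: sT; rewrite inE eqxx.
have [xF ysF] := T_facts eT.
move: ysF; rewrite mem_tuples => /andP[/eqP sy /allP ysF].
have node := dag_of_position e0 eT.
case/orP: je => [/andP[/allP ysT /hasP[a _ /hasP[q _ /andP[/eqP Ea r]]]]|/hasP[f fs]].
  have [y|ts st H] := all_exists_seq (no_fact k k') dtr (s := e.2) (R := fun y t =>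
      unfolds (dag_of e0) (position heads y) t /\ derivable y t).
    by move=> /mem_In /ysT /mapP[f /IH[t Ht] ->]; exists t.
  exists (Node a ts); split.
    apply: (Unfolds (js := [seq position heads y | y <- e.2])); first by rewrite node -Ea.
    apply: (@Forall2_nth _ _ 0 dtr); rewrite size_map // => i hi.
    by rewrite (nth_map (no_fact k k')) //; case: (H i hi).
  apply: (rule_derivable xF _ _ r); rewrite -?Ea ?st ?sy //.
  by move=> i hi; case: (H i); rewrite ?sy.
move=> /and5P[/eqP E1 /eqP E2 /eqP E3 /eqP E4 /andP[/eqP E5 /hasP[r rX /andP[/eqP E6 /eqP E7]]]].
have [t [Ut Dt]] := IH f fs; exists t; split.
  apply: unfolds_same Ut; rewrite node (dag_of_position e0 (sT' f fs)).
  by rewrite /dag_node E1 E2.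
exact: (alias_derivable rX E6 E7 E3 E4 E5 Dt).
Qed.

Lemma zero_asg A : A \in strs X -> nseq k 0 \in asg k A.
Proof.
move=> /dm0 h; rewrite mem_tuples size_nseq eqxx; apply/allP => x.
by rewrite mem_nseq => /andP[_ /eqP ->].
Qed.

Lemma lookup_models (v : seq atom2) (p : phi tau k par) (B : structure tau) :
  dstructure B \in strs X -> describes [::] v (q0 k k') (tree_of_phi p) ->
  (lookup v (dstructure B, 0) (nseq k 0) == 1) = models B p.
Proof.
move=> BX D; rewrite D ?zero_asg //; last first.
  by apply/worlds_ofP; rewrite mem_worlds BX.
by rewrite models_tree_val.
Qed.

Lemma all_structures (f : data -> bool) (h : structure tau -> bool) s :
  {subset map (@dstructure tau) s <= strs X} ->
  (forall B, dstructure B \in strs X -> f (dstructure B) = h B) ->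
  all f (map (@dstructure tau) s) = all h s.
Proof.
move=> sX fh; elim: s sX => //= B s IH sX.
rewrite fh ?IH // => [y ys|]; apply: sX; rewrite inE ?ys ?orbT ?eqxx //.
Qed.

Lemma pos_strs : {subset map (@dstructure tau) (pos X0) <= strs X}.
Proof. by move=> y ys; rewrite /strs mem_cat ys. Qed.

Lemma neg_strs : {subset map (@dstructure tau) (neg X0) <= strs X}.
Proof. by move=> y ys; rewrite /strs mem_cat orbC ys. Qed.

Lemma separatingP u v (p : phi tau k par) : u = start_node X ->
  describes [::] v (q0 k k') (tree_of_phi p) ->
  separating X (u, q0 k k', [::], v) =
  all (fun A => models A p) (pos X0) && all (fun A => ~~ models A p) (neg X0).
Proof.
move=> -> D; rewrite /separating /= !eqxx /=.
rewrite (all_structures pos_strs (h := fun A => models A p)); last first.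
  by move=> B BX; apply: lookup_models.
congr andb; apply: (all_structures neg_strs) => B BX.
by rewrite (lookup_models BX D).
Qed.

Lemma solve_correct : correct_output strict X0 (word_of (enc (solve tau k par strict X))).
Proof.
rewrite /solve /answer -/Z -/T.
case E: [seq e <- T | separating X e.1.1] => [|e r].
  right; split=> // -[p [ps pl ppos pneg]].
  have wp : wt strict (q0 k k') (tree_of_phi p) by apply/sentence_wt; exists p.
  have /(lang_derives (SAnd tau k par)) dp := pl.
  have sX : dtree (Node (inr (axm G)) [::] : tree (sym + nat)) \in nodes X.
    by rewrite inE start_node_dtree eqxx.
  (* The empty context interprets every definable symbol by the empty set, as [models] does. *)
  have nC : [::] \in pow (atoms1 par X).
    by have := filter_pow pred0 (atoms1 par X); rewrite filter_pred0.
  have /mapP[e eT Ee] := complete dp wp sX nC.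
  have : e \in [seq e <- T | separating X e.1.1].
    rewrite mem_filter eT andbT -Ee (@separatingP _ _ p) //; first by rewrite ppos.
    exact: canonical_describes.
  by rewrite E.
left; have : e \in [seq e <- T | separating X e.1.1] by rewrite E inE eqxx.
rewrite mem_filter => /andP[se eT].
have [t [Ut [dt wt_t Dt]]] := sound e T_valid.1 (fun _ h => h) eT.
case: e {E} se eT Ut dt wt_t Dt => [[[[[u q] c] v] a] ys] se eT Ut /= dt wt_t Dt.
have := se => /and5P[/= /eqP Eu /eqP Eq /eqP Ec _ _].
subst q c; have [p Et ps] := (sentence_wt strict t).1 wt_t; subst t.
exists (dag_of (u, q0 k k', [::], v, a, ys)), p; split.
- by [].
- apply: unfolds_same Ut; rewrite dag_of_position //.
- move: se; rewrite (separatingP Eu Dt) => /andP[hp hn]; split=> //.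
  by apply/(lang_derives (SAnd tau k par)); apply: dt; rewrite Eu.
Qed.

End Correctness.

(** Trades the base n + 2 for the form of bound in the theorem: the summand [3 ^ c] covers n = 0 and
    n = 1, and for larger n the exponent [2 * c] works because n + 2 is at most the square of n. *)
Lemma exp_bound n c : 2 ^ ((n + 2) ^ c) <= 2 ^ (n ^ (2 * c + 3 ^ c) + (2 * c + 3 ^ c)).
Proof.
rewrite leq_exp2l //; case: n => [|[|n]].
- rewrite add0n; apply: leq_trans (leq_addl _ _); apply: leq_trans (leq_addl _ _).
  by case: c => // c; rewrite leq_exp2r.
- by apply: leq_trans (leq_addl _ _); apply: leq_trans (leq_addl _ _).
- apply: leq_trans (leq_addr _ _); apply: (@leq_trans (n.+2 ^ (2 * c))).
    by rewrite expnM; case: c => // c; rewrite leq_exp2r //; lia.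
  by rewrite leq_pexp2l // leq_addr.
Qed.

Theorem theorem6p2 (tau : signature) (k k' : nat) (par : 'I_k' -> nat)
    (strict : bool) :
  exists (M : TM) (c : nat), forall X : instance tau k par,
    wf_grammar (@rank tau k k' par) (gram X) ->
    exists w : seq bool,
      computes_in M (input X) (2 ^ (size (input X) ^ c + c)) w /\
      correct_output strict X w.
Proof.
have [P [c HP]] := @ET_solve tau k k' par strict.
exists (TM_of P), (2 * c + 3 ^ c) => X _.
have [b [t ht H]] := HP (dinstance X) [::] [::] [::] [::].
exists (word_of (enc (solve tau k par strict (dinstance X)))); split.
  rewrite cats0 in H; have := exec_computes_in H => /= /(_ (2 ^ _)); rewrite cats0; apply.
  by apply: leq_trans ht _; apply: exp_bound.
exact: solve_correct.
Qed.
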